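(* Let $D$ be a Dirichlet–Ferguson process with parameter $\alpha$ on $(A,\mathcal{A})$ and let $\mathbf{X}=\{X_n:n\ge1\}$ be the associated Pólya sequence with the same parameter $\alpha$. For every $N\ge1$, the space $\bigoplus_{l=0}^N\mathcal{M}_l(D)=\mathcal{P}_N(D)$ is generated (as a closed linear subspace of $L^2(D)$) by the random variables with the representation $$Y=L^2\text{-}\lim_{K\to+\infty}\frac{1}{\binom KN}\sum_{1\le j_1<\cdots<j_N\le K}h(X_{j_1},\ldots,X_{j_N}),\qquad h\in\mathcal{H}_N.$$
   Context: $(A,\mathcal{A})$ is a Polish space with its Borel $\sigma$-field and $\alpha$ is a finite positive measure on it ($0<\alpha(A)<\infty$). On a probability space $(\Omega,\mathcal{F},\mathbb{P})$, the Pólya sequence $\mathbf{X}=\{X_n:n\ge1\}$ with parameter $\alpha$ is a sequence of $A$-valued random variables such that, for every $k\ge1$ and $1\le j_1<\cdots<j_k$, $$\mathbb{P}(X_{j_1}\in da_1,\ldots,X_{j_k}\in da_k)=\prod_{i=1}^k\frac{\alpha(da_i)+\sum_{l=1}^{i-1}\delta_{a_l}(da_i)}{\alpha(A)+i-1}.$$ Write $\mathbf{X}_n=(X_1,\ldots,X_n)$. A Dirichlet–Ferguson process with parameter $\alpha$ is a random probability measure $D$ on $(A,\mathcal{A})$ such that for every finite measurable partition $(C_1,\ldots,C_n)$ of $A$ the vector $(D(C_1),\ldots,D(C_n))$ has a Dirichlet distribution with parameters $(\alpha(C_1),\ldots,\alpha(C_n))$. Standing convention: $D$ is the a.s. limit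 of the empirical measures $\frac1n\sum_{i=1}^n\mathbf{1}_C(X_i)$ of $\mathbf{X}$ (a.s. convergence for all $C\in\mathcal{A}$); then, conditionally on $D$, the $X_i$ are i.i.d. with law $D$. $L^2(D)$ is the Hilbert space of square-integrable random variables measurable with respect to $\sigma(D(C):C\in\mathcal{A})$; $D^{\otimes n}$ is the $n$-fold random product measure. $\Xi_n(\mathbf{X})$ is the class of symmetric measurable $h:A^n\to\mathbb{R}$ with $\mathbb{E}(h(\mathbf{X}_n)^2)<\infty$ and $\mathbb{E}(h(\mathbf{X}_n)\mid\mathbf{X}_{n-1})=0$ a.s. (for $n=1$: $\mathbb{E}(h(X_1))=0$). $\mathcal{M}_0(D)=\mathbb{R}$ and, for $n\ge1$, $\mathcal{M}_n(D)=\{Y\in L^2(D):Y=\int_{A^n}h\,\mathrm{d}D^{\otimes n},\ h\in\Xi_n(\mathbf{X})\}$; these are closed, mutually orthogonal subspaces of $L^2(D)$. $\mathcal{P}_N(D)$ is the closed linear span in $L^2(D)$ of the random variables $\prod_{j=1}^n(D(C_j))^{k_j}$ with $n\ge0$, $C_j\in\mathcal{A}$, integers $k_j\ge1$ and $\sum_jk_j\le N$. $\mathcal{H}_N$ is the class of functions on $A^N$ of the form $h(a_1,\ldots,a_N)=\sum_\sigma\prod_{j=1}^N\mathbf{1}_{C_{\sigma(j)}}(a_j)$ with $C_1,\ldots,C_N\in\mathcal{A}$, where $\sigma$ runs over all permutations of $\{1,\ldots,N\}$. *)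

(* Defs.v *)
From HB Require Import structures.
From mathcomp Require Import all_boot all_order all_algebra.
From mathcomp Require Import fingroup perm.
From mathcomp Require Import all_classical all_reals all_analysis.
From mathcomp Require Import measurable_realfun.

Set Implicit Arguments.
Unset Strict Implicit.
Unset Printing Implicit Defensive.

Import Order.TTheory GRing.Theory Num.Theory.
Import numFieldNormedType.Exports.

Local Open Scope classical_set_scope.
Local Open Scope ring_scope.

Definition polish (R : realType) (A : topologicalType) : Prop :=
  (exists2 S : set A, countable S & dense S) /\
  exists dist : A -> A -> R,
    [/\ [/\ forall x y, 0 <= dist x y,
            forall x y, dist x y = 0 <-> x = y,
            forall x y, dist x y = dist y x &
            forall x y z, dist x z <= dist x y + dist y z],
        forall x (V : set A),
          nbhs x V <-> exists2 e : R, 0 < e & [set y | dist x y < e] `<=` V &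
        forall u : nat -> A,
          (forall e : R, 0 < e -> exists N, forall m n, (N <= m)%N -> (N <= n)%N ->
             dist (u m) (u n) < e) ->
          exists l : A, u k @[k --> \oo] --> l].

Notation borel A := (g_sigma_algebraType (@open A)).

Section product_probability.
Context {d} {T : measurableType d} {R : realType}.

Definition tuple_cons n (x : T * n.-tuple T) : n.+1.-tuple T :=
  [tuple of x.1 :: x.2].

Lemma measurable_tuple_cons n : measurable_fun setT (@tuple_cons n).
Proof. exact: (measurable_cons measurable_fst measurable_snd). Qed.

HB.instance Definition _ n :=
  isMeasurableFun.Build _ _ _ _ (@tuple_cons n) (@measurable_tuple_cons n).

Fixpoint product_prob n : ('I_n -> probability T R) ->
    probability (n.-tuple T) R :=
  match n with
  | 0 => fun _ => \d_[tuple]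
  | n'.+1 => fun mu => distribution (T' := n'.+1.-tuple T)
      (mu ord0 \x product_prob (fun i : 'I_n' => mu (lift ord0 i)))%E
      (@tuple_cons n')
  end.

Definition prob_pow (mu : probability T R) n : probability (n.-tuple T) R :=
  product_prob (fun _ : 'I_n => mu).

End product_probability.

Section gamma.
Context {R : realType}.
Implicit Type a : R.

Definition gamma_density a (x : R) : R :=
  if 0 < x then x `^ (a - 1) * expR (- x) else 0.

Lemma gamma_density_ge0 a x : 0 <= gamma_density a x.
Proof.
rewrite /gamma_density; case: ifP => // _.
by rewrite mulr_ge0 ?powR_ge0 ?expR_ge0.
Qed.

Lemma measurable_gamma_density a : measurable_fun setT (gamma_density a).
Proof.
apply: measurable_fun_ifT => //.
- exact: measurable_fun_ltr.
- apply: measurable_funM; first exact: measurable_powR.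
  by apply: measurableT_comp => //; exact: measurableT_comp.
Qed.

Definition gamma_mass a (V : set R) : \bar R :=
  (\int[lebesgue_measure]_(x in V) (gamma_density a x)%:E)%E.

Let gamma_mass0 a : gamma_mass a set0 = 0%E.
Proof. by rewrite /gamma_mass integral_set0. Qed.

Let gamma_mass_ge0 a V : (0 <= gamma_mass a V)%E.
Proof. by apply: integral_ge0 => x _; rewrite lee_fin gamma_density_ge0. Qed.

Let gamma_mass_sigma_additive a : semi_sigma_additive (gamma_mass a).
Proof.
move=> /= F mF tF mUF; rewrite /gamma_mass; apply: cvg_toP.
  apply: ereal_nondecreasing_is_cvgn => m n mn.
  apply: lee_sum_nneg_natr => // k _ _; exact: gamma_mass_ge0.
rewrite ge0_integral_bigcup//=.
- apply/measurable_funTS/measurableT_comp => //.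
  exact: measurable_gamma_density.
- by move=> x _; rewrite lee_fin gamma_density_ge0.
Qed.

HB.instance Definition _ a := isMeasure.Build _ _ _ (gamma_mass a)
  (gamma_mass0 a) (gamma_mass_ge0 a) (@gamma_mass_sigma_additive a).

End gamma.

Section dirichlet.
Context {R : realType}.
Implicit Type a : R.

(* The Gamma(a, 1) law, for a >= 0, with Gamma(0, 1) the point mass at 0.     *)
(* For a > 0 the total mass of gamma_mass a is the finite positive number     *)
(* Gamma(a), so the default measure of mnormalize plays no role.              *)
Definition gamma_prob a : probability R R :=
  if a == 0 then (\d_(0 : R) : probability R R)
  else (mnormalize (gamma_mass a) \d_(0 : R) : probability R R).

(* Ferguson's definition, which allows some (not all) parameters to vanish:   *)
(* the law of (Z_i / sum_j Z_j)_i for independent Z_i of law Gamma(a_i, 1).   *)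
Definition dirichlet n (a : 'I_n -> R) : set (n.-tuple R) -> \bar R :=
  pushforward (product_prob (fun i => gamma_prob (a i)))
    (fun z : n.-tuple R =>
       [tuple tnth z i / \sum_(j < n) tnth z j | i < n] : n.-tuple R).

End dirichlet.

Section dirichlet_ferguson.
Context {d d'} {Omega : measurableType d} {A : measurableType d'}
  {R : realType}.
Variables (P : probability Omega R)
  (alpha : {finite_measure set A -> \bar R}).

Definition dirichlet_ferguson (D : R.-pker Omega ~> A) : Prop :=
  forall n (C : 'I_n -> set A),
    (forall i, measurable (C i)) -> trivIset setT C ->
    \bigcup_i C i = setT ->
    forall B : set (n.-tuple R), measurable B ->
      P [set w | B [tuple fine (D w (C i)) | i < n]] =
      dirichlet (fun i => fine (alpha (C i))) B.

Lemma polya_weight_ge0 (s : seq A) :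
  0 <= (fine (alpha setT) + (size s)%:R)^-1.
Proof. by rewrite invr_ge0 addr_ge0 ?fine_ge0. Qed.

(* (alpha + sum_(a in s) delta_a) / (alpha(A) + size s): law of the next draw *)
(* after the draws listed in s.                                               *)
Definition polya_step (s : seq A) : {measure set A -> \bar R} :=
  mscale (NngNum (polya_weight_ge0 s))
    (measure_add alpha (msum (fun i => \d_(nth point s i)) (size s))).

Fixpoint polya_box (s : seq A) (Bs : seq (set A)) : \bar R :=
  if Bs is B :: Bs' then
    (\int[polya_step s]_(a in B) polya_box (rcons s a) Bs')%E
  else 1%E.

(* The random variable X_n of the mathematical text is X n.-1.                *)
Definition polya_sequence (X : nat -> {RV P >-> A}) : Prop :=
  forall k (j : 'I_k -> nat) (B : 'I_k -> set A), (0 < k)%N ->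
    (forall i i' : 'I_k, (i < i')%N -> (j i < j i')%N) ->
    (forall i, measurable (B i)) ->
    P [set w | forall i, B i (X (j i) w)] =
    polya_box [::] [seq B i | i <- enum 'I_k].

Definition empirical_limit (X : nat -> {RV P >-> A}) (D : R.-pker Omega ~> A) :
    Prop :=
  forall C : set A, measurable C ->
    {ae P, forall w,
      n%:R^-1 * \sum_(i < n) \1_C (X i w) @[n --> \oo] --> fine (D w C)}.

End dirichlet_ferguson.

Section kernel_at.
Context {d d'} {Omega : measurableType d} {A : measurableType d'}
  {R : realType}.
Variables (D : R.-pker Omega ~> A) (w : Omega).

(* D w, repackaged so as to inherit a structure of probability measure. *)
Definition kernel_at : set A -> \bar R := D w.

HB.instance Definition _ := Measure.on kernel_at.

HB.instance Definition _ :=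
  Measure_isProbability.Build _ _ _ kernel_at (prob_kernel w).

End kernel_at.

(* Elements of L^2(D) are represented by functions Omega -> R. Every closed   *)
(* subspace below is saturated, within L2 D, for equality P-almost surely,    *)
(* so that equalities of sets of functions are equalities of subspaces of     *)
(* the space of classes.                                                      *)

Section L2D.
Context {d d'} {Omega : measurableType d} {A : measurableType d'}
  {R : realType}.
Variables (P : probability Omega R) (D : R.-pker Omega ~> A).
Implicit Types (Y Z : Omega -> R) (V S : set (Omega -> R)).

Definition measurable_wrt (G : set (set Omega)) Y : Prop :=
  forall B : set R, measurable B -> G (Y @^-1` B).

Definition sigma_D : set (set Omega) :=
  <<s \bigcup_(C in @measurable _ A)
        preimage_set_system setT (fun w => D w C) measurable >>.

Definition L2 : set (Omega -> R) :=
  [set Y | measurable_wrt sigma_D Y /\ Y \in Lfun P 2%:E].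

Definition L2_cvg (F : nat -> Omega -> R) Y : Prop :=
  ('N[P]_2%:E[EFin \o (F k \- Y)%R])%E @[k --> \oo] --> 0%E.

Definition closed_subspace V : Prop :=
  [/\ V `<=` L2, V (cst 0),
      forall (a : R) Y Z, V Y -> V Z -> V (fun w => a * Y w + Z w) &
      forall (F : nat -> Omega -> R) Y,
        (forall k, V (F k)) -> L2 Y -> L2_cvg F Y -> V Y].

Definition closed_span S : set (Omega -> R) := smallest closed_subspace S.

Definition orthogonal_direct_sum (M : nat -> set (Omega -> R)) N S : Prop :=
  (forall l m Y Z, (l <= N)%N -> (m <= N)%N -> l != m -> M l Y -> M m Z ->
     ('E_P[(Y \* Z)%R] = 0)%E) /\
  S = [set Y | exists2 Z : nat -> Omega -> R,
                 (forall l, (l <= N)%N -> M l (Z l)) &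
                 Y = (fun w => \sum_(l < N.+1) Z l w)].

Definition D_monomial N : set (Omega -> R) :=
  [set Y | exists n (C : 'I_n -> set A) (k : 'I_n -> nat),
     [/\ forall j, measurable (C j), forall j, (1 <= k j)%N,
         (\sum_(j < n) k j <= N)%N &
         Y = (fun w => \prod_(j < n) fine (D w (C j)) ^+ k j)]].

Definition P_ N : set (Omega -> R) := closed_span (D_monomial N).

End L2D.

Section M_spaces.
Context {d d'} {Omega : measurableType d} {A : measurableType d'}
  {R : realType}.
Variables (P : probability Omega R) (X : nat -> {RV P >-> A}).

Definition cond_expectation (G : set (set Omega)) (Y Z : Omega -> R) : Prop :=
  [/\ measurable_wrt G Z, P.-integrable setT (EFin \o Z) &
      forall B, G B ->
        (\int[P]_(w in B) (Z w)%:E = \int[P]_(w in B) (Y w)%:E)%E].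

Definition X_prefix n (w : Omega) : n.-tuple A := [tuple X i w | i < n].

Definition symmetric_fun n (h : n.-tuple A -> R) : Prop :=
  forall (s : 'S_n) (a : n.-tuple A), h [tuple tnth a (s i) | i < n] = h a.

(* For n = 1 the conditioning sigma-field is trivial, and the last condition  *)
(* reads E(h(X_1)) = 0.                                                       *)
Definition Xi n (h : n.-tuple A -> R) : Prop :=
  [/\ symmetric_fun h, measurable_fun setT h,
      ('E_P[fun w => (h (X_prefix n w) ^+ 2)%R] < +oo)%E &
      cond_expectation (g_sigma_algebra_preimage (X_prefix n.-1))
        (h \o X_prefix n) (cst 0)].

Definition M_ (D : R.-pker Omega ~> A) n : set (Omega -> R) :=
  if n is 0 then
    [set Y | L2 P D Y /\ exists c : R, {ae P, forall w, Y w = c}]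
  else
    [set Y | L2 P D Y /\ exists2 h : n.-tuple A -> R, Xi h &
       {ae P, forall w, Y w = \int[prob_pow (kernel_at D w) n]_a h a}].

Definition H_ N (h : N.-tuple A -> R) : Prop :=
  exists2 C : 'I_N -> set A, (forall j, measurable (C j)) &
    h = (fun a => \sum_(s : 'S_N) \prod_(j < N) \1_(C (s j)) (tnth a j)).

Definition U_statistic N (h : N.-tuple A -> R) (K : nat) (w : Omega) : R :=
  ('C(K, N)%:R)^-1 *
  \sum_(j : N.-tuple 'I_K | sorted ltn (map val j))
     h [tuple X (tnth j i) w | i < N].

Definition U_limit (D : R.-pker Omega ~> A) N : set (Omega -> R) :=
  [set Y | L2 P D Y /\
     exists2 h : N.-tuple A -> R, H_ h & L2_cvg P (U_statistic h) Y].

End M_spaces.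

(* Main.v *)
(* Everything is read off the laws mu_n of (X_1, ..., X_n). Averaging over
   disjoint blocks of variables gives mu_n = E(D^n), and the prediction rule of
   the urn gives mu_(n+1)(da, dt) = mu_n(dt) (alpha + sum_i delta_(t_i))(da) / (c + n),
   where c = alpha(A).
   - Let F be symmetric on A^n with E(F | first n-1 coordinates) = 0, and G be
     square-integrable on A^m. Integrating out the n variables of F one at a time,
     each time against alpha + sum delta, cancels the contribution of the
     variables already present and leaves
       prod_(q < n) (c + m + q) * E(int F dD^n int G dD^m)
         = n! * sum_S int G(t) F(t_S) mu_m(dt),
     S running over the n-subsets of the m coordinates. The sum is empty if m < n
     (orthogonality) and is int G F dmu_n if m = n, so that int F dD^n determines
     the norm of F, up to a constant; hence the sum of the spaces M_l is closed.
   - A bounded symmetric F on A^M is the degenerate kernel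
     sum_k c_k sum_(|S| = k) h_k(t_S), with h_M = F and h_(k-1) obtained from h_k by
     one step of the urn, plus terms of lower order; by induction on M, int F dD^M
     lies in the sum of the M_l. This applies to the monomials of degree at most N,
     padded to degree N with factors D(A) = 1.
   - Conversely boxes span a dense subspace of L^2(mu_l), and F |-> int F dD^l is a
     contraction from L^2(mu_l) to L^2(D).
   - For h the symmetrised indicator of a box, the U-statistic differs from
     K^N / C(K, N) times the product of the empirical measures by the
     contribution of non-injective index maps, which is O(1/K). *)

From HB Require Import structures.
From mathcomp Require Import all_boot all_order all_algebra.
From mathcomp Require Import fingroup perm.
From mathcomp Require Import all_classical all_reals all_analysis.
From mathcomp Require Import measurable_realfun.
From mathcomp Require Import ring lra.
Require Import Defs.

Set Implicit Arguments.
Unset Strict Implicit.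
Unset Printing Implicit Defensive.

Import Order.TTheory GRing.Theory Num.Theory.
Import numFieldNormedType.Exports.

Local Open Scope classical_set_scope.
Local Open Scope ring_scope.

(** * Measures on tuples and square-integrable functions *)

(** [D] enters only through its integrals, and the expectation of a product of two of them is an
    integral over two disjoint groups of variables of mu_(n+m). The obstacle is that a degenerate
    kernel is centred given the other variables that it sees, whereas the urn also remembers the
    variables seen by the second kernel. Under the unnormalised measure alpha + sum delta, a longer
    history only adds point evaluations, so centring leaves exactly those. This explains the
    constants: c + m + q is the total mass of that measure after m + q draws, and n! counts the
    orders in which the n variables of F can be identified with the elements of S. The case m = n
    turns a Cauchy sequence of sums of random integrals into Cauchy sequences of kernels, one for
    each degree; as symmetry and degeneracy survive mean-square limits, closedness follows without
    orthogonal projections. The lower-order terms of the Hoeffding expansion are computed for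
    bounded kernels only, where every integral exists at every point; unbounded kernels arise only
    as limits. *)

Section boxes.
Context {d} {T : measurableType d}.

Definition tbox n (B : 'I_n -> set T) : set (n.-tuple T) :=
  [set t | forall i, B i (tnth t i)].

Lemma measurable_tbox n (B : 'I_n -> set T) :
  (forall i, measurable (B i)) -> measurable (tbox B).
Proof.
move=> mB; rewrite (_ : tbox B = \bigcap_(i in [set: 'I_n]) [set t | B i (tnth t i)]).
  apply: fin_bigcap_measurable => // i _.
  have := @measurable_tnth _ T n i measurableT _ (mB i).
  by rewrite setTI.
by apply/seteqP; split=> t h i; [move=> _|]; exact: h.
Qed.

Definition tboxes n : set (set (n.-tuple T)) :=
  [set U | exists2 B : 'I_n -> set T, (forall i, measurable (B i)) & U = tbox B].

Lemma tboxesI n : setI_closed (@tboxes n).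
Proof.
move=> _ _ [B mB ->] [C mC ->]; exists (fun i => B i `&` C i).
  by move=> i; exact: measurableI.
by apply/seteqP; split=> t; [move=> [hB hC] i; split|move=> h; split=> i; have [] := h i].
Qed.

Lemma tboxesT n : @tboxes n setT.
Proof. by exists (fun=> setT) => //; apply/seteqP; split. Qed.

Lemma measurable_tboxesE n : measurable = <<s @tboxes n >>.
Proof.
apply/seteqP; split; last first.
  apply: smallest_sub; first exact: sigma_algebra_measurable.
  by move=> _ [B mB ->]; exact: measurable_tbox.
apply: smallest_sub; first exact: smallest_sigma_algebra.
rewrite [X in X `<=` _]/=; apply: (big_ind (fun S => S `<=` <<s @tboxes n >>)).
- by [].
- by move=> S S' hS hS' U [/hS|/hS'].
- move=> i _ _ [B mB <-]; apply: sub_sigma_algebra.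
  exists (fun j => if j == i then B else setT).
    by move=> j; case: ifP.
  apply/seteqP; split=> t /=.
    by move=> [_ Bt] j; case: eqP => // ->.
  by move=> /(_ i); rewrite eqxx.
Qed.

Lemma tuple_measure_unique (R : realType) n
    (m1 m2 : {measure set (n.-tuple T) -> \bar R}) :
  (m1 setT < +oo)%E ->
  (forall B : 'I_n -> set T, (forall i, measurable (B i)) ->
    m1 (tbox B) = m2 (tbox B)) ->
  forall U, measurable U -> m1 U = m2 U.
Proof.
move=> m1oo m12 U; apply: (measure_unique (@tboxes n) (fun=> setT)) => //.
- exact: measurable_tboxesE.
- exact: tboxesI.
- by move=> _; exact: tboxesT.
- by rewrite bigcup_const//; exists 0%N.
- by move=> _ [B mB ->]; exact: m12.
Qed.

(** Dynkin's argument; stability under complements uses that every [k y] has total mass 1. *)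
Lemma measurable_kernel_tbox d' (Y : measurableType d') (R : realType) n
    (k : Y -> probability (n.-tuple T) R) :
  (forall B : 'I_n -> set T, (forall i, measurable (B i)) ->
    measurable_fun setT (fun y => k y (tbox B))) ->
  forall U, measurable U -> measurable_fun setT (fun y => k y U).
Proof.
move=> mk U; rewrite measurable_tboxesE -setI_closed_g_dynkin_g_sigma_algebra; last first.
  exact: tboxesI.
suff : <<d @tboxes n >> `<=`
    [set U | measurable U /\ measurable_fun setT (fun y => k y U)].
  by move=> h /h[].
apply: smallest_sub; last first.
  by move=> _ [B mB ->]; split; [exact: measurable_tbox|exact: mk].
split.
- split => //; under eq_fun do rewrite probability_setT; exact: measurable_cst.
- move=> V [mV mkV]; split; first exact: measurableC.
  under eq_fun do rewrite probability_setC//.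
  by apply: emeasurable_funB.
- move=> F tF mF; split; first by apply: bigcup_measurable => i _; have [] := mF i.
  have -> : (fun y => k y (\bigcup_i F i)) = (fun y => (\sum_(0 <= i <oo) k y (F i))%E).
    apply/funext => y; apply/esym/cvg_lim => //.
    apply: measure_semi_sigma_additive => //.
    + by move=> i; have [] := mF i.
    + by apply: bigcup_measurable => i _; have [] := mF i.
  by apply: ge0_emeasurable_sum => // i _; have [] := mF i.
Qed.

End boxes.

(** * Laws that are averages of a family of laws *)

Section disintegration.
Context {d d'} {Y : measurableType d} {Z : measurableType d'} {R : realType}.
Variables (nu : probability Y R) (k : Y -> probability Z R).

Section kernel_of_family.
Hypothesis mk : forall U, measurable U -> measurable_fun setT (fun y => k y U).

(** The measurability proof is an argument so that the kernel structure can be attached to the term;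
    the factor [unit] gives the domain the product shape expected by the composition of kernels. *)
Definition fam_kernel of (forall U, measurable U -> measurable_fun setT (fun y => k y U)) :
  unit * Y -> {measure set Z -> \bar R} := fun y => k y.2.

Let measurable_fam_kernel U : measurable U -> measurable_fun setT (fam_kernel mk ^~ U).
Proof. by move=> mU; apply: (measurableT_comp (mk mU)). Qed.

HB.instance Definition _ := isKernel.Build _ _ _ _ _ (fam_kernel mk) measurable_fam_kernel.

Let fam_kernel_prob x : fam_kernel mk x setT = 1%E.
Proof. exact: probability_setT. Qed.

HB.instance Definition _ := Kernel_isProbability.Build _ _ _ _ _ (fam_kernel mk)
  fam_kernel_prob.

Let nuk : R.-pker unit ~> Y :=
  kprobability (measurable_cst (nu : pprobability Y R)).

Lemma ge0_disintegration (mu : {measure set Z -> \bar R}) :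
  (forall U, measurable U -> mu U = \int[nu]_y k y U)%E ->
  forall f : Z -> \bar R, (forall z, 0 <= f z)%E -> measurable_fun setT f ->
  (\int[mu]_z f z = \int[nu]_y \int[k y]_z f z)%E.
Proof.
move=> muE f f0 mf.
have := @integral_kcomp _ _ _ _ _ _ R nuk (fam_kernel mk) tt f f0 mf.
move=> <-.
apply: eq_measure_integral => U mU _; rewrite muE//.
Qed.
Definition mixture : {measure set Z -> \bar R} := mkcomp nuk (fam_kernel mk) tt.

Lemma mixtureE U : mixture U = (\int[nu]_y k y U)%E.
Proof. by []. Qed.

End kernel_of_family.

Hypothesis mk : forall U, measurable U -> measurable_fun setT (fun y => k y U).

Lemma measurable_fam_Rintegral (f : Z -> R) : measurable_fun setT f ->
  measurable_fun setT (fun y => (\int[k y]_z f z)%R).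
Proof.
move=> mf; rewrite /Rintegral.
under eq_fun do rewrite integralE.
apply: measurableT_comp; first exact: fine_measurable.
have mF : measurable_fun setT (EFin \o f) by exact/measurable_EFinP.
apply: emeasurable_funB.
  apply: (@measurable_fun_integral_kernel _ _ _ _ R k mk) => //.
  exact: measurable_funepos.
apply: (@measurable_fun_integral_kernel _ _ _ _ R k mk) => //.
exact: measurable_funeneg.
Qed.

Variable mu : {measure set Z -> \bar R}.
Hypothesis muE : (forall U, measurable U -> mu U = \int[nu]_y k y U)%E.

Let Dge0 := ge0_disintegration mk muE.

(** The fibre integrals of [|f|] have a finite mean, hence are almost surely finite. *)
Lemma disintegration_ae_integrable (f : Z -> R) :
  mu.-integrable setT (EFin \o f) ->
  {ae nu, forall y, (k y).-integrable setT (EFin \o f)}.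
Proof.
move=> /integrableP[mf foo].
have mf' : measurable_fun setT (fun z => `|(EFin \o f) z|)%E by exact: measurableT_comp.
have := @integrable_ae _ _ R nu setT measurableT (fun y => \int[k y]_z `|(EFin \o f) z|)%E.
have h : nu.-integrable setT (fun y => (\int[k y]_z `|(EFin \o f) z|)%E).
  apply/integrableP; split.
    by apply: (@measurable_fun_integral_kernel _ _ _ _ R k mk).
  under eq_integral do rewrite gee0_abs ?integral_ge0//; rewrite -Dge0//.
move=> /(_ h); apply: filterS => y /(_ I) hy.
apply/integrableP; split => //.
by rewrite ltey_eq hy.
Qed.

Lemma disintegration_integrable (f : Z -> R) :
  mu.-integrable setT (EFin \o f) ->
  nu.-integrable setT (fun y => (\int[k y]_z f z)%R%:E).
Proof.
move=> /integrableP[mf foo]; have mf1 : measurable_fun setT f by exact/measurable_EFinP.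
apply/integrableP; split; first by apply/measurable_EFinP; exact: measurable_fam_Rintegral.
apply: le_lt_trans foo; rewrite Dge0//; last exact: measurableT_comp.
apply: ge0_le_integral => //.
- apply: measurableT_comp => //; apply/measurable_EFinP; exact: measurable_fam_Rintegral.
- by apply: (@measurable_fun_integral_kernel _ _ _ _ R k mk) => //; exact: measurableT_comp.
- move=> y _; apply: le_trans (le_abse_integral _ _ mf) => //.
  by rewrite /Rintegral; case: (\int[k y]_z _)%E => //=; rewrite normr0 leey.
Qed.

Lemma disintegration_Rintegral (f : Z -> R) :
  mu.-integrable setT (EFin \o f) ->
  (\int[mu]_z f z = \int[nu]_y \int[k y]_z f z)%R.
Proof.
move=> fi; have /integrableP[mf foo] := fi.
have ae := disintegration_ae_integrable fi.
rewrite /Rintegral; congr fine.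
rewrite integralE Dge0//; last exact: measurable_funepos.
rewrite Dge0//; last exact: measurable_funeneg.
have ip (g : Z -> \bar R) : mu.-integrable setT g -> (forall z, 0 <= g z)%E ->
    nu.-integrable setT (fun y => (\int[k y]_z g z)%E).
  move=> /integrableP[mg goo] g0; apply/integrableP; split.
    by apply: (@measurable_fun_integral_kernel _ _ _ _ R k mk).
  under eq_integral do rewrite gee0_abs ?integral_ge0//.
  rewrite -Dge0//; apply: le_lt_trans goo.
  by apply: ge0_le_integral => //; [exact: measurableT_comp|move=> z _; exact: lee_abs].
rewrite -integralB//; last 2 first.
- by apply: ip => //; exact: integrable_funepos.
- by apply: ip => //; exact: integrable_funeneg.
(* The two integrands can differ only on the null set of those [y] for which [f] is not
   [k y]-integrable, where [fine] may return a default value. *)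
apply: ae_eq_integral => //.
- apply: emeasurable_funB; apply: (@measurable_fun_integral_kernel _ _ _ _ R k mk) => //.
  exact: measurable_funepos.
  exact: measurable_funeneg.
- apply/measurable_EFinP; apply: measurable_fam_Rintegral; exact/measurable_EFinP.
apply: filterS ae => y iy _ /=.
rewrite fineK; first by rewrite [RHS]integralE.
exact: integrable_fin_num.
Qed.

End disintegration.

Lemma disintegration_tbox d d' (Y : measurableType d) (T : measurableType d') (R : realType)
    (nu : probability Y R) n (k : Y -> probability (n.-tuple T) R)
    (mu : probability (n.-tuple T) R) :
  (forall U, measurable U -> measurable_fun setT (fun y => k y U)) ->
  (forall B : 'I_n -> set T, (forall i, measurable (B i)) ->
    mu (tbox B) = \int[nu]_y k y (tbox B))%E ->
  forall U, measurable U -> (mu U = \int[nu]_y k y U)%E.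
Proof.
move=> mk muk U mU; rewrite -(mixtureE nu mk); apply: tuple_measure_unique => //.
by apply: (le_lt_trans (probability_le1 mu measurableT)); rewrite ltey.
Qed.

(** * Mean-square norm and convergence *)

Section square_integrable.
Context {d} {T : measurableType d} {R : realType}.
Implicit Types (mu : probability T R) (f g : T -> R).

Definition sqn (mu : {measure set T -> \bar R}) f : \bar R :=
  (\int[mu]_x ((f x) ^+ 2)%:E)%E.

Definition sq_integrable (mu : {measure set T -> \bar R}) f : Prop :=
  measurable_fun setT f /\ (sqn mu f < +oo)%E.

(** With squared norms and a non-strict bound in the extended reals, neither roots nor finiteness of
    norms have to be carried along; [L2_cvgP] is the link to [L2_cvg]. *)
Definition sq_cvg (mu : {measure set T -> \bar R}) (F : nat -> T -> R) f : Prop :=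
  forall e : R, 0 < e -> \forall k \near \oo, (sqn mu (F k \- f)%R <= e%:E)%E.

Lemma sqn_ge0 (mu : {measure set T -> \bar R}) f : (0 <= sqn mu f)%E.
Proof. by apply: integral_ge0 => x _; rewrite lee_fin sqr_ge0. Qed.

Lemma measurable_sqr f : measurable_fun setT f ->
  measurable_fun setT (fun x => ((f x) ^+ 2)%:E).
Proof. by move=> mf; apply/measurable_EFinP; exact: measurable_funX. Qed.
Hint Resolve measurable_sqr : core.

Lemma sqn_le_ae (mu : {measure set T -> \bar R}) f g : measurable_fun setT f ->
  measurable_fun setT g -> {ae mu, forall x, `|f x| <= `|g x|} ->
  (sqn mu f <= sqn mu g)%E.
Proof.
move=> mf mg fg; apply: ae_ge0_le_integral => //=.
- by move=> x _; rewrite lee_fin sqr_ge0.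
- exact: measurable_sqr.
- by move=> x _; rewrite lee_fin sqr_ge0.
- exact: measurable_sqr.
- apply: filterS fg => x fgx _; rewrite lee_fin -[leLHS]real_normK ?num_real//.
  by rewrite -[leRHS]real_normK ?num_real// lerXn2r ?nnegrE.
Qed.

Lemma eq_sqn_ae (mu : {measure set T -> \bar R}) f g : measurable_fun setT f ->
  measurable_fun setT g -> {ae mu, forall x, f x = g x} -> sqn mu f = sqn mu g.
Proof.
by move=> mf mg fg; apply/eqP; rewrite eq_le !sqn_le_ae//;
  apply: filterS fg => x ->.
Qed.

Lemma sqnZ (mu : {measure set T -> \bar R}) f (a : R) : measurable_fun setT f ->
  (sqn mu (fun x => a * f x)%R = (a ^+ 2)%:E * sqn mu f)%E.
Proof.
move=> mf; rewrite /sqn -ge0_integralZl_EFin//.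
- by apply: eq_integral => x _; rewrite exprMn.
- by move=> x _; rewrite lee_fin sqr_ge0.
- exact: measurable_sqr.
- by rewrite sqr_ge0.
Qed.

Lemma sqnB (mu : {measure set T -> \bar R}) f g : sqn mu (f \- g) = sqn mu (g \- f).
Proof. by apply: eq_integral => x _ /=; rewrite -sqrrN opprB. Qed.

Lemma sqnD (mu : {measure set T -> \bar R}) f g : measurable_fun setT f -> measurable_fun setT g ->
  (sqn mu (f \+ g)%R <= 2%:E * sqn mu f + 2%:E * sqn mu g)%E.
Proof.
move=> mf mg; rewrite /sqn -!ge0_integralZl_EFin//; [|by move=> x _; rewrite lee_fin sqr_ge0|exact: measurable_sqr|by move=> x _; rewrite lee_fin sqr_ge0|exact: measurable_sqr].
rewrite -ge0_integralD//=; last 4 first.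
- by move=> x _; rewrite lee_fin mulr_ge0// sqr_ge0.
- by apply: measurable_funeM; exact: measurable_sqr.
- by move=> x _; rewrite lee_fin mulr_ge0// sqr_ge0.
- by apply: measurable_funeM; exact: measurable_sqr.
apply: ge0_le_integral => //=.
- by move=> x _; rewrite lee_fin sqr_ge0.
- by apply: measurable_sqr; exact: measurable_funD.
- by apply: emeasurable_funD; apply: measurable_funeM; exact: measurable_sqr.
- move=> x _; rewrite -!EFinM -EFinD lee_fin -subr_ge0.
  have -> : 2 * f x ^+ 2 + 2 * g x ^+ 2 - (f x + g x) ^+ 2 = (f x - g x) ^+ 2 by ring.
  exact: sqr_ge0.
Qed.

Lemma sqn_triangle (mu : {measure set T -> \bar R}) f g h :
  measurable_fun setT f -> measurable_fun setT g -> measurable_fun setT h ->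
  (sqn mu (f \- h)%R <= 2%:E * sqn mu (f \- g)%R + 2%:E * sqn mu (g \- h)%R)%E.
Proof.
move=> mf mg mh; have -> : f \- h = (f \- g) \+ (g \- h).
  by apply/funext => x /=; rewrite addrA subrK.
by apply: sqnD; exact: measurable_funB.
Qed.

Lemma sq_integrable_lin (mu : {measure set T -> \bar R}) f g (a : R) :
  sq_integrable mu f -> sq_integrable mu g ->
  sq_integrable mu (fun x => a * f x + g x).
Proof.
move=> [mf foo] [mg goo]; have maf : measurable_fun setT (fun x => a * f x).
  by apply: measurable_funM => //; exact: measurable_cst.
split; first exact: measurable_funD.
apply: le_lt_trans (sqnD mu maf mg) _; rewrite sqnZ//.
rewrite lte_add_pinfty// lte_mul_pinfty// ?lee_fin//.
by rewrite lte_mul_pinfty// ?lee_fin ?sqr_ge0.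
Qed.

Lemma sq_integrable_mul mu f g : sq_integrable mu f -> sq_integrable mu g ->
  mu.-integrable setT (EFin \o (f \* g)).
Proof.
move=> [mf foo] [mg goo]; apply/integrableP; split.
  by apply/measurable_EFinP; exact: measurable_funM.
apply: (@le_lt_trans _ _ (\int[mu]_x (((f x)^+2)%:E + ((g x)^+2)%:E))%E).
  apply: ge0_le_integral => //=.
  - by apply/measurable_EFinP; apply: measurableT_comp => //; exact: measurable_funM.
  - by apply: emeasurable_funD; exact: measurable_sqr.
  - move=> x _; rewrite -EFinD lee_fin ler_norml.
    by apply/andP; split; [have := sqr_ge0 (f x + g x)|have := sqr_ge0 (f x - g x)];
      have := sqr_ge0 (f x); have := sqr_ge0 (g x); rewrite !expr2; nra.
rewrite ge0_integralD//=; [|by move=> x _; rewrite lee_fin sqr_ge0|exact: measurable_sqr|by move=> x _; rewrite lee_fin sqr_ge0|exact: measurable_sqr].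
by rewrite lte_add_pinfty.
Qed.

Lemma sq_integrable_bounded mu f (M : R) : measurable_fun setT f ->
  (forall x, `|f x| <= M) -> sq_integrable mu f.
Proof.
move=> mf fM; split => //; apply: (@le_lt_trans _ _ (\int[mu]_x (M ^+ 2)%:E)%E).
  apply: ge0_le_integral => //=.
  - by move=> x _; rewrite lee_fin sqr_ge0.
  - exact: measurable_sqr.
  - by move=> x _; rewrite lee_fin -[leLHS]real_normK ?num_real// lerXn2r ?nnegrE ?(le_trans _ (fM x)).
rewrite integral_cst// [X in (_ * X)%E](_ : _ = 1%E) ?mule1 ?ltey//.
exact: probability_setT.
Qed.

Lemma sq_integrable_cst mu (c : R) : sq_integrable mu (cst c).
Proof. exact: (@sq_integrable_bounded _ _ `|c|). Qed.

Lemma sq_integrable_integrable mu f : sq_integrable mu f ->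
  mu.-integrable setT (EFin \o f).
Proof.
move=> fi; have := sq_integrable_mul fi (sq_integrable_cst mu 1).
by congr (integrable _ _ _); apply/funext => x /=; rewrite mulr1.
Qed.

Lemma Lnorm2E (mu : {measure set T -> \bar R}) f :
  ('N[mu]_2%:E[EFin \o f] = sqn mu f `^ 2^-1)%E.
Proof.
rewrite unlock /Lnorm; congr poweR; apply: eq_integral => x _ /=.
by rewrite powR_mulrn// real_normK// num_real.
Qed.

Lemma Lfun2P (mu : {measure set T -> \bar R}) f : f \in Lfun mu 2%:E <-> sq_integrable mu f.
Proof.
rewrite inE; split=> [/andP[]|[mf foo]].
  rewrite !inE /= /finite_norm Lnorm2E => mf foo; split => //.
  exact: lty_poweRy foo.
apply/andP; rewrite !inE /=; split => //.
by rewrite /finite_norm Lnorm2E poweR_lty.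
Qed.

Lemma poweR_half_le (x : \bar R) (e : R) : (0 <= x)%E -> 0 < e ->
  (x `^ 2^-1 <= e%:E)%E = (x <= (e ^+ 2)%:E)%E.
Proof.
case: x => [r||]//.
  rewrite !lee_fin => r0 e0; rewrite powR12_sqrt//.
  by rewrite -[in RHS]ler_sqrt ?sqr_ge0// sqrtr_sqr gtr0_norm.
by move=> _ e0; rewrite poweRyr.
Qed.

Lemma L2_cvgP (mu : probability T R) F f : L2_cvg mu F f <-> sq_cvg mu F f.
Proof.
have NE k : ('N[mu]_2%:E[EFin \o (F k \- f)%R] = sqn mu (F k \- f)%R `^ 2^-1)%E.
  exact: Lnorm2E.
rewrite /L2_cvg; split => h.
  move=> e e0; have s0 : 0 < Num.sqrt e by rewrite sqrtr_gt0.
  move/fine_cvgP : h => [hfin /cvgrPdist_le/(_ _ s0)].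
  apply: filterS2 hfin => k hk; rewrite sub0r normrN.
  move=> hle; have : ('N[mu]_2%:E[EFin \o (F k \- f)%R] <= (Num.sqrt e)%:E)%E.
    apply: le_trans (lee_abs _) _; rewrite -(fineK hk) abse_EFin lee_fin.
    exact: hle.
  by rewrite NE poweR_half_le ?sqn_ge0// sqr_sqrtr// ltW.
apply/fine_cvgP; split.
  have := h _ ltr01; apply: filterS => k hk.
  rewrite ge0_fin_numE ?Lnorm_ge0//; apply: (@le_lt_trans _ _ 1%:E) => //.
    by rewrite NE poweR_half_le ?sqn_ge0// expr1n.
  by rewrite ltey.
apply/cvgrPdist_le => e e0; have e20 : 0 < e ^+ 2 by rewrite exprn_gt0.
have := h _ e20; apply: filterS => k hk.
have hN : ('N[mu]_2%:E[EFin \o (F k \- f)%R] <= e%:E)%E.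
  by rewrite NE poweR_half_le ?sqn_ge0.
rewrite sub0r normrN /= ger0_norm ?fine_ge0 ?Lnorm_ge0//.
rewrite -lee_fin fineK// ge0_fin_numE ?Lnorm_ge0//.
by apply: le_lt_trans hN _; rewrite ltey.
Qed.

Lemma sq_cvg_sq_integrable (mu : probability T R) F f : measurable_fun setT f ->
  (forall k, sq_integrable mu (F k)) -> sq_cvg mu F f -> sq_integrable mu f.
Proof.
move=> mf iF Ff; split => //; have [K _ /(_ K (leqnn K))/= hK] := Ff _ ltr01.
have -> : f = (f \- F K) \+ F K by apply/funext => x /=; rewrite subrK.
have [mF Foo] := iF K; apply: le_lt_trans (sqnD mu (measurable_funB mf mF) mF) _.
rewrite lte_add_pinfty// lte_mul_pinfty// ?lee_fin//.
by rewrite sqnB (le_lt_trans hK)// ltey.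
Qed.

Lemma sq_cvg_lin (mu : probability T R) F f G g (a : R) :
  (forall k, measurable_fun setT (F k)) -> measurable_fun setT f ->
  (forall k, measurable_fun setT (G k)) -> measurable_fun setT g ->
  sq_cvg mu F f -> sq_cvg mu G g ->
  sq_cvg mu (fun k x => a * F k x + G k x) (fun x => a * f x + g x).
Proof.
move=> mF mf mG mg Ff Gg e e0.
have a0 : 0 < a ^+ 2 + 1 by rewrite ltr_wpDl// sqr_ge0.
have e1 : 0 < e / 4 / (a ^+ 2 + 1) by rewrite divr_gt0// divr_gt0.
have e2 : 0 < e / 4 by rewrite divr_gt0.
have := Gg _ e2; have := Ff _ e1; apply: filterS2 => k hF hG.
have -> : (fun x => a * F k x + G k x) \- (fun x => a * f x + g x) =
    (fun x => a * (F k \- f) x) \+ (G k \- g).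
  by apply/funext => x /=; ring.
have mFf : measurable_fun setT (F k \- f) by exact: measurable_funB.
have mGg : measurable_fun setT (G k \- g) by exact: measurable_funB.
apply: (le_trans (sqnD mu _ mGg)); first by apply: measurable_funM => //; exact: measurable_cst.
rewrite sqnZ//.
apply: (@le_trans _ _ (2%:E * ((a^+2)%:E * (e / 4 / (a ^+ 2 + 1))%:E) + 2%:E * (e / 4)%:E)%E).
  by apply: leeD; apply: lee_wpmul2l => //; apply: lee_wpmul2l; rewrite // lee_fin sqr_ge0.
rewrite -!EFinM -EFinD lee_fin.
have : a ^+ 2 * (e / 4 / (a ^+ 2 + 1)) <= e / 4.
  rewrite mulrCA -[leRHS]mulr1 ler_pM2l// ler_pdivrMr// mul1r lerDl//.
lra.
Qed.

Lemma sq_cvg_cst (mu : probability T R) f : sq_cvg mu (fun=> f) f.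
Proof.
move=> e e0; apply: nearW => k; rewrite /sqn (eq_integral (cst 0%E)) ?integral0 ?lee_fin ?ltW//.
by move=> x _ /=; rewrite subrr expr0n.
Qed.

Lemma sq_cvg_unique (mu : probability T R) F f g :
  (forall k, measurable_fun setT (F k)) -> measurable_fun setT f -> measurable_fun setT g ->
  sq_cvg mu F f -> sq_cvg mu F g -> {ae mu, forall x, f x = g x}.
Proof.
move=> mF mf mg Ff Fg.
have mfg : measurable_fun setT (f \- g) by exact: measurable_funB.
have h0 : sqn mu (f \- g) = 0%E.
  apply/eqP; rewrite eq_le sqn_ge0 andbT; apply/lee_addgt0Pr => e e0; rewrite add0e.
  have e1 : 0 < e / 4 by rewrite divr_gt0.
  have [k _ hk] := filterI (Ff _ e1) (Fg _ e1).
  have [h1 h2] := hk k (leqnn k).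
  apply: (le_trans (sqn_triangle mu mf (mF k) mg)).
  apply: (@le_trans _ _ (2%:E * (e / 4)%:E + 2%:E * (e / 4)%:E)%E).
    by apply: leeD; apply: lee_wpmul2l => //; rewrite sqnB.
  by rewrite -!EFinM -EFinD lee_fin; lra.
have := @ae_eq_integral_abs _ _ _ mu setT measurableT (fun x => (((f \- g) x) ^+ 2)%:E) (measurable_sqr mfg).
move=> [+ _].
have -> : (\int[mu]_x `|(((f \- g) x) ^+ 2)%:E| = 0)%E.
  rewrite -[RHS]h0; apply: eq_integral => x _; rewrite gee0_abs// lee_fin sqr_ge0//.
move=> /(_ erefl); apply: filterS => x /(_ I) /= [] /eqP.
by rewrite sqrf_eq0 subr_eq0 => /eqP.
Qed.

Lemma sq_cvg_ae_eq (mu : probability T R) f g : measurable_fun setT f -> measurable_fun setT g ->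
  {ae mu, forall x, f x = g x} -> sq_cvg mu (fun=> f) g.
Proof.
move=> mf mg fg e e0; apply: nearW => k.
rewrite (@eq_sqn_ae mu _ (f \- f)); last 3 first.
- exact: measurable_funB.
- exact: measurable_funB.
- by apply: filterS fg => x /= ->.
by have [K _ /(_ K (leqnn K))] := sq_cvg_cst mu f e0.
Qed.

End square_integrable.

Section riesz_fischer.
Context {d} {T : measurableType d} {R : realType}.
Variable mu : probability T R.

(** Riesz-Fischer: a fast subsequence converges almost everywhere. The last clause says that the
    limit at a point depends only on the values of the sequence there, so that a symmetry shared by
    all [h k] holds for [g] everywhere, not merely almost everywhere. *)
Lemma sq_cauchy_cvg (h : nat -> T -> R) :
  (forall k, sq_integrable mu (h k)) ->
  (forall e : R, 0 < e -> exists K, forall i j, (K <= i)%N -> (K <= j)%N ->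
    (sqn mu (h i \- h j)%R <= e%:E)%E) ->
  exists g, [/\ sq_integrable mu g, sq_cvg mu h g &
    forall x y, (forall k, h k x = h k y) -> g x = g y].
Proof.
move=> ih ch.
have /choice[N hN] : forall k : nat, exists K, forall i j, (K <= i)%N -> (K <= j)%N ->
    (sqn mu (h i \- h j)%R <= ((8^-1) ^+ k)%:E)%E.
  by move=> k; apply: ch; rewrite exprn_gt0.
(* Summing the ranks makes [s j] at least [N k] for every [k <= j], although [N] itself need not
   increase. *)
pose s k := (\sum_(i < k.+1) N i)%N.
have sN k j : (k <= j)%N -> (N k <= s j)%N.
  move=> kj; rewrite /s (bigD1 (inord k : 'I_j.+1))//= inordK ?ltnS//.
  exact: leq_addr.
pose u k := h (s k).
have mh k : measurable_fun setT (h k) by have [] := ih k.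
have mu_ k : measurable_fun setT (u k) by exact: mh.
pose v (k : nat) (x : T) : R := `|u k.+1 x - u k x|.
have mv k : measurable_fun setT (EFin \o v k).
  by apply/measurable_EFinP; apply: measurableT_comp => //; exact: measurable_funB.
have iv k : (\int[mu]_x (v k x)%:E <= (4 / (2 ^ (k + 1))%:R)%:E)%E.
  have mw : measurable_fun setT (u k.+1 \- u k) by exact: measurable_funB.
  (* From [2 b <= 2^k b^2 + 2^-k] and a squared distance of at most [8^-k], the mean of [v k] is at
     most [4^-k + 2^-k]. The shape [4 / 2^(k+1)] of the bound is that of the geometric series used
     below to sum it. *)
  apply: (@le_trans _ _ (\int[mu]_x ((2 ^+ k)%:E * (((u k.+1 \- u k) x) ^+ 2)%:E + cst (2^-1 ^+ k)%:E x))%E).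
    apply: ge0_le_integral => //=.
    - by move=> x _; rewrite lee_fin /v.
    - exact: mv.
    - by apply: emeasurable_funD => //; apply: measurable_funeM; exact: measurable_sqr.
    - move=> x _; rewrite -EFinM -EFinD lee_fin /v.
      set a := _ - _; rewrite -[a ^+ 2]real_normK ?num_real//; set b := `|a|.
      have c0 : 0 < 2 ^+ k :> R by rewrite exprn_gt0.
      rewrite exprVn; have : 0 <= (2 ^+ k)^-1 * (2 ^+ k * b - 1) ^+ 2.
        by apply: mulr_ge0; [rewrite invr_ge0 ltW|exact: sqr_ge0].
      have -> : (2 ^+ k)^-1 * (2 ^+ k * b - 1) ^+ 2 = 2 ^+ k * b ^+ 2 - 2 * b + (2 ^+ k)^-1.
        by field; rewrite gt_eqF.
      have : 0 <= b by exact: normr_ge0.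
      lra.
  rewrite ge0_integralD//=; last 2 first.
  - by move=> x _; rewrite -EFinM lee_fin mulr_ge0 ?sqr_ge0// exprn_ge0.
  - by apply: measurable_funeM; exact: measurable_sqr.
  rewrite ge0_integralZl_EFin//; last 2 first.
  - by move=> x _; rewrite lee_fin sqr_ge0.
  - exact: measurable_sqr.
  rewrite integral_cst// [X in (_ + _ * X)%E](_ : _ = 1%E) ?mule1; last exact: probability_setT.
  have -> : 4 / (2 ^ (k + 1))%:R = 2 ^+ k * 4^-1 ^+ k + 2^-1 ^+ k :> R.
    rewrite -exprMn natrX addn1 exprS; have -> : 2 * 4^-1 = 2^-1 :> R by field.
    by rewrite exprVn; field; rewrite expf_neq0.
  rewrite EFinD; apply: leeD => //.
  apply: (@le_trans _ _ ((2 ^+ k)%:E * (8^-1 ^+ k)%:E)%E).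
    apply: lee_wpmul2l; first by rewrite lee_fin exprn_ge0.
    by apply: hN; apply: sN.
  rewrite -EFinM lee_fin ler_pM2l ?exprn_gt0// lerXn2r// ?nnegrE//; lra.
have v0 k x : (0 <= (v k x)%:E)%E by rewrite lee_fin normr_ge0.
have V0 x : (0 <= \sum_(0 <= k <oo) (v k x)%:E)%E by apply: nneseries_ge0 => k _ _; exact: v0.
have aes : {ae mu, forall x, (\sum_(0 <= k <oo) (v k x)%:E < +oo)%E}.
  have m : measurable_fun setT (fun x => (\sum_(0 <= k <oo) (v k x)%:E)%E).
    by apply: (@ge0_emeasurable_sum _ _ R setT (fun k x => (v k x)%:E) xpredT) => [k x _ _|k _]; [exact: v0|exact: mv].
  have := @integrable_ae _ _ R mu setT measurableT (fun x => \sum_(0 <= k <oo) (v k x)%:E)%E.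
  have hi : mu.-integrable setT (fun x => (\sum_(0 <= k <oo) (v k x)%:E)%E).
    apply/integrableP; split => //.
    under eq_integral do rewrite gee0_abs//.
    rewrite integral_nneseries//.
    apply: (@le_lt_trans _ _ (4%:E)%E); last by rewrite ltey.
    apply: (@le_trans _ _ (\sum_(0 <= k <oo) (4 / (2 ^ (k + 1))%:R : R)%:E)%E).
      apply: lee_nneseries => [*|k _]; [by apply: integral_ge0|exact: iv].
    have := @cvg_geometric_eseries_half R 4 0; rewrite expr0 divr1.
    by move=> /cvg_lim => ->.
  move=> /(_ hi); apply: filterS => x /(_ I); rewrite ge0_fin_numE//.
have aec : {ae mu, forall x, cvgn (u ^~ x)}.
  apply: filterS aes => x hx.
  have cs : cvgn (series (fun k => u k.+1 x - u k x)).
    apply: normed_cvg; apply: nondecreasing_is_cvgn.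
      by apply: nondecreasing_series => n _ _; exact: normr_ge0.
    have hfin : (\sum_(0 <= k <oo) (v k x)%:E)%E \is a fin_num.
      by rewrite ge0_fin_numE.
    exists (fine (\sum_(0 <= k <oo) (v k x)%:E)%E) => _ [n _ <-].
    rewrite -lee_fin fineK// /series /= -sumEFin.
    by apply: nneseries_lim_ge => k _; rewrite lee_fin.
  have -> : u ^~ x = (fun k => u 0%N x + series (fun k => u k.+1 x - u k x) k).
    by apply/funext => k; rewrite /series /= telescope_sumr// addrC subrK.
  by apply: is_cvgD => //; exact: is_cvg_cst.
(* A limit superior exists and is measurable without any restriction to the convergence set, and it
   is a function of the values [u k x] alone. *)
pose g x := fine (limn_esup (fun k => (u k x)%:E)).
have mg : measurable_fun setT g.
  apply: measurableT_comp; first exact: fine_measurable.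
  by apply: measurable_fun_limn_esup => k; exact/measurable_EFinP.
have aeg : {ae mu, forall x, u k x @[k --> \oo] --> g x}.
  apply: filterS aec => x hx.
  have hE : (u k x)%:E @[k --> \oo] --> (limn (u ^~ x))%:E by apply: cvg_EFin => //; exact: nearW.
  by rewrite /g (cvg_limn_einf_sup hE).2.
have hg : sq_cvg mu h g.
  move=> e e0.
  have [k0 hk0] : exists k0, (8^-1) ^+ k0 <= e.
    have /cvgrPdist_le/(_ _ e0)[k0 _ /(_ k0 (leqnn k0))] :=
      @cvg_geometric R 1 8^-1 ltac:(rewrite ger0_norm; lra).
    rewrite /= sub0r normrN mul1r ger0_norm ?exprn_ge0// => h8; by exists k0.
  exists (N k0) => // i /= Ni.
  (* Fatou's lemma along the tail of the subsequence carries the Cauchy bound [8^-k0] over to the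
     distance between [h i] and [g]. *)
  pose f_ (j : nat) (x : T) : \bar R := (((h i \- u (j + k0)%N) x) ^+ 2)%:E.
  have mf j : measurable_fun setT (f_ j) by apply: measurable_sqr; exact: measurable_funB.
  have f0 j x : setT x -> (0 <= f_ j x)%E by move=> _; rewrite lee_fin sqr_ge0.
  apply: (@le_trans _ _ (\int[mu]_x limn_einf (f_ ^~ x))%E).
    apply: ae_ge0_le_integral => //=.
    - by move=> x _; rewrite lee_fin sqr_ge0.
    - by apply: measurable_sqr; exact: measurable_funB.
    - by move=> x _; rewrite limn_einf_lim; apply: lime_ge;
        [exact: is_cvg_einfs|apply: nearW => n; apply: le_ereal_inf_tmp => _ [p _ <-]; exact: f0].
    - have -> : (fun x => limn_einf (f_ ^~ x)) =
        (fun x => - limn_esup (fun j => - f_ j x))%E.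
        apply/funext => x; rewrite -(limn_einfN (fun j => - f_ j x)%E); congr limn_einf.
        by apply/funext => j; rewrite /comp oppeK.
      apply: measurableT_comp => //; apply: measurable_fun_limn_esup => j.
      exact: measurableT_comp.
    - apply: filterS aeg => x hx _.
      have hc : f_ j x @[j --> \oo] --> (((h i \- g) x) ^+ 2)%:E.
        apply: cvg_EFin; first exact: nearW.
        rewrite /comp /=; rewrite expr2; under eq_fun do rewrite expr2.
        by apply: cvgM; (apply: cvgB; [exact: cvg_cst|rewrite (cvg_shiftn k0 (u ^~ x))]).
      by rewrite (cvg_limn_einf_sup hc).1.
  apply: (le_trans (fatou mu measurableT mf f0)).
  rewrite limn_einf_lim; apply: lime_le; first exact: is_cvg_einfs.
  apply: nearW => n; apply: (@le_trans _ _ (\int[mu]_x f_ n x)%E).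
    by apply: ereal_inf_lbound; exists n => //=.
  apply: (@le_trans _ _ ((8^-1 ^+ k0)%:E)); last by rewrite lee_fin.
  by apply: hN => //; apply: sN; exact: leq_addl.
exists g; split => //; first exact: (sq_cvg_sq_integrable mg ih hg).
by move=> x y hxy; rewrite /g; congr (fine (limn_esup _)); apply/funext => k; rewrite /u hxy.
Qed.
End riesz_fischer.

(** * Induction on square-integrable functions *)

Section density.
Context {d} {T : measurableType d} {R : realType}.
Variable mu : probability T R.

Lemma sq_cvg_dominated (F : nat -> T -> R) (f g : T -> R) :
  (forall k, measurable_fun setT (F k)) -> measurable_fun setT f -> sq_integrable mu g ->
  {ae mu, forall x : T, F k x @[k --> \oo] --> f x} ->
  (forall k x, `|F k x - f x| <= g x) -> sq_cvg mu F f.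
Proof.
move=> mF mf ig Ff Fg.
have g0 x : 0 <= g x by apply: le_trans (Fg 0%N x).
have ig2 : mu.-integrable setT (EFin \o (fun x => g x ^+ 2)).
  by have := sq_integrable_mul ig ig; congr (integrable _ _ _).
have [] := @dominated_convergence _ _ _ mu setT measurableT
  (fun k x => ((F k x - f x) ^+ 2)%:E) (cst 0%E) (EFin \o (fun x => g x ^+ 2)) _ _ _ ig2 _.
- by move=> k; apply: measurable_sqr; exact: measurable_funB.
- exact: measurable_cst.
- apply: filterS Ff => x Ffx _; apply: cvg_EFin; first by near=> k.
  rewrite (_ : fine \o _ = (fun k => (F k x - f x) ^+ 2))//.
  have : (F k x - f x) * (F k x - f x) @[k --> \oo] --> (0 : R).
    rewrite -(mulr0 (0:R)); apply: cvgM; apply/cvgr0Pnorm_lt => e e0;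
    by move/cvgrPdistC_lt : Ffx => /(_ e e0); apply: filterS => k.
  by apply: cvg_trans; apply: near_eq_cvg; near=> k; rewrite expr2.
- apply: aeW => x k _; rewrite abse_EFin lee_fin normrX ler_sqr ?nnegrE//; exact: Fg.
move=> _ _; rewrite integral0 => /fine_cvgP[hfin /cvgr0Pnorm_le h] e e0.
apply: filterS2 hfin (h e e0) => k /= hf he.
rewrite -[sqn _ _]fineK// lee_fin; apply: le_trans he; exact: ler_norm.
Unshelve. all: by end_near. Qed.

Lemma sq_integrable_indic U : measurable U -> sq_integrable mu (\1_U : T -> R).
Proof.
move=> mU; apply: (@sq_integrable_bounded _ _ _ _ _ 1) => //.
by move=> x; rewrite indicE; case: (_ \in _); rewrite /= ?normr1 ?normr0.
Qed.

Section induction.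
Variables (G : set (set T)) (Q : (T -> R) -> Prop).
Hypotheses (GE : @measurable _ T = <<s G >>) (GI : setI_closed G).
Hypothesis Q1 : Q (\1_[set: T]).
Hypothesis QG : forall U, G U -> Q (\1_U).
Hypothesis Qlin : forall (a : R) f g, sq_integrable mu f -> sq_integrable mu g ->
  Q f -> Q g -> Q (fun x => a * f x + g x).
Hypothesis Qlim : forall F f, (forall k, sq_integrable mu (F k)) -> sq_integrable mu f ->
  (forall k, Q (F k)) -> sq_cvg mu F f -> Q f.

Let Q0 : Q (fun=> 0).
Proof.
have i1 := sq_integrable_indic measurableT.
have := Qlin (-1) i1 i1 Q1 Q1; congr Q; apply/funext => x.
by rewrite mulN1r addNr.
Qed.

Let Qsum (f : nat -> T -> R) n : (forall i, sq_integrable mu (f i)) -> (forall i, Q (f i)) ->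
  sq_integrable mu (fun x => \sum_(i < n) f i x) /\ Q (fun x => \sum_(i < n) f i x).
Proof.
move=> fi Qf; elim: n => [|n [IH1 IH2]].
  by under eq_fun do rewrite big_ord0; split => //; exact: sq_integrable_cst.
rewrite (_ : (fun _ => _) = (fun x => 1 * f n x + \sum_(i < n) f i x)); last first.
  by apply/funext => x; rewrite big_ord_recr mul1r addrC.
by split; [exact: sq_integrable_lin|exact: Qlin].
Qed.

Let Q_indic U : measurable U -> Q (\1_U).
Proof.
rewrite GE; apply: (dynkin_induction (P := fun U => Q (\1_U))) => //.
  move=> S mS QS; have := Qlin (-1) (sq_integrable_indic mS) (sq_integrable_indic measurableT) QS Q1.
  congr Q; apply/funext => x; rewrite !indicE in_setT in_setC.
  by case: (_ \in _); rewrite /= ?mulr1 ?mulr0 ?addNr ?add0r.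
move=> F mF tF QF.
have [iS QS] : (forall n, sq_integrable mu (fun x => \sum_(i < n) \1_(F i) x)) /\
    (forall n, Q (fun x => \sum_(i < n) \1_(F i) x)).
  by split => n; have [] := @Qsum (fun i => \1_(F i)) n (fun i => sq_integrable_indic (mF i)) QF.
have mU : measurable (\bigcup_k F k) by exact: bigcupT_measurable.
(* As the sets are disjoint, the partial sums at a point are 0 or 1: [b n] tells whether one of the
   first [n] sets contains [x]. *)
have E x : exists b : nat -> bool, [/\ forall n, \sum_(i < n) \1_(F i) x = (b n)%:R :> R,
    forall n, \1_(\bigcup_k F k) x = (b n)%:R :> R \/ b n = false &
    \forall n \near \oo, \1_(\bigcup_k F k) x = (b n)%:R :> R].
  have [[k _ Fkx]|nF] := pselect ((\bigcup_k F k) x).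
    have Ux : \1_(\bigcup_k F k) x = 1 :> R by rewrite indicE mem_set//; exists k.
    have Fx i : \1_(F i) x = (i == k)%:R :> R.
      rewrite indicE; congr (_%:R); congr nat_of_bool; have [->|ik] := eqVneq i k; first exact: mem_set.
      apply: memNset => Fix; move/eqP: ik; apply; apply: tF => //.
      by exists x.
    exists (fun n => (k < n)%N); split.
    - move=> n; under eq_bigr do rewrite Fx; have [kn|nk] := ltnP k n.
        rewrite (bigD1 (Ordinal kn))//= eqxx big1 ?addr0// => i.
        by rewrite -val_eqE /= => /negbTE ->.
      by rewrite big1// => i _; rewrite ltn_eqF//; exact: leq_trans nk.
    - by move=> n; rewrite Ux; case: (k < n)%N; [left|right].
    by exists k.+1 => // n /= kn; rewrite Ux kn.
  have Ux : \1_(\bigcup_k F k) x = 0 :> R by rewrite indicE memNset.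
  exists xpred0; split => //.
  - move=> n; rewrite big1// => i _; rewrite indicE memNset// => Fix; apply: nF.
    by exists i.
  - by move=> n; right.
  by apply: nearW => n; rewrite Ux.
apply: (Qlim iS (sq_integrable_indic mU) QS).
apply: (sq_cvg_dominated (g := cst 1)).
- by move=> k; case: (iS k).
- exact: measurable_indic.
- exact: sq_integrable_cst.
- apply: aeW => x; have [b [bE _ bU]] := E x; under eq_fun do rewrite bE.
  by apply: cvg_near_cst; apply: filterS bU => n ->.
move=> n x; have [b [-> bU _]] := E x; have [->|->] := bU n.
  by rewrite subrr normr0.
by rewrite sub0r normrN indicE; case: (_ \in _); rewrite /= ?normr1 ?normr0.
Qed.

Import HBNNSimple.

Let Q_ge0 f : sq_integrable mu f -> (forall x, 0 <= f x) -> Q f.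
Proof.
move=> fi f0; have mf : measurable_fun setT (EFin \o f) by apply/measurable_EFinP; case: fi.
have [g [ndg gf]] := approximation measurableT mf (fun x _ => f0 x).
have gle k x : 0 <= g k x <= f x.
  apply/andP; split; first exact: fun_ge0.
  have /fine_cvgP[_ gfx] := gf x I; rewrite -(cvg_lim _ gfx)//.
  apply: (@nondecreasing_cvgn_le _ (fun n => g n x)); last by apply/cvg_ex; exists (f x).
  by move=> m n mn; exact: (lefP _ _ (ndg m n mn)).
have mg k : measurable_fun setT (g k) by exact: measurable_funP.
have ig k : sq_integrable mu (g k).
  split => //; apply: le_lt_trans (fi.2); apply: sqn_le_ae => //; first by case: fi.
  by apply: aeW => x; have /andP[g0 gfx] := gle k x; rewrite !ger0_norm.
apply: (Qlim ig fi).
  move=> k; have [n [r gE]] : exists n (r : nat -> R),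
      forall x, g k x = \sum_(i < n) (r i * \1_(g k @^-1` [set r i]) x).
    by do 2!eexists; move=> x; exact: fimfunEord.
  rewrite (_ : (g k : T -> R) = fun x => \sum_(i < n) (r i * \1_(g k @^-1` [set r i]) x)); last first.
    by apply/funext => x; exact: gE.
  have mgk i : measurable (g k @^-1` [set r i]).
    by rewrite -[_ @^-1` _]setTI; exact: mg.
  have H i : sq_integrable mu (fun x => r i * \1_(g k @^-1` [set r i]) x) /\
      Q (fun x => r i * \1_(g k @^-1` [set r i]) x).
    have i1 := sq_integrable_indic (mgk i).
    rewrite (_ : (fun _ => _) = (fun x => r i * \1_(g k @^-1` [set r i]) x + 0)); last first.
      by apply/funext => x; rewrite addr0.
    split; first by apply: (sq_integrable_lin _ i1); exact: sq_integrable_cst.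
    by apply: Qlin => //; [exact: sq_integrable_cst|exact: Q_indic].
  by have [] := @Qsum (fun i x => r i * \1_(g k @^-1` [set r i]) x) n
    (fun i => (H i).1) (fun i => (H i).2).
apply: (sq_cvg_dominated (g := f)) => //.
- by case: fi.
- by apply: aeW => x; have /fine_cvgP[_] := gf x I.
move=> k x; have /andP[g0 gfx] := gle k x.
by rewrite ler0_norm ?subr_le0// opprB lerBlDr lerDl.
Qed.

(** The monotone class argument in mean-square form: a Dynkin argument reaches all indicators,
    simple functions reach nonnegative functions, and positive and negative parts do the rest. It is
    the density of boxes in the form used later, [Q f] saying that the random integral of [f] lies
    in a given closed subspace. *)
Lemma sq_integrable_ind f : sq_integrable mu f -> Q f.
Proof.
move=> fi; have [mf foo] := fi.
have H (s : R) : s = 1 \/ s = -1 -> sq_integrable mu (fun x => Num.max (s * f x) 0).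
  move=> hs; have mM : measurable_fun setT (fun x => Num.max (s * f x) 0).
    by apply: measurable_maxr => //; apply: measurable_funM => //; exact: measurable_cst.
  split => //; apply: le_lt_trans foo; apply: sqn_le_ae => //; apply: aeW => x.
  have -> : `|f x| = `|s * f x| by case: hs => ->; rewrite ?mul1r ?mulN1r ?normrN.
  by have [h|h] := leP (s * f x) 0; rewrite // normr0.
have ip := H 1 (or_introl erefl); have im := H (-1) (or_intror erefl).
have := Qlin (-1) im ip (Q_ge0 im _) (Q_ge0 ip _).
have mx (x : R) : 0 <= Num.max x 0 by rewrite le_max lexx orbT.
move=> /(_ (fun x => mx _) (fun x => mx _)); congr Q; apply/funext => x.
rewrite !mulN1r mul1r; have [h|/ltW h] := leP (f x) 0.
  by rewrite max_l ?oppr_ge0// opprK addr0.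
by rewrite max_r ?oppr_le0// oppr0 add0r.
Qed.

End induction.

End density.

(** * Sums over subsequences *)

Section subsequence_sums.
Context {T : eqType} {V : nzRingType}.
Implicit Types (s u v : seq T) (g : seq T -> V).

(** The [r]-subsets of [n] positions, listed by Pascal's rule. Lists of masks split definitionally
    on the first position, which is where the urn puts a new draw. *)
Fixpoint masks n r : seq bitseq :=
  match n, r with
  | 0, 0 => [:: [::]]
  | 0, _.+1 => [::]
  | n'.+1, 0 => map (cons false) (masks n' 0)
  | n'.+1, r'.+1 => map (cons false) (masks n' r) ++ map (cons true) (masks n' r')
  end.

Lemma masksP n r m : m \in masks n r -> size m = n /\ count id m = r.
Proof.
elim: n r m => [|n IH] [|r] m //=; first by rewrite inE => /eqP ->.
  by move=> /mapP[m' /IH[<- cm] ->].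
by rewrite mem_cat => /orP[] /mapP[m' /IH[<- <-] ->].
Qed.

Lemma masks0 n : masks n 0 = [:: nseq n false].
Proof. by elim: n => //= n ->. Qed.

Lemma masks_gt n r : (n < r)%N -> masks n r = [::].
Proof.
elim: n r => [|n IH] [|r] //= nr; rewrite !IH//.
by rewrite ltnW.
Qed.

Lemma masks_full n : masks n n = [:: nseq n true].
Proof. by elim: n => //= n ->; rewrite masks_gt. Qed.

Lemma perm_mask_negb m s : size m = size s ->
  perm_eq s (mask m s ++ mask (map negb m) s).
Proof.
elim: s m => [|x s IH] [|b m] //= [sm]; case: b => /=; first by rewrite perm_cons IH.
by rewrite perm_sym -cat1s perm_catCA /= perm_cons perm_sym IH.
Qed.

(** This is the unnormalised U-statistic with kernel [g]. *)
Definition subsum r g s : V := \sum_(m <- masks (size s) r) g (mask m s).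

Lemma eq_subsum r g g' s : (forall u, size u = r -> g u = g' u) ->
  subsum r g s = subsum r g' s.
Proof.
move=> gg; rewrite /subsum big_seq [RHS]big_seq; apply: eq_bigr => m /masksP[sm cm].
by apply: gg; rewrite size_mask.
Qed.

Lemma subsum0 g s : subsum 0 g s = g [::].
Proof.
rewrite /subsum; elim: s g => [|x s IH] g; first by rewrite /= big_seq1.
by rewrite /= big_map.
Qed.

Lemma subsumS r g x s :
  subsum r.+1 g (x :: s) = subsum r.+1 g s + subsum r (fun u => g (x :: u)) s.
Proof. by rewrite /subsum /= big_cat !big_map. Qed.

Lemma subsum_gt r g s : (size s < r)%N -> subsum r g s = 0.
Proof.
elim: s r g => [|x s IH] [|r] g //= sr; first by rewrite /subsum /= big_nil.
by rewrite subsumS !IH ?addr0// ltnW.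
Qed.

(** Double counting: a subset of size [r + 1] arises once for each of its elements regarded as the
    one added last, and symmetry of [g] makes the place of insertion irrelevant. These factors build
    up the factorial of the key identity. *)
Lemma sum_mask_insert r g s :
  (forall u v, size u = r.+1 -> perm_eq u v -> g u = g v) ->
  \sum_(m <- masks (size s) r) \sum_(b <- mask (map negb m) s) g (b :: mask m s) =
  r.+1%:R * subsum r.+1 g s.
Proof.
elim: s r g => [|x s IH] r g gsym.
  case: r gsym => [|r] _; rewrite /subsum /= ?big_seq1 ?big_nil ?mulr0//.
have E (R' : seq bitseq) : \sum_(m <- map (cons false) R')
    \sum_(b <- mask (map negb m) (x :: s)) g (b :: mask m (x :: s)) =
    \sum_(m <- R') g (x :: mask m s) +
    \sum_(m <- R') \sum_(b <- mask (map negb m) s) g (b :: mask m s).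
  by rewrite big_map -big_split /=; apply: eq_bigr => m _; rewrite big_cons.
have HE : \sum_(m <- masks (size s) r) g (x :: mask m s) = subsum r (fun u => g (x :: u)) s.
  by [].
case: r gsym E HE => [|r] gsym E HE.
  by rewrite /= E HE IH// mul1r mul1r subsumS addrC.
rewrite /= big_cat /= E HE IH//.
rewrite big_map /=.
have -> : \sum_(j <- masks (size s) r) \sum_(b <- mask [seq ~~ i | i <- j] s)
      g [:: b, x & mask j s] = r.+1%:R * subsum r.+1 (fun u => g (x :: u)) s.
  rewrite -IH; last first.
    by move=> u v su uv; apply: gsym; rewrite ?perm_cons//= su.
  rewrite big_seq [RHS]big_seq; apply: eq_bigr => m /masksP[sm cm]; apply: eq_bigr => b _.
  apply: gsym; first by rewrite /= size_mask// cm.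
  by rewrite -[[:: b, x & _]]/([:: b; x] ++ _) -[[:: x, b & _]]/([:: x; b] ++ _) perm_cat2r
    (perm_catC [:: b] [:: x]).
rewrite subsumS; set a := subsum r.+2 g s; set b := subsum _ _ s; set p : V := r.+1%:R.
have -> : r.+2%:R = p + 1 by rewrite /p natr1.
by rewrite mulrDr [(p + 1) * b]mulrDl mul1r [b + _]addrC -addrA [b + _]addrC.
Qed.

Lemma subsum_swap r g x s1 s2 :
  (forall u v, size u = r -> perm_eq u v -> g u = g v) ->
  subsum r g (s1 ++ x :: s2) = subsum r g (x :: s1 ++ s2).
Proof.
elim: s1 r g => [//|y s1 IH] [|r] g gsym; first by rewrite !subsum0.
have gsym' z u v : size u = r -> perm_eq u v -> g (z :: u) = g (z :: v).
  by move=> su uv; apply: gsym; rewrite ?perm_cons//= su.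
rewrite /= subsumS IH// IH; last by move=> u v; exact: gsym'.
rewrite subsumS [RHS]subsumS [in RHS]subsumS.
case: r gsym gsym' => [|r] gsym gsym'.
  rewrite !subsum0 addrAC; congr (_ + _); rewrite ?subsum0//.
rewrite !subsumS -!addrA; congr (_ + _).
rewrite [LHS]addrCA; congr (_ + _); congr (_ + _).
apply: eq_subsum => u su; apply: gsym; first by rewrite /= su.
by rewrite -[[:: y, x & _]]/([:: y; x] ++ _) -[[:: x, y & _]]/([:: x; y] ++ _) perm_cat2r
  (perm_catC [:: y] [:: x]).
Qed.

Lemma subsum_perm r g s s' :
  (forall u v, size u = r -> perm_eq u v -> g u = g v) ->
  perm_eq s s' -> subsum r g s = subsum r g s'.
Proof.
elim: s r g s' => [|x s IH] r g s' gsym; first by rewrite perm_sym => /perm_nilP ->.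
move=> ss'; have xs' : x \in s' by rewrite -(perm_mem ss') mem_head.
case/splitPr : xs' ss' => s1 s2 ss'.
have {}ss' : perm_eq s (s1 ++ s2).
  by move: ss'; rewrite -[x :: s2]cat1s perm_sym perm_catCA /= perm_cons perm_sym.
rewrite subsum_swap//; case: r gsym => [|r] gsym; first by rewrite !subsum0.
rewrite !subsumS (IH _ _ _ gsym ss') (IH _ _ _ _ ss')// => u v su uv.
by apply: gsym; rewrite ?perm_cons//= su.
Qed.

End subsequence_sums.

Lemma cvg_prodr (R : realType) (I : Type) (s : seq I) (f : I -> nat -> R) (l : I -> R) :
  (forall i, f i n @[n --> \oo] --> l i) ->
  \prod_(i <- s) f i n @[n --> \oo] --> \prod_(i <- s) l i.
Proof.
move=> fl; elim: s => [|i s IH].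
  by rewrite big_nil; under eq_fun do rewrite big_nil; exact: cvg_cst.
by rewrite big_cons; under eq_fun do rewrite big_cons; apply: cvgM.
Qed.

(** * Increasing index tuples against all index maps *)

Section sorted_sums.
Variable R : realType.

(** The pair [(j, p)] encodes the injective map [j] composed with the inverse of [p]. It is
    recovered from that map: [j] is the sorted list of the values, and then [p] follows. *)
Let code N K (u : N.-tuple 'I_K * 'S_N) : {ffun 'I_N -> 'I_K} :=
  [ffun i => tnth u.1 ((u.2)^-1%g i)].

Let code_inj N K : {in [set u : N.-tuple 'I_K * 'S_N | sorted ltn (map val u.1)]%SET &,
  injective (@code N K)}.
Proof.
move=> [j p] [j' p']; rewrite !inE /= => sj sj' /ffunP E.
have mem (t t' : N.-tuple 'I_K) (q q' : 'S_N) :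
    (forall i, code (t, q) i = code (t', q') i) -> {subset t <= t'}.
  move=> H _ /tnthP[i ->]; have := H (q i); rewrite !ffunE /= permK => ->.
  exact: mem_tnth.
have jj' : j = j'.
  apply: val_inj; apply: (inj_map val_inj).
  apply: (irr_sorted_eq ltn_trans ltnn sj sj') => k.
  by apply/idP/idP => /mapP[i ij ->]; apply: map_f; [apply: mem ij => l; exact: E|apply: mem ij => l; exact/esym/E].
have uj : injective (tnth j).
  apply/tuple_uniqP; rewrite -(map_inj_uniq val_inj).
  exact: sorted_uniq ltn_trans ltnn _ sj.
congr pair => //; apply/invg_inj/permP => i.
by apply: uj; have := E i; rewrite !ffunE /= jj'.
Qed.

Definition sorted_sum N K (x : 'I_N -> 'I_K -> R) : R :=
  \sum_(j : N.-tuple 'I_K | sorted ltn (map val j)) \sum_(p : 'S_N)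
    \prod_(i < N) x (p i) (tnth j i).

(** Once the product is expanded over all maps, those in the image of [code] give [sorted_sum]
    exactly; each of the others contributes a number between 0 and 1, so only their count
    matters. *)
Lemma sorted_sum_bound N K (x : 'I_N -> 'I_K -> R) : (forall i k, 0 <= x i k <= 1) ->
  sorted_sum x <= \prod_(i < N) \sum_(k < K) x i k <=
  sorted_sum x + (K%:R ^+ N - ('C(K, N) * N`!)%:R).
Proof.
move=> x01; set T := sorted_sum x.
have f01 (f : {ffun 'I_N -> 'I_K}) : 0 <= \prod_(i < N) x i (f i) <= 1.
  apply/andP; split; first by apply: prodr_ge0 => i _; case/andP: (x01 i (f i)).
  by apply: prodr_ile1 => i _; exact: x01.
pose E := [set u : N.-tuple 'I_K * 'S_N | sorted ltn (map val u.1)]%SET.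
pose S := (@code N K @: E)%SET.
have TE : T = \sum_(f in S) \prod_(i < N) x i (f i).
  rewrite big_imset/=; last exact: code_inj.
  rewrite /T /sorted_sum pair_big_dep/=; apply: eq_big => [u|u _]; first by rewrite inE andbT.
  rewrite (reindex_inj (@perm_inj _ (u.2)^-1%g)); apply: eq_bigr => i _.
  by rewrite permKV ffunE.
have cS : #|S| = ('C(K, N) * N`!)%N.
  rewrite card_in_imset; last exact: code_inj.
  rewrite -(card_ltn_sorted_tuples N K) -(card_Sn N) -cardsT -cardsX; apply: eq_card => u.
  by rewrite !inE andbT.
rewrite bigA_distr_bigA/= (bigID (mem S))/= -TE lerDl lerD2l sumr_ge0/=; last first.
  by move=> f _; case/andP: (f01 f).
apply: (@le_trans _ _ (\sum_(f | f \notin S) 1)).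
  by apply: ler_sum => f _; case/andP: (f01 f).
rewrite sumr_const lerBrDr -cS -natrX -natrD ler_nat.
have -> : #|[pred f | f \notin S]| = #|~: S|%SET by apply: eq_card => f; rewrite !inE.
by rewrite addnC cardsC card_ffun !card_ord.
Qed.

(** The number ['C(K, N) * N!] is a falling factorial, that is [K^N] times the product of the
    [1 - i / K], which tends to 1. *)
Lemma cvg_binomial_ratio N : K%:R ^+ N / 'C(K, N)%:R @[K --> \oo] --> (N`!%:R : R).
Proof.
have h : \prod_(i < N) (1 - i%:R * K%:R^-1) @[K --> \oo] --> (1 : R).
  rewrite -[X in _ --> X](_ : \prod_(i < N) (1 - i%:R * 0) = 1); last first.
    by rewrite big1// => i _; rewrite mulr0 subr0.
  apply: (cvg_prodr (f := fun (i : 'I_N) K => 1 - i%:R * K%:R^-1)) => i.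
  apply: cvgB; first exact: cvg_cst.
  apply: cvgM; first exact: cvg_cst.
  rewrite -(cvg_shiftS (fun K => K%:R^-1 : R)); exact: cvg_harmonic.
have : N`!%:R * (\prod_(i < N) (1 - i%:R * K%:R^-1))^-1 @[K --> \oo] --> (N`!%:R : R).
  rewrite -[X in _ --> X](_ : N`!%:R * 1^-1 = N`!%:R); last by rewrite invr1 mulr1.
  by apply: cvgM; [exact: cvg_cst|apply: cvgV => //; exact: oner_neq0].
apply: cvg_trans; apply: near_eq_cvg; near=> K.
have NK : (N < K)%N by near: K; exists N.+1.
have K0 : K%:R != 0 :> R by rewrite pnatr_eq0; case: (K) NK.
have C0 : 'C(K, N)%:R != 0 :> R by rewrite pnatr_eq0 -lt0n bin_gt0 ltnW.
have f0 : N`!%:R != 0 :> R by rewrite pnatr_eq0 -lt0n fact_gt0.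
have E : \prod_(i < N) (1 - i%:R * K%:R^-1) * K%:R ^+ N = 'C(K, N)%:R * N`!%:R :> R.
  have -> : K%:R ^+ N = \prod_(i < N) K%:R :> R by rewrite prodr_const card_ord.
  rewrite -natrM bin_ffact ffact_prod natr_prod -big_split/=.
  apply: eq_bigr => i _; rewrite mulrBl mul1r mulfVK// natrB//.
  by apply: ltnW; exact: ltn_trans NK.
have p0 : \prod_(i < N) (1 - i%:R * K%:R^-1) != 0 :> R.
  by apply: contraNneq (mulf_neq0 C0 f0) => p0; rewrite -E p0 mul0r.
apply/esym/eqP; rewrite eqr_div// mulrC E; apply/eqP; ring.
Unshelve. all: by end_near. Qed.

End sorted_sums.

Section seq_functions.
Context {d'} {A : measurableType d'}.

(** Kernels live on [seq A] so that variables can be added, dropped and selected without transport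
    between tuple types; measurability is then required at each length separately. *)
Definition seq_measurable d2 (S : measurableType d2) (F : seq A -> S) : Prop :=
  forall n, measurable_fun setT (fun t : n.-tuple A => F t).

Lemma measurable_seq_comp d1 (T1 : measurableType d1) d2 (S : measurableType d2)
    (F : seq A -> S) (phi : T1 -> seq A) k :
  seq_measurable F -> (forall x, size (phi x) = k) ->
  (forall i, (i < k)%N -> measurable_fun setT (fun x => nth point (phi x) i)) ->
  measurable_fun setT (fun x => F (phi x)).
Proof.
move=> mF sphi mphi.
pose psi x : k.-tuple A := [tuple nth point (phi x) i | i < k].
have psiE x : phi x = psi x.
  apply: (@eq_from_nth _ point); first by rewrite sphi size_tuple.
  move=> i; rewrite sphi => ik.
  by rewrite -[i in RHS]/(nat_of_ord (Ordinal ik)) -tnth_nth tnth_mktuple.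
under eq_fun do rewrite psiE.
apply: (measurableT_comp (mF k)).
apply/measurable_fun_tnthP => i.
rewrite (_ : _ \o _ = (fun x => nth point (phi x) i)); first exact: mphi.
by apply/funext => x /=; rewrite tnth_mktuple.
Qed.

Lemma measurable_nth_tuple n i : measurable_fun setT (fun t : n.-tuple A => nth point t i).
Proof.
have [ni|ni] := ltnP i n; last first.
  under eq_fun do rewrite nth_default ?size_tuple//.
  exact: measurable_cst.
rewrite (_ : (fun t => _) = (@tnth n A ^~ (Ordinal ni))); first exact: measurable_tnth.
by apply/funext => t; rewrite (tnth_nth point).
Qed.

End seq_functions.

Local Arguments polya_step : simpl never.

Lemma integral_indic_mul d (T : measurableType d) (R : realType)
    (m : {measure set T -> \bar R}) (D B : set T) (f : T -> \bar R) :
  (\int[m]_(x in D) ((\1_B x)%:E * f x) = \int[m]_(x in D `&` B) f x)%E.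
Proof.
rewrite integral_mkcondr; apply: eq_integral => x _; rewrite /patch indicE.
by case: ifPn => _; rewrite ?mul1e ?mul0e.
Qed.

(** * One step of the urn *)

Section polya_step_theory.
Context {d'} {A : measurableType d'} {R : realType}.
Variable alpha : {finite_measure set A -> \bar R}.

Let c : R := fine (alpha setT).

Lemma ge0_integral_polya_step s (f : A -> \bar R) :
  (forall a, 0 <= f a)%E -> measurable_fun setT f ->
  (\int[polya_step alpha s]_a f a =
   ((c + (size s)%:R)^-1)%:E * (\int[alpha]_a f a + \sum_(b <- s) f b))%E.
Proof.
move=> f0 mf; rewrite ge0_integral_mscale//=; congr (_ * _)%E.
rewrite ge0_integral_measure_add// ge0_integral_measure_sum//; congr (_ + _)%E.
rewrite (big_nth point) big_mkord; apply: eq_bigr => i _.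
by rewrite integral_dirac// diracT mul1e.
Qed.

Lemma measurable_integral_polya_step n (G : n.-tuple A * A -> \bar R) :
  (forall x, 0 <= G x)%E -> measurable_fun setT G ->
  measurable_fun setT (fun t : n.-tuple A => \int[polya_step alpha t]_a G (t, a))%E.
Proof.
move=> G0 mG.
have mG1 t : measurable_fun setT (fun a => G (t, a)).
  by apply: (measurableT_comp mG); exact: pair1_measurable.
under eq_fun do rewrite ge0_integral_polya_step// size_tuple.
apply: measurable_funeM; apply: emeasurable_funD.
  exact: (@measurable_fun_fubini_tonelli_F _ _ _ _ _ alpha G mG G0).
under eq_fun do rewrite (big_nth point) size_tuple.
apply: emeasurable_sum => i; apply: (measurableT_comp mG).
apply: measurable_fun_pair => //.
exact: measurable_nth_tuple.
Qed.

Lemma polya_box_ge0 s Bs : (0 <= polya_box alpha s Bs)%E.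
Proof. by elim: Bs s => [|B Bs IH] s //=; apply: integral_ge0. Qed.

Lemma seq_measurable_polya_box Bs : (forall B, B \in Bs -> measurable B) ->
  seq_measurable (fun s => polya_box alpha s Bs).
Proof.
elim: Bs => [_ n|B Bs IH mBs n] /=; first exact: measurable_cst.
have mB : measurable B by apply: mBs; rewrite mem_head.
have {}IH := IH (fun C hC => mBs C (mem_behead (s := B :: Bs) hC)).
pose G (x : n.-tuple A * A) := (polya_box alpha (rcons x.1 x.2) Bs * (\1_B x.2)%:E)%E.
under eq_fun.
  move=> t; rewrite integral_mkcond.
  rewrite (_ : _ \_ _ = (fun a => G (t, a))); last first.
    apply/funext => a; rewrite /patch /G /= indicE; case: ifPn => _; first by rewrite mule1.
    by rewrite mule0.
  over.
apply: measurable_integral_polya_step.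
  by move=> x; rewrite /G mule_ge0 ?polya_box_ge0// lee_fin.
apply: emeasurable_funM.
  apply: (measurable_seq_comp IH (k := n.+1)).
    by move=> x; rewrite size_rcons size_tuple.
  move=> i; rewrite ltnS leq_eqVlt => /predU1P[->|ni].
    by under eq_fun do rewrite nth_rcons size_tuple ltnn eqxx; exact: measurable_snd.
  under eq_fun do rewrite nth_rcons size_tuple ni.
  exact: (measurableT_comp (measurable_nth_tuple i)).
apply/measurable_EFinP; apply: measurableT_comp => //; exact: measurable_indic.
Qed.

Lemma measurable_polya_box s Bs : (forall B, B \in Bs -> measurable B) ->
  measurable_fun setT (fun a => polya_box alpha (rcons s a) Bs).
Proof.
move=> mBs; apply: (measurable_seq_comp (seq_measurable_polya_box mBs) (k := (size s).+1)).
  by move=> x; rewrite size_rcons.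
move=> i; rewrite ltnS leq_eqVlt => /predU1P[->|ni].
  by under eq_fun do rewrite nth_rcons ltnn eqxx; exact: measurable_id.
under eq_fun do rewrite nth_rcons ni.
exact: measurable_cst.
Qed.

Hypothesis alpha_gt0 : (0 < alpha setT)%E.

Lemma mass_gt0 : 0 < c.
Proof. by rewrite fine_gt0// alpha_gt0 ltey_eq fin_num_measure. Qed.

Lemma mass_addn_gt0 n : 0 < c + n%:R.
Proof. by rewrite ltr_wpDr// mass_gt0. Qed.

Definition polya_mass s B : \bar R := (alpha B + \sum_(b <- s) \d_b B)%E.

Lemma polya_mass_ge0 s B : (0 <= polya_mass s B)%E.
Proof. by rewrite adde_ge0// sume_ge0. Qed.

Lemma polya_stepE s B : measurable B ->
  (polya_step alpha s B = ((c + (size s)%:R)^-1)%:E * polya_mass s B)%E.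
Proof.
move=> mB; transitivity (\int[polya_step alpha s]_a (\1_B a)%:E)%E.
  by rewrite integral_indic// setIT.
rewrite ge0_integral_polya_step//; last by apply/measurable_EFinP; exact: measurable_indic.
rewrite integral_indic// setIT; congr (_ * (_ + _))%E.
Qed.

(** [polya_box] unfolds from the first draw, whereas the prediction rule concerns the last one: it
    is either a draw from the initial urn ([alpha] and the atoms of [s]), or a repetition of draw
    [l], which must then lie in both sets. *)
Lemma polya_box_rcons s Bs B : (forall C, C \in Bs -> measurable C) -> measurable B ->
  ((c + (size s)%:R + (size Bs)%:R)%:E * polya_box alpha s (rcons Bs B) =
   polya_mass s B * polya_box alpha s Bs +
   \sum_(l < size Bs) polya_box alpha s (set_nth set0 Bs l (nth set0 Bs l `&` B)))%E.
Proof.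
move=> mBs mB; elim: Bs s mBs => [|B1 Bs IH] s mBs.
  rewrite /= big_ord0 adde0 mule1 addr0 integral_cst// mul1e polya_stepE//.
  by rewrite muleA -EFinM divff ?mul1e// gt_eqF// mass_addn_gt0.
have mB1 : measurable B1 by apply: mBs; rewrite mem_head.
have {}mBs C : C \in Bs -> measurable C by move=> hC; apply: mBs; rewrite inE hC orbT.
have mS l C : C \in set_nth set0 Bs l (nth set0 Bs l `&` B) -> (l < size Bs)%N -> measurable C.
  move=> /(nthP set0)[i]; rewrite size_set_nth nth_set_nth /= => hi <- lB.
  case: eqP => [_|_]; first by apply: measurableI => //; exact/mBs/mem_nth.
  by apply/mBs/mem_nth; move: hi; rewrite (maxn_idPr _)// .
pose p a := polya_box alpha (rcons s a) Bs.
pose q l a := polya_box alpha (rcons s a) (set_nth set0 Bs l (nth set0 Bs l `&` B)).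
have mp : measurable_fun setT p by exact: measurable_polya_box.
have mq l : (l < size Bs)%N -> measurable_fun setT (q l).
  by move=> lB; apply: measurable_polya_box => C /mS; exact.
have p0 a : (0 <= p a)%E by exact: polya_box_ge0.
have q0 l a : (0 <= q l a)%E by exact: polya_box_ge0.
have mrc : measurable_fun setT (fun a => polya_box alpha (rcons s a) (rcons Bs B)).
  by apply: measurable_polya_box => C; rewrite mem_rcons inE => /predU1P[->|/mBs].
rewrite /= -ge0_integralZl_EFin//; last 3 first.
- by move=> a _; exact: polya_box_ge0.
- exact: measurable_funTS.
- by rewrite -addrA -natrD; exact/ltW/mass_addn_gt0.
(* The induction hypothesis for the history [rcons s a] has one more atom, at [a]; this atom yields
   the new term [l = 0], in which the last draw repeats the present one. *)
have E a : ((c + (size s)%:R + (size Bs).+1%:R)%:E * polya_box alpha (rcons s a) (rcons Bs B) =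
    polya_mass s B * p a + ((\1_B a)%:E * p a + \sum_(l < size Bs) q l a))%E.
  have -> : c + (size s)%:R + (size Bs).+1%:R = c + (size (rcons s a))%:R + (size Bs)%:R.
    by rewrite size_rcons -!natr1; ring.
  rewrite IH// addeA; congr (_ + _)%E.
  rewrite /polya_mass -cats1 big_cat big_seq1 /= addeA ge0_muleDl//; last first.
    by rewrite -/(polya_mass s B) polya_mass_ge0.
  by rewrite cats1 diracE indicE.
under eq_integral do rewrite E.
have mW : measurable_fun B1 (fun a => (polya_mass s B * p a)%E).
  by apply: measurable_funeM; exact: measurable_funTS.
have m1 : measurable_fun B1 (fun a => ((\1_B a)%:E * p a)%E).
  apply: measurable_funTS; apply: emeasurable_funM => //.
  by apply/measurable_EFinP; exact: measurable_indic.
have msum_ : measurable_fun B1 (fun a => \sum_(l < size Bs) q l a)%E.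
  by apply: measurable_funTS; apply: emeasurable_sum => l; exact: mq.
rewrite ge0_integralD//=; last 3 first.
- by move=> a _; rewrite mule_ge0// polya_mass_ge0.
- by move=> a _; rewrite adde_ge0 ?sume_ge0// mule_ge0// lee_fin.
- exact: emeasurable_funD.
rewrite ge0_integralZl//; last 2 first.
- exact: measurable_funTS.
- exact: polya_mass_ge0.
congr (_ + _)%E.
rewrite ge0_integralD//=; last 2 first.
- by move=> a _; rewrite mule_ge0// lee_fin.
- by move=> a _; rewrite sume_ge0.
rewrite big_ord_recl/=; congr (_ + _)%E.
  exact: integral_indic_mul.
rewrite ge0_integral_sum//; last by move=> l; apply: measurable_funTS; exact: mq.
Qed.

End polya_step_theory.

Section tuple_cons_theory.
Context {d} {T : measurableType d}.

Lemma tuple_cons_tbox n (B : 'I_n.+1 -> set T) :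
  @tuple_cons d T n @^-1` tbox B = B ord0 `*` tbox (fun i => B (lift ord0 i)).
Proof.
apply/seteqP; split=> -[a t] /=.
  move=> h; split=> [|i]; first by have := h ord0; rewrite /tuple_cons (tnth_nth a).
  by have := h (lift ord0 i); rewrite /tuple_cons !(tnth_nth a).
move=> [h0 h] i; rewrite (tnth_nth a) /=.
case: (unliftP ord0 i) => [j ->|->//].
by have := h j; rewrite (tnth_nth a).
Qed.

Lemma prob_pow_tbox {R : realType} (mu : probability T R) n (B : 'I_n -> set T) :
  (forall i, measurable (B i)) ->
  prob_pow mu n (tbox B) = (\prod_(i < n) fine (mu (B i)))%:E.
Proof.
rewrite /prob_pow; elim: n B => [|n IH] B mB /=.
  rewrite big_ord0 diracE mem_set//; by case.
rewrite /pushforward tuple_cons_tbox product_measure1E//; last exact: measurable_tbox.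
rewrite big_ord_recl EFinM fineK ?fin_num_measure//; congr (_ * _)%E.
exact: (IH (fun i => B (lift ord0 i))).
Qed.

End tuple_cons_theory.

Section integral_distribution.
Context {d d'} {T : measurableType d} {S : measurableType d'} {R : realType}.

Lemma Rintegral_distribution (mu : probability T R) (phi : {mfun T >-> S}) (f : S -> R) :
  measurable_fun setT f ->
  (\int[distribution mu phi]_y f y = \int[mu]_x f (phi x)).
Proof.
move=> mf; have mF : measurable_fun setT (EFin \o f) by exact/measurable_EFinP.
rewrite /Rintegral integralE ge0_integral_distribution//; last exact: measurable_funepos.
rewrite ge0_integral_distribution//; last exact: measurable_funeneg.
rewrite [in RHS]integralE -[fun x => (f (phi x))%:E]/((EFin \o f) \o phi).
congr fine; congr (_ - _)%E.
  by apply: eq_integral => x _; rewrite (funepos_comp (EFin \o f) phi).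
by apply: eq_integral => x _; rewrite (funeneg_comp (EFin \o f) phi).
Qed.

Lemma integrable_distribution (mu : probability T R) (phi : {mfun T >-> S}) (f : S -> R) :
  measurable_fun setT f ->
  (distribution mu phi).-integrable setT (EFin \o f) <-> mu.-integrable setT (EFin \o (f \o phi)).
Proof.
move=> mf; have mF : measurable_fun setT (EFin \o f) by exact/measurable_EFinP.
have E : (\int[distribution mu phi]_y `|(EFin \o f) y| = \int[mu]_x `|(EFin \o (f \o phi)) x|)%E.
  by rewrite ge0_integral_distribution//; exact: measurableT_comp.
split=> /integrableP[_]; rewrite ?E => h; apply/integrableP; split; rewrite ?E//.
by apply/measurable_EFinP; exact: measurableT_comp.
Qed.

End integral_distribution.

Section polya_kernel.
Context {d'} {A : measurableType d'} {R : realType}.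
Variable alpha : {finite_measure set A -> \bar R}.
Hypothesis alpha_gt0 : (0 < alpha setT)%E.

(** [polya_step] prepared for the structure of a probability. Positivity of [alpha] is an argument
    of the term because the total mass for the empty history depends on it. *)
Definition pstep of (0 < alpha setT)%E := fun s : seq A => (polya_step alpha s : set A -> \bar R).

HB.instance Definition _ s := Measure.on (pstep alpha_gt0 s).

Let pstep_setT s : pstep alpha_gt0 s setT = 1%E.
Proof.
rewrite /pstep polya_stepE// /polya_mass.
have -> : (\sum_(b <- s) \d_b setT = (size s)%:R%:E :> \bar R)%E.
  elim: s => [|b s IH]; first by rewrite big_nil.
  by rewrite big_cons IH diracT /= -natr1 addrC EFinD.
rewrite -[X in (_ * (X + _))%E]fineK ?fin_num_measure//.
rewrite -EFinD -EFinM; congr EFin.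
by rewrite mulVf// gt_eqF// mass_addn_gt0.
Qed.

HB.instance Definition _ s := Measure_isProbability.Build _ _ _ (pstep alpha_gt0 s) (pstep_setT s).

Definition prepend n (t : n.-tuple A) (a : A) : n.+1.-tuple A := tuple_cons (a, t).

Lemma measurable_prepend n (t : n.-tuple A) : measurable_fun setT (prepend t).
Proof.
apply: (measurableT_comp (@measurable_tuple_cons _ _ n)).
exact: measurable_fun_pair.
Qed.

HB.instance Definition _ n (t : n.-tuple A) :=
  isMeasurableFun.Build _ _ _ _ (prepend t) (@measurable_prepend n t).

(** The joint law of the next draw and the draws [t] already made. The new draw goes in front, as
    exchangeability permits, so that the urn step is a [cons] on sequences. *)
Definition polya_kernel n (t : n.-tuple A) : probability (n.+1.-tuple A) R :=
  distribution (pstep alpha_gt0 t) (prepend t).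

Lemma polya_kernel_tbox n (t : n.-tuple A) (B : 'I_n.+1 -> set A) :
  polya_kernel t (tbox B) =
  (pstep alpha_gt0 t (B ord0) * (\1_(tbox (fun i => B (lift ord0 i))) t)%:E)%E.
Proof.
rewrite /polya_kernel /distribution /= /pushforward.
have -> : prepend t @^-1` tbox B =
    if t \in tbox (fun i => B (lift ord0 i)) then B ord0 else set0.
  have -> : prepend t @^-1` tbox B = [set a | (B ord0 `*` tbox (fun i => B (lift ord0 i))) (a, t)].
    by rewrite -tuple_cons_tbox.
  case: ifPn => [/set_mem ht|/negP ht]; apply/seteqP; split=> a //=; first by case.
  by move=> [_ h]; apply: ht; rewrite inE.
by rewrite indicE; case: ifPn => _; rewrite ?mule1 ?measure0 ?mule0.
Qed.

Lemma measurable_polya_kernel n U : measurable U ->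
  measurable_fun setT (fun t : n.-tuple A => polya_kernel t U).
Proof.
apply: measurable_kernel_tbox => B mB; under eq_fun do rewrite polya_kernel_tbox.
apply: emeasurable_funM; last first.
  by apply/measurable_EFinP; apply: measurable_indic; exact: measurable_tbox.
under eq_fun do rewrite /pstep polya_stepE// size_tuple.
apply: measurable_funeM; apply: emeasurable_funD => //.
rewrite /polya_mass; under eq_fun do rewrite (big_nth point) size_tuple.
apply: emeasurable_sum => i.
rewrite (_ : (fun _ => _) = (fun t : n.-tuple A => (\1_(B ord0) (nth point t i))%:E)); last first.
  by apply/funext => t; rewrite diracE indicE.
apply/measurable_EFinP; apply: measurableT_comp (measurable_nth_tuple i).
exact: measurable_indic.
Qed.

End polya_kernel.

(** * Laws of the Polya sequence and directing measure *)

Section polya_laws.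
Context {d d'} {Omega : measurableType d} {A : measurableType d'} {R : realType}.
Variables (P : probability Omega R) (alpha : {finite_measure set A -> \bar R}).
Hypothesis alpha_gt0 : (0 < alpha setT)%E.
Variables (X : nat -> {RV P >-> A}) (D : R.-pker Omega ~> A).
Hypotheses (hX : polya_sequence alpha X) (hXD : empirical_limit X D).

Let c : R := fine (alpha setT).

Lemma measurable_X_prefix n : measurable_fun setT (X_prefix X n).
Proof.
apply/measurable_fun_tnthP => i.
rewrite (_ : _ \o _ = X i); first exact: measurable_funP.
by apply/funext => w; rewrite /= tnth_mktuple.
Qed.

HB.instance Definition _ n :=
  isMeasurableFun.Build _ _ _ _ (X_prefix X n) (@measurable_X_prefix n).

Definition law n : probability (n.-tuple A) R := distribution P (X_prefix X n).

Lemma law_tboxE n (B : 'I_n -> set A) :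
  law n (tbox B) = P [set w | forall i, B i (X i w)].
Proof.
rewrite /law /distribution /= /pushforward; congr (P _).
by apply/seteqP; split=> w h i; have := h i; rewrite tnth_mktuple.
Qed.

Lemma polya_law n (j : 'I_n -> nat) (B : 'I_n -> set A) :
  (forall i i' : 'I_n, (i < i')%N -> (j i < j i')%N) ->
  (forall i, measurable (B i)) ->
  P [set w | forall i, B i (X (j i) w)] = polya_box alpha [::] [seq B i | i <- enum 'I_n].
Proof.
case: n j B => [|n] j B hj mB; last exact: hX.
rewrite (_ : enum 'I_0 = [::]) /=; last by apply: size0nil; rewrite size_enum_ord.
rewrite -(@probability_setT _ _ _ P); congr (P _).
by apply/seteqP; split=> // w _ [].
Qed.

Lemma law_polya_box n (B : 'I_n -> set A) : (forall i, measurable (B i)) ->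
  law n (tbox B) = polya_box alpha [::] [seq B i | i <- enum 'I_n].
Proof. by move=> mB; rewrite law_tboxE; exact: (@polya_law n (fun i => i)). Qed.

Lemma spreadable n (j : 'I_n -> nat) (B : 'I_n -> set A) :
  (forall i i' : 'I_n, (i < i')%N -> (j i < j i')%N) ->
  (forall i, measurable (B i)) ->
  P [set w | forall i, B i (X (j i) w)] = law n (tbox B).
Proof. by move=> hj mB; rewrite polya_law// law_polya_box. Qed.

Let emp (C : set A) n w : R := n%:R^-1 * \sum_(i < n) \1_C (X i w).

(** Giving coordinate [k] the [k]-th block of [K] indices makes the index tuples in a product of
    averages automatically increasing. *)
Let block (C : set A) k K w : R := K%:R^-1 * \sum_(j < K) \1_C (X (k * K + j)%N w).

(** A block average is a fixed combination of two empirical means, [k + 1] times the one up to the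
    end of the block minus [k] times the one up to its beginning. *)
Lemma block_cvg (C : set A) k w :
  emp C n w @[n --> \oo] --> fine (D w C) ->
  block C k K.+1 w @[K --> \oo] --> fine (D w C).
Proof.
move=> h.
have blockE K : block C k K.+1 w =
    k.+1%:R * emp C (k.+1 * K.+1)%N w - k%:R * emp C (k * K.+1)%N w.
  have S n : \sum_(i < n) \1_C (X i w) = n%:R * emp C n w :> R.
    rewrite /emp mulrA; case: n => [|n]; first by rewrite big_ord0 mul0r mul0r.
    by rewrite divff ?mul1r// pnatr_eq0.
  have -> : block C k K.+1 w = K.+1%:R^-1 *
      (\sum_(i < k.+1 * K.+1) \1_C (X i w) - \sum_(i < k * K.+1) \1_C (X i w)).
    rewrite /block; congr (_ * _).
    rewrite -!(big_mkord xpredT (fun i => \1_C (X i w) : R)).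
    rewrite (@big_cat_nat _ _ _ (k * K.+1)%N 0%N (k.+1 * K.+1)%N) ?leq_mul//=.
    rewrite addrAC subrr add0r mulSn addnC.
    rewrite -[X in \sum_(X <= _ < _) _]add0n big_addn addKn big_mkord.
    by apply: eq_bigr => i _; rewrite addnC.
  have aux (m : nat) (e : R) : K.+1%:R^-1 * ((m * K.+1)%:R * e) = m%:R * e.
    by rewrite natrM [m%:R * _]mulrC !mulrA mulVf ?mul1r ?pnatr_eq0.
  by rewrite !S mulrBr !aux.
under eq_fun do rewrite blockE.
have hc m : (0 < m)%N -> emp C (m * K.+1)%N w @[K --> \oo] --> fine (D w C).
  move=> m0; apply: (cvg_comp _ _ _ h).
  move=> V [n _ hn]; exists n => // K /= nK; apply: hn => /=.
  by rewrite (leq_trans nK)// (leq_trans (leqnSn K))// leq_pmull.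
have -> : fine (D w C) = k.+1%:R * fine (D w C) - k%:R * fine (D w C).
  by rewrite -mulrBl -natrB ?leqnSn// subSnn mul1r.
apply: cvgB; first by apply: cvgZl_tmp; exact: hc.
case: k {blockE} => [|k].
  rewrite mul0r; under eq_fun do rewrite mul0r; exact: cvg_cst.
by apply: cvgZl_tmp; exact: hc.
Qed.

(** An identity for every block length: each term of the expanded product has strictly increasing
    indices, and the law at such indices does not depend on their choice. *)
Lemma expectation_block_prod n (B : 'I_n -> set A) K :
  (forall i, measurable (B i)) ->
  (\int[P]_w (\prod_(i < n) block (B i) i K.+1 w)%:E = law n (tbox B))%E.
Proof.
move=> mB.
have E w : (\prod_(i < n) block (B i) i K.+1 w =
   (K.+1%:R ^- n) * \sum_(f : {ffun 'I_n -> 'I_K.+1})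
      \1_[set w | forall i, B i (X (i * K.+1 + f i)%N w)] w).
  rewrite big_split /= prodr_const card_ord exprVn; congr (_ * _).
  rewrite (bigA_distr_bigA (fun (i : 'I_n) (j : 'I_K.+1) => \1_(B i) (X (i * K.+1 + j)%N w) : R)).
  apply: eq_bigr => f _; rewrite indicE.
  have [hw|hw] := boolP (_ \in _).
    rewrite big1// => i _; rewrite indicE mem_set//.
    by move/set_mem : hw; apply.
  have /existsNP[i hi] : ~ forall i, B i (X (i * K.+1 + f i)%N w).
    by move=> h; move/negP : hw; apply; rewrite inE.
  by rewrite (bigD1 i)//= indicE memNset// mul0r.
have mS (f : {ffun 'I_n -> 'I_K.+1}) :
    measurable [set w | forall i, B i (X (i * K.+1 + f i)%N w)].
  rewrite (_ : [set w | _] = \bigcap_(i in [set: 'I_n]) (X (i * K.+1 + f i)%N @^-1` B i)).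
    by apply: fin_bigcap_measurable => // i _; rewrite -[_ @^-1` _]setTI; exact: measurable_funP.
  by apply/seteqP; split=> w h i; [move=> _|]; exact: h.
under eq_integral do rewrite E EFinM -sumEFin.
rewrite ge0_integralZl_EFin//; last 2 first.
- by move=> w _; apply: sume_ge0 => f _; rewrite lee_fin.
- by apply: emeasurable_sum => f; apply/measurable_EFinP; exact: measurable_indic.
rewrite ge0_integral_sum//; last by move=> f; apply/measurable_EFinP; exact: measurable_indic.
rewrite (eq_bigr (fun=> law n (tbox B))); last first.
  move=> f _; rewrite integral_indic// setIT.
  apply: (@spreadable n (fun i => i * K.+1 + f i)%N B) => // i i' ii'.
  rewrite (@leq_trans (i.+1 * K.+1))//.
    by rewrite mulSn addnC ltn_add2r.
  by rewrite (@leq_trans (i' * K.+1))// ?leq_addr// leq_mul.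
rewrite -[law n (tbox B)]fineK ?fin_num_measure//; last exact: measurable_tbox.
rewrite sumEFin sumr_const card_ffun !card_ord -EFinM; congr EFin.
by rewrite -[X in _ * X]mulr_natl natrX mulrA mulVf ?mul1r// expf_neq0// pnatr_eq0.
Qed.

Lemma measurable_kernel_fine (C : set A) : measurable C ->
  measurable_fun setT (fun w => fine (D w C)).
Proof.
move=> mC; apply: measurableT_comp; first exact: fine_measurable.
exact: measurable_kernel.
Qed.

(** The de Finetti representation on boxes: the expectations of the products of block averages do
    not depend on the block length, and dominated convergence identifies their common value with
    that of the limit. *)
Lemma law_tbox n (B : 'I_n -> set A) : (forall i, measurable (B i)) ->
  law n (tbox B) = (\int[P]_w (\prod_(i < n) fine (D w (B i)))%:E)%E.
Proof.
move=> mB.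
have mb k K C : measurable C -> measurable_fun setT (block C k K).
  move=> mC; apply: measurable_funM; first exact: measurable_cst.
  apply: measurable_sum => j; apply: measurableT_comp; last exact: measurable_funP.
  exact: measurable_indic.
have aec : {ae P, forall w, forall i : 'I_n, block (B i) i K.+1 w @[K --> \oo] --> fine (D w (B i))}.
  have : {ae P, forall w, forall k : nat, forall i : 'I_n, k = i ->
      block (B i) i K.+1 w @[K --> \oo] --> fine (D w (B i))}.
    apply: ae_foralln => k; have [kn|kn] := ltnP k n; last first.
      by apply: aeW => w i ki; move: kn; rewrite ki leqNgt ltn_ord.
    apply: filterS (hXD (mB (Ordinal kn))) => w hw i ki.
    have -> : i = Ordinal kn by exact/val_inj.
    exact: block_cvg.
  by apply: filterS => w h i; exact: (h i).
have [|||||_ _] := @dominated_convergence _ _ R P setT measurableT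
  (fun K w => (\prod_(i < n) block (B i) i K.+1 w)%:E)
  (fun w => (\prod_(i < n) fine (D w (B i)))%:E) (cst 1%E).
- by move=> K; apply/measurable_EFinP; apply: measurable_prod => i _; exact: mb.
- by apply/measurable_EFinP; apply: measurable_prod => i _; exact: measurable_kernel_fine.
- apply: filterS aec => w hw _; apply: cvg_EFin; first exact: nearW.
  rewrite /comp /=; apply: cvg_prodr => i; exact: hw.
- apply/integrableP; split; first exact: measurable_cst.
  by rewrite integral_cst// normr1 mul1e (le_lt_trans (probability_le1 P measurableT))// ltey.
- apply: aeW => w K _; rewrite lee_fin normr_prod; apply: prodr_ile1 => i _.
  rewrite normr_ge0/= /block ger0_norm; last by rewrite mulr_ge0// sumr_ge0.
  rewrite ler_pdivrMl// mulr1.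
  have -> : K.+1%:R = \sum_(j < K.+1) 1 :> R by rewrite sumr_const card_ord.
  by apply: ler_sum => j _; rewrite indicE; case: (_ \in _).
rewrite /=; under eq_fun do rewrite expectation_block_prod//.
by move=> h; apply: (cvg_unique _ _ h) => //; exact: cvg_cst.
Qed.

Definition Dpow n w : probability (n.-tuple A) R := prob_pow (kernel_at D w) n.

Lemma Dpow_tbox n w (B : 'I_n -> set A) : (forall i, measurable (B i)) ->
  Dpow n w (tbox B) = (\prod_(i < n) fine (D w (B i)))%:E.
Proof. by move=> mB; rewrite /Dpow prob_pow_tbox. Qed.

Lemma measurable_Dpow n U : measurable U -> measurable_fun setT (fun w => Dpow n w U).
Proof.
apply: measurable_kernel_tbox => B mB; under eq_fun do rewrite Dpow_tbox//.
by apply/measurable_EFinP; apply: measurable_prod => i _; exact: measurable_kernel_fine.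
Qed.

Lemma law_Dpow n U : measurable U -> (law n U = \int[P]_w Dpow n w U)%E.
Proof.
apply: disintegration_tbox => [V|B mB]; first exact: measurable_Dpow.
by rewrite law_tbox//; apply: eq_integral => w _; rewrite Dpow_tbox.
Qed.

Lemma law_polya_kernel n U : measurable U ->
  (law n.+1 U = \int[law n]_t polya_kernel alpha_gt0 t U)%E.
Proof.
apply: disintegration_tbox => [V|B mB]; first exact: measurable_polya_kernel.
pose B' (i : 'I_n) := B (lift ord0 i).
pose B2 (i : 'I_n.+1) := if unlift ord_max i is Some j then B' j else B ord0.
have mB' i : measurable (B' i) by exact: mB.
have mB2 i : measurable (B2 i) by rewrite /B2; case: unlift.
(* Exchangeability, read off the commutative product in [law_tbox], moves the side of the new draw
   to the last place, where [polya_box_rcons] applies. *)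
have -> : law n.+1 (tbox B) = law n.+1 (tbox B2).
  rewrite !law_tbox//; apply: eq_integral => w _; congr EFin.
  rewrite big_ord_recl big_ord_recr /= mulrC; congr (_ * _); last by rewrite /B2 unlift_none.
  apply: eq_bigr => i _; rewrite /B2.
  by have -> : widen_ord (leqnSn n) i = lift ord_max i;
    [apply/val_inj; rewrite /= /bump leqNgt ltn_ord|rewrite liftK].
(* This is the box for the case in which the new draw repeats draw [l]. *)
pose B'' (l i : 'I_n) := if i == l then B' i `&` B ord0 else B' i.
have mB'' l i : measurable (B'' l i) by rewrite /B''; case: ifP => // _; exact: measurableI.
have -> :
  law n.+1 (tbox B2) = (((c + n%:R)^-1)%:E * (alpha (B ord0) * law n (tbox B') +
    \sum_(l < n) law n (tbox (B'' l))))%E.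
  have E : [seq B2 i | i <- enum 'I_n.+1] = rcons [seq B' i | i <- enum 'I_n] (B ord0).
    rewrite enum_ordSr map_rcons -map_comp; congr rcons; last by rewrite /B2 unlift_none.
    apply: eq_map => i /=; rewrite /B2.
    by have -> : widen_ord (leqnSn n) i = lift ord_max i;
      [apply/val_inj; rewrite /= /bump leqNgt ltn_ord|rewrite liftK].
  rewrite law_polya_box// E.
  have := @polya_box_rcons _ _ _ alpha alpha_gt0 [::] [seq B' i | i <- enum 'I_n] (B ord0).
  rewrite size_map size_enum_ord /= addr0 => H.
  have {}H := H _ (mB ord0).
  have /H {}H : forall C, C \in [seq B' i | i <- enum 'I_n] -> measurable C.
    by move=> C /mapP[i _ ->].
  rewrite law_polya_box//.
  rewrite (eq_bigr (fun l : 'I_n => polya_box alpha [::] (set_nth set0 [seq B' i | i <- enum 'I_n] l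
            (nth set0 [seq B' i | i <- enum 'I_n] l `&` B ord0)))); last first.
    move=> l _; rewrite law_polya_box//; congr polya_box.
    apply: (@eq_from_nth _ set0).
      by rewrite size_set_nth 2!size_map size_enum_ord (maxn_idPr _).
    rewrite size_map size_enum_ord => i ni; rewrite nth_set_nth /=.
    rewrite (nth_map l set0 (B'' l)) ?size_enum_ord// !(nth_map l set0 B') ?size_enum_ord//.
    have -> : nth l (enum 'I_n) i = Ordinal ni by apply/val_inj; rewrite /= nth_enum_ord.
    have -> : nth l (enum 'I_n) l = l by apply/val_inj; rewrite /= nth_enum_ord.
    rewrite /B''.
    have -> : (Ordinal ni == l) = (i == l) by [].
    case: eqP => // il; congr (B' _ `&` _); exact/val_inj.
  have -> : (alpha (B ord0) = polya_mass alpha [::] (B ord0))%E.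
    by rewrite /polya_mass big_nil adde0.
  by rewrite -H muleA -EFinM mulVf ?mul1e// gt_eqF// mass_addn_gt0.
under eq_integral do rewrite polya_kernel_tbox.
have mb l : measurable (tbox (B'' l)) by exact: measurable_tbox.
have mb' : measurable (tbox B') by exact: measurable_tbox.
have ind V : measurable V -> (\int[law n]_t (\1_V t)%:E = law n V)%E.
  by move=> mV; rewrite integral_indic// setIT.
have mi V : measurable V -> measurable_fun setT (fun t : n.-tuple A => (\1_V t)%:E : \bar R).
  by move=> mV; apply/measurable_EFinP; exact: measurable_indic.
have E (t : n.-tuple A) : (pstep alpha_gt0 t (B ord0) * (\1_(tbox B') t)%:E =
    ((c + n%:R)^-1)%:E * (alpha (B ord0) * (\1_(tbox B') t)%:E +
      \sum_(l < n) (\1_(tbox (B'' l)) t)%:E))%E.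
  rewrite /pstep polya_stepE// size_tuple -muleA; congr (_ * _)%E.
  rewrite /polya_mass ge0_muleDl ?sume_ge0//; congr (_ + _)%E.
  rewrite ge0_sume_distrl//.
  rewrite (big_nth point) size_tuple big_mkord; apply: eq_bigr => l _.
  rewrite diracE !indicE -EFinM -natrM mulnb; congr ((nat_of_bool _)%:R%:E).
  apply/idP/idP.
    move=> /andP[/set_mem h0 /set_mem h]; apply/mem_set => i; rewrite /B''.
    case: eqP => [->|_]; last exact: h.
    by split; [exact: h|rewrite (tnth_nth point)].
  move/set_mem => h; apply/andP; split; apply/mem_set.
    by have := h l; rewrite /B'' eqxx (tnth_nth point) => -[].
  by move=> i; have := h i; rewrite /B''; case: eqP => // _ [].
under eq_integral do rewrite E.
rewrite ge0_integralZl_EFin//; last 3 first.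
- by move=> t _; rewrite adde_ge0 ?sume_ge0 ?mule_ge0// => *; rewrite lee_fin.
- apply: emeasurable_funD; first by apply: measurable_funeM; exact: mi.
  by apply: emeasurable_sum => l; exact: mi.
- by rewrite invr_ge0 ltW// mass_addn_gt0.
congr (_ * _)%E; rewrite ge0_integralD//; last 4 first.
- by move=> t _; rewrite mule_ge0// lee_fin.
- by apply: measurable_funeM; exact: mi.
- by move=> t _; rewrite sume_ge0// => *; rewrite lee_fin.
- by apply: emeasurable_sum => l; exact: mi.
rewrite ge0_integralZl//; last exact: mi.
rewrite ind//; congr (_ + _)%E; rewrite ge0_integral_sum//; last by move=> l; exact: mi.
by apply: eq_bigr => l _; rewrite ind.
Qed.

(** * Random integrals against powers of [D] *)

Definition intD n (F : seq A -> R) (w : Omega) : R := \int[Dpow n w]_t F t.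

Let seqf n (F : seq A -> R) (t : n.-tuple A) : R := F t.

Lemma sigma_D_sub : sigma_D D `<=` measurable.
Proof.
apply: smallest_sub; first exact: sigma_algebra_measurable.
move=> _ [C mC [B mB <-]]; rewrite setTI.
by have := measurable_kernel D C mC measurableT B mB; rewrite setTI.
Qed.

Lemma measurable_wrt_fun (Y : Omega -> R) : measurable_wrt (sigma_D D) Y ->
  measurable_fun setT Y.
Proof. by move=> mY _ B mB; rewrite setTI; apply: sigma_D_sub; exact: mY. Qed.

Lemma measurable_wrtP (Y : Omega -> R) : measurable_wrt (sigma_D D) Y <->
  measurable_fun [set: g_sigma_algebraType (\bigcup_(C in @measurable _ A)
        preimage_set_system setT (fun w => D w C) measurable)] Y.
Proof.
split=> [mY _ B mB|mY B mB]; first by rewrite setTI; exact: mY.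
by have := mY measurableT B mB; rewrite setTI.
Qed.

Lemma intD_measurable_wrt n F : seq_measurable F -> measurable_wrt (sigma_D D) (intD n F).
Proof.
move=> mF; apply/measurable_wrtP; apply: measurable_fam_Rintegral; last exact: mF.
move=> U mU; apply: (@measurable_kernel_tbox _ _ _ (g_sigma_algebraType (\bigcup_(C in @measurable _ A)
        preimage_set_system setT (fun w => D w C) measurable))
  R n (fun w => Dpow n w)) => // B mB.
rewrite (_ : (fun _ => _) = (fun w => (\prod_(i < n) fine (D w (B i)))%:E)); last first.
  by apply/funext => w; exact: Dpow_tbox.
apply/measurable_EFinP; apply: measurable_prod => i _.
apply: measurableT_comp; first exact: fine_measurable.
move=> _ V mV; rewrite setTI; apply: sub_sigma_algebra.
by exists (B i) => //; exists V => //; rewrite setTI.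
Qed.

Lemma measurable_intD n F : seq_measurable F -> measurable_fun setT (intD n F).
Proof. by move=> mF; apply: measurable_wrt_fun; exact: intD_measurable_wrt. Qed.

Lemma intD_ae_integrable n F : (law n).-integrable setT (EFin \o seqf F (n:=n)) ->
  {ae P, forall w, (Dpow n w).-integrable setT (EFin \o seqf F (n:=n))}.
Proof.
by apply: disintegration_ae_integrable => [U|U]; [exact: measurable_Dpow|exact: law_Dpow].
Qed.

Lemma intD_integrable n F : (law n).-integrable setT (EFin \o seqf F (n:=n)) ->
  P.-integrable setT (EFin \o intD n F).
Proof.
by apply: (@disintegration_integrable _ _ _ _ _ _ (Dpow n)) => [U|U];
  [exact: measurable_Dpow|exact: law_Dpow].
Qed.

Lemma expectation_intD n F : (law n).-integrable setT (EFin \o seqf F (n:=n)) ->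
  \int[law n]_t F t = \int[P]_w intD n F w.
Proof.
by apply: (disintegration_Rintegral (k := Dpow n)) => [U|U];
  [exact: measurable_Dpow|exact: law_Dpow].
Qed.

(** The identity is only almost sure, since the kernels need not be integrable on an exceptional set
    of fibres. *)
Lemma intD_lin n F G (a : R) : (law n).-integrable setT (EFin \o seqf F (n:=n)) ->
  (law n).-integrable setT (EFin \o seqf G (n:=n)) ->
  {ae P, forall w, intD n (fun s => a * F s + G s) w = a * intD n F w + intD n G w}.
Proof.
move=> /intD_ae_integrable aF /intD_ae_integrable aG; apply: filterS2 aF aG => w iF iG.
rewrite /intD RintegralD//; last first.
  by have := integrableZl measurableT a iF; congr (integrable _ _ _).
by rewrite RintegralZl.
Qed.

Lemma Rintegral_sqr_le d0 (T : measurableType d0) (mu : probability T R) (f : T -> R) :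
  mu.-integrable setT (EFin \o f) ->
  mu.-integrable setT (EFin \o (fun x => f x ^+ 2)) ->
  (\int[mu]_x f x) ^+ 2 <= \int[mu]_x (f x ^+ 2).
Proof.
move=> f1 f2; set m := \int[mu]_x f x.
have h : 0 <= \int[mu]_x ((f x - m) ^+ 2) by apply: Rintegral_ge0 => x _; exact: sqr_ge0.
have E : (fun x => (f x - m) ^+ 2) = (fun x => (f x ^+ 2 + (- (2 * m)) * f x) + m ^+ 2).
  by apply/funext => x; ring.
have i3 : mu.-integrable setT (EFin \o (fun x => - (2 * m) * f x)).
  by have := integrableZl measurableT (- (2 * m)) f1; congr (integrable _ _ _).
have ic : mu.-integrable setT (EFin \o (fun=> m ^+ 2)) by exact: sq_integrable_integrable (sq_integrable_cst _ _).
have i4 : mu.-integrable setT (EFin \o (fun x => f x ^+ 2 + (- (2 * m)) * f x)).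
  by have := integrableD measurableT f2 i3; congr (integrable _ _ _).
move: h; rewrite E RintegralD// RintegralD// RintegralZl// Rintegral_cst// -/m.
have -> : fine (mu setT) = 1 by rewrite probability_setT.
by move=> h; rewrite -subr_ge0; apply: le_trans h _; rewrite le_eqVlt; apply/orP; left; apply/eqP; ring.
Qed.

(** Jensen's inequality on almost every fibre, then integration over the fibres. *)
Lemma sqn_intD n F : seq_measurable F -> sq_integrable (law n) (seqf F (n:=n)) ->
  (sqn P (intD n F) <= sqn (law n) (seqf F (n:=n)))%E.
Proof.
move=> mF iF; have i1 := sq_integrable_integrable iF.
have i2 : (law n).-integrable setT (EFin \o seqf (fun s => F s ^+ 2) (n:=n)).
  by have := sq_integrable_mul iF iF; congr (integrable _ _ _).
have mF2 : seq_measurable (fun s => F s ^+ 2) by move=> k; apply: measurable_funX; exact: mF.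
have -> : sqn (law n) (seqf F (n:=n)) = (\int[P]_w (intD n (fun s => F s ^+ 2) w)%:E)%E.
  have := expectation_intD i2; rewrite /Rintegral => h.
  rewrite /sqn -[LHS]fineK; last exact: (integrable_fin_num measurableT i2).
  rewrite -[RHS]fineK; last exact: (integrable_fin_num measurableT (intD_integrable i2)).
  by rewrite h.
apply: ae_ge0_le_integral => //.
- by move=> w _; rewrite lee_fin sqr_ge0.
- exact: measurable_sqr (measurable_intD _ _).
- by move=> w _; rewrite lee_fin; apply: Rintegral_ge0 => t _; exact: sqr_ge0.
- by apply/measurable_EFinP; exact: measurable_intD.
- apply: filterS2 (intD_ae_integrable i1) (intD_ae_integrable i2) => w h1 h2 _.
  by rewrite lee_fin; exact: Rintegral_sqr_le.
Qed.

Lemma sq_integrable_intD n F : seq_measurable F -> sq_integrable (law n) (seqf F (n:=n)) ->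
  sq_integrable P (intD n F).
Proof.
move=> mF iF; split; first exact: measurable_intD.
by apply: le_lt_trans (sqn_intD mF iF) _; case: iF.
Qed.

Lemma L2_intD n F : seq_measurable F -> sq_integrable (law n) (seqf F (n:=n)) ->
  L2 P D (intD n F).
Proof.
move=> mF iF; split; first exact: intD_measurable_wrt.
by apply/Lfun2P; exact: sq_integrable_intD.
Qed.

Definition tselect k n (J : k.-tuple 'I_n) (t : n.-tuple A) : k.-tuple A :=
  [tuple tnth t (tnth J i) | i < k].

Lemma measurable_tselect k n (J : k.-tuple 'I_n) : measurable_fun setT (tselect J).
Proof.
apply/measurable_fun_tnthP => i.
rewrite (_ : _ \o _ = (fun t => tnth t (tnth J i))); first exact: measurable_tnth.
by apply/funext => t; rewrite /= tnth_mktuple.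
Qed.

HB.instance Definition _ k n (J : k.-tuple 'I_n) :=
  isMeasurableFun.Build _ _ _ _ (tselect J) (@measurable_tselect k n J).

Lemma Dpow_tselect k n (J : k.-tuple 'I_n) w : uniq J ->
  forall U, measurable U -> distribution (Dpow n w) (tselect J) U = Dpow k w U.
Proof.
move=> uJ; apply: tuple_measure_unique.
  by apply: (le_lt_trans (probability_le1 _ measurableT)); rewrite ltey.
(* Coordinates outside [J] are left free: their side is the whole space, of mass 1. *)
move=> B mB; pose B' j := if [pick i | tnth J i == j] is Some i then B i else setT.
have B'E i : B' (tnth J i) = B i.
  rewrite /B'; case: pickP => [i' /eqP|/(_ i)]; last by rewrite eqxx.
  by move/(tuple_uniqP J uJ) => ->.
have mB' j : measurable (B' j) by rewrite /B'; case: pickP.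
transitivity (Dpow n w (tbox B')).
  rewrite /distribution /= /pushforward; congr (Dpow n w _).
  apply/seteqP; split=> t h j.
    rewrite /B'; case: pickP => [i /eqP <-|//]; by have := h i; rewrite tnth_mktuple.
  by have := h (tnth J j); rewrite B'E tnth_mktuple.
rewrite (Dpow_tbox w mB') [RHS](Dpow_tbox w mB); congr EFin.
rewrite (bigID (mem J)) /= [X in _ * X]big1 ?mulr1; last first.
  move=> j jJ; rewrite /B'; case: pickP => [i /eqP ij|_].
    by move: jJ; rewrite -ij mem_tnth.
  by rewrite prob_kernel.
rewrite -big_uniq//= big_tuple; apply: eq_bigr => i _.
by rewrite B'E.
Qed.

Lemma law_tselect k n (J : k.-tuple 'I_n) : uniq J ->
  forall U, measurable U -> distribution (law n) (tselect J) U = law k U.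
Proof.
move=> uJ U mU; rewrite law_Dpow// /distribution /= /pushforward law_Dpow.
  by apply: eq_integral => w _; rewrite -(Dpow_tselect w uJ mU).
by rewrite -[_ @^-1` _]setTI; exact: measurable_tselect.
Qed.

Definition tcat m n (x : m.-tuple A * n.-tuple A) : (m + n).-tuple A :=
  cat_tuple x.1 x.2.

Lemma measurable_tcat m n : measurable_fun setT (@tcat m n).
Proof.
apply/measurable_fun_tnthP => i; case: (split_ordP i) => j ->.
  rewrite (_ : _ \o _ = (@tnth _ A ^~ j) \o fst).
    by apply: measurableT_comp => //; exact: measurable_tnth.
  by apply/funext => x; rewrite /= tnth_lshift.
rewrite (_ : _ \o _ = (@tnth _ A ^~ j) \o snd).
  by apply: measurableT_comp => //; exact: measurable_tnth.
by apply/funext => x; rewrite /= tnth_rshift.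
Qed.

HB.instance Definition _ m n :=
  isMeasurableFun.Build _ _ _ _ (@tcat m n) (@measurable_tcat m n).

Lemma Dpow_cat m n w U : measurable U ->
  distribution (Dpow m w \x Dpow n w)%E (@tcat m n) U = Dpow (m + n) w U.
Proof.
apply: tuple_measure_unique.
  by apply: (le_lt_trans (probability_le1 _ measurableT)); rewrite ltey.
move=> B mB; rewrite [RHS](Dpow_tbox w mB) big_split_ord EFinM.
rewrite -(@Dpow_tbox m w (fun i => B (lshift n i)))// -(@Dpow_tbox n w (fun i => B (rshift m i)))//.
rewrite -product_measure1E; [|exact: measurable_tbox|exact: measurable_tbox].
rewrite /distribution /= /pushforward; congr (product_measure1 _ _ _).
apply/seteqP; split=> -[x y] /=.
  move=> h; split=> i; first by have := h (lshift n i); rewrite tnth_lshift.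
  by have := h (rshift m i); rewrite tnth_rshift.
by move=> [hx hy] i; case: (split_ordP i) => j ->; rewrite ?tnth_lshift ?tnth_rshift.
Qed.

Lemma intD_mul m n F G w : seq_measurable F -> seq_measurable G ->
  (Dpow m w).-integrable setT (EFin \o seqf F (n:=m)) ->
  (Dpow n w).-integrable setT (EFin \o seqf G (n:=n)) ->
  intD (m + n) (fun s => F (take m s) * G (drop m s)) w = intD m F w * intD n G w.
Proof.
move=> mF mG iF iG.
have mH : measurable_fun setT (seqf (fun s => F (take m s) * G (drop m s)) (n := m + n)).
  apply: measurable_funM.
    apply: (measurable_seq_comp mF (k := m)) => [t|i im].
      by rewrite size_take size_tuple; case: ltngtP => //; rewrite ltnNge leq_addr.
    under eq_fun do rewrite nth_take//.
    exact: measurable_nth_tuple.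
  apply: (measurable_seq_comp mG (k := n)) => [t|i im].
    by rewrite size_drop size_tuple addKn.
  under eq_fun do rewrite nth_drop.
  exact: measurable_nth_tuple.
rewrite /intD.
have -> : (\int[Dpow (m + n) w]_t (F (take m t) * G (drop m t)) =
    \int[distribution (Dpow m w \x Dpow n w)%E (@tcat m n)]_t seqf (fun s => F (take m s) * G (drop m s)) t).
  by congr fine; apply: eq_measure_integral => U mU _; apply/esym/Dpow_cat.
rewrite Rintegral_distribution//.
have -> : (\int[(Dpow m w \x Dpow n w)%E]_x seqf (fun s => F (take m s) * G (drop m s)) (tcat x) =
    \int[(Dpow m w \x Dpow n w)%E]_x (F x.1 * G x.2)).
  apply: eq_Rintegral => x _; rewrite /seqf /= take_size_cat ?size_tuple//.
  by rewrite drop_size_cat ?size_tuple.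
have mf : measurable_fun setT (fun x : m.-tuple A * n.-tuple A => (F x.1 * G x.2)%:E).
  apply/measurable_EFinP; apply: measurable_funM.
    exact: (measurableT_comp (mF m)).
  exact: (measurableT_comp (mG n)).
have /integrableP[mF1 Foo] := iF; have /integrableP[mG1 Goo] := iG.
have ifg : (Dpow m w \x Dpow n w)%E.-integrable setT
    (fun x : m.-tuple A * n.-tuple A => (F x.1 * G x.2)%:E).
  apply/(@integrable12ltyP _ _ _ _ _ (Dpow m w) (Dpow n w) _ mf).
  have mGa : measurable_fun setT (fun x : n.-tuple A => `|G x|%:E).
    exact: (measurableT_comp (f := abse)) mG1.
  have mFa : measurable_fun setT (fun x : m.-tuple A => `|F x|%:E).
    exact: (measurableT_comp (f := abse)) mF1.
  have G0 : (0 <= \int[Dpow n w]_x `|G x|%:E)%E by apply: integral_ge0 => x _; rewrite lee_fin.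
  have F0 : (0 <= \int[Dpow m w]_x `|F x|%:E)%E by apply: integral_ge0 => x _; rewrite lee_fin.
  rewrite (eq_integral (fun x : m.-tuple A => `|F x|%:E * \int[Dpow n w]_y `|G y|%:E)%E).
    rewrite ge0_integralZr//.
    by rewrite lte_mul_pinfty// ge0_fin_numE.
  move=> x _; rewrite -ge0_integralZl//.
  by apply: eq_integral => y _; rewrite /= normrM EFinM.
rewrite {1}/Rintegral -(integral12_prod_meas1 ifg) /fubini_F /=.
rewrite (eq_integral (fun x : m.-tuple A => (F x)%:E * (\int[Dpow n w]_y G y)%:E)%E).
  by rewrite integralZr// fineM//; exact: integrable_fin_num.
move=> x _; rewrite /Rintegral fineK; last exact: (integrable_fin_num measurableT iG).
by rewrite -integralZl//; apply: eq_integral.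
Qed.

(** A common form for [mask], [drop] and [rotr] on tuples. Choosing distinct coordinates carries
    [Dpow n w] to [Dpow k w] and [law n] to [law k]. *)
Definition selects n k (phi : seq A -> seq A) : Prop :=
  exists2 J : k.-tuple 'I_n, uniq J & forall t : n.-tuple A, phi t = tselect J t.

Lemma selects_mask n k b : size b = n -> count id b = k -> selects n k (mask b).
Proof.
move=> sb cb; have sJ : size (mask b (enum 'I_n)) == k.
  by rewrite size_mask ?size_enum_ord ?cb.
exists (Tuple sJ); first by rewrite /= mask_uniq// enum_uniq.
move=> t; have -> : mask b t = map (tnth t) (mask b (enum 'I_n)).
  by rewrite map_mask map_tnth_enum.
apply: (@eq_from_nth _ point); first by rewrite size_map (eqP sJ) size_tuple.
move=> i; rewrite size_map (eqP sJ) => ik.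
rewrite -[i in RHS]/(nat_of_ord (Ordinal ik)) -tnth_nth tnth_mktuple.
rewrite (nth_map (tnth (Tuple sJ) (Ordinal ik))) ?(eqP sJ)//; congr tnth.
exact/esym/tnth_nth.
Qed.

Lemma selects_rotr n : selects n n (rotr 1).
Proof.
have sJ : size (rotr 1 (enum 'I_n)) == n by rewrite size_rotr size_enum_ord.
exists (Tuple sJ); first by rewrite /= rotr_uniq enum_uniq.
move=> t; have -> : rotr 1 t = map (tnth t) (rotr 1 (enum 'I_n)).
  by rewrite map_rotr map_tnth_enum.
apply: (@eq_from_nth _ point); first by rewrite size_map (eqP sJ) size_tuple.
move=> i; rewrite size_map (eqP sJ) => ik.
rewrite -[i in RHS]/(nat_of_ord (Ordinal ik)) -tnth_nth tnth_mktuple.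
rewrite (nth_map (tnth (Tuple sJ) (Ordinal ik))) ?(eqP sJ)//; congr tnth.
exact/esym/tnth_nth.
Qed.

Section selection.
Variables (n k : nat) (phi : seq A -> seq A).
Hypothesis hphi : selects n k phi.

Lemma measurable_select (F : seq A -> R) : seq_measurable F ->
  measurable_fun setT (fun t : n.-tuple A => F (phi t)).
Proof.
case: hphi => J _ phiJ mF; under eq_fun do rewrite phiJ.
exact: (measurableT_comp (mF k) (measurable_tselect J)).
Qed.

Lemma intD_select (F : seq A -> R) w : seq_measurable F ->
  intD n (fun s => F (phi s)) w = intD k F w.
Proof.
case: hphi => J uJ phiJ mF; rewrite /intD.
under eq_Rintegral do rewrite phiJ.
rewrite -(@Rintegral_distribution _ _ _ _ _ (Dpow n w) (tselect J) (fun t : k.-tuple A => F t))//.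
  by congr fine; apply: eq_measure_integral => U mU _; exact: Dpow_tselect.
exact: mF.
Qed.

Lemma ge0_law_select (F : seq A -> R) : seq_measurable F -> (forall s, 0 <= F s) ->
  (\int[law n]_t (F (phi t))%:E = \int[law k]_t (F t)%:E)%E.
Proof.
case: hphi => J uJ phiJ mF F0.
under eq_integral do rewrite phiJ.
rewrite -(@ge0_integral_distribution _ _ _ _ _ (law n) (tselect J) (fun t : k.-tuple A => (F t)%:E))//.
  by apply: eq_measure_integral => U mU _; exact: law_tselect.
  by apply/measurable_EFinP; exact: mF.
by move=> t; rewrite lee_fin.
Qed.

Lemma law_select_sq_integrable (F : seq A -> R) : seq_measurable F ->
  sq_integrable (law k) (seqf F (n:=k)) ->
  sq_integrable (law n) (seqf (fun s => F (phi s)) (n:=n)).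
Proof.
move=> mF [_ Foo]; split; first exact: measurable_select.
rewrite /sqn /seqf (@ge0_law_select (fun s => F s ^+ 2)) => // [m|s]; last exact: sqr_ge0.
by apply: measurable_funX; exact: mF.
Qed.

Lemma law_select_ae (Q : seq A -> Prop) : {ae law k, forall t : k.-tuple A, Q t} ->
  {ae law n, forall t : n.-tuple A, Q (phi t)}.
Proof.
case: hphi => J uJ phiJ [N [mN N0 QN]].
exists (tselect J @^-1` N); split.
- by rewrite -[_ @^-1` _]setTI; exact: measurable_tselect.
- by rewrite -N0 -(law_tselect uJ mN).
- by move=> t /= nQ; apply: QN => /= Qt; apply: nQ; rewrite phiJ.
Qed.

Lemma law_select (F : seq A -> R) : seq_measurable F ->
  \int[law n]_t F (phi t) = \int[law k]_t F t.
Proof.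
case: hphi => J uJ phiJ mF.
under eq_Rintegral do rewrite phiJ.
rewrite -(@Rintegral_distribution _ _ _ _ _ (law n) (tselect J) (fun t : k.-tuple A => F t))//.
  by congr fine; apply: eq_measure_integral => U mU _; exact: law_tselect.
exact: mF.
Qed.

End selection.

(** The conditional expectation of [F] at the next draw and the past, given the past [s]; it removes
    one variable from a kernel. *)
Let stepE (F : seq A -> R) (s : seq A) : R := \int[pstep alpha_gt0 s]_a F (a :: s).

Lemma polya_kernel_Rintegral n (F : seq A -> R) (t : n.-tuple A) : seq_measurable F ->
  \int[polya_kernel alpha_gt0 t]_u F u = stepE F t.
Proof.
move=> mF; rewrite /polya_kernel (@Rintegral_distribution _ _ _ _ _ _ (prepend t) (fun u => F u))//.
exact: mF.
Qed.

Lemma seq_measurable_step F : seq_measurable F -> seq_measurable (stepE F).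
Proof.
move=> mF n; rewrite (_ : (fun t => _) = (fun t : n.-tuple A => \int[polya_kernel alpha_gt0 t]_u F u)).
  by apply: measurable_fam_Rintegral; [move=> U; exact: measurable_polya_kernel|exact: mF].
by apply/funext => t; rewrite polya_kernel_Rintegral.
Qed.

Lemma law_step n F : seq_measurable F ->
  (law n.+1).-integrable setT (EFin \o seqf F (n:=n.+1)) ->
  [/\ {ae law n, forall t : n.-tuple A, (pstep alpha_gt0 t).-integrable setT (fun a => (F (a :: t))%:E)},
   (law n).-integrable setT (EFin \o seqf (stepE F) (n:=n)) &
   \int[law n.+1]_t F t = \int[law n]_t stepE F t].
Proof.
move=> mF iF.
have mk U := @measurable_polya_kernel _ _ _ alpha alpha_gt0 n U.
have E := @law_polya_kernel n.
split.
- have := disintegration_ae_integrable mk E iF; apply: filterS => t.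
  by move=> /(@integrable_distribution _ _ _ _ _ _ (prepend t) (fun u => F u) (mF _)).
- have := disintegration_integrable mk E iF; congr (integrable _ _ _).
  by apply/funext => t; rewrite /= /seqf -polya_kernel_Rintegral.
- have := disintegration_Rintegral mk E iF => ->.
  by apply: eq_Rintegral => t _; exact: polya_kernel_Rintegral.
Qed.

Lemma Rintegral_sum d0 (T : measurableType d0) (mu : {measure set T -> \bar R}) (I : eqType)
    (s : seq I) (f : I -> T -> R) :
  (forall i, i \in s -> mu.-integrable setT (EFin \o f i)) ->
  mu.-integrable setT (EFin \o (fun x => \sum_(i <- s) f i x)) /\
  \int[mu]_x (\sum_(i <- s) f i x) = \sum_(i <- s) \int[mu]_x f i x.
Proof.
elim: s => [|i s IH] fi.
  rewrite big_nil; under eq_fun do rewrite big_nil; split; first exact: integrable0.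
  by rewrite /Rintegral integral0.
have [is_ {}IH] : mu.-integrable setT (EFin \o (fun x => \sum_(i <- s) f i x)) /\
  \int[mu]_x (\sum_(i <- s) f i x) = \sum_(i <- s) \int[mu]_x f i x.
  by apply: IH => j js; apply: fi; rewrite inE js orbT.
have fi0 : mu.-integrable setT (EFin \o f i) by apply: fi; rewrite mem_head.
have E : (fun x => \sum_(j <- i :: s) f j x) = (fun x => f i x + \sum_(j <- s) f j x).
  by apply/funext => x; rewrite big_cons.
rewrite E big_cons RintegralD// IH; split => //.
by have := integrableD measurableT fi0 is_; congr (integrable _ _ _).
Qed.

Lemma ae_eq_Rintegral d0 (T : measurableType d0) (mu : {measure set T -> \bar R}) (f g : T -> R) :
  measurable_fun setT f -> measurable_fun setT g -> {ae mu, forall x, f x = g x} ->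
  \int[mu]_x f x = \int[mu]_x g x.
Proof.
move=> mf mg fg; congr fine; apply: ae_eq_integral => //.
- exact/measurable_EFinP.
- exact/measurable_EFinP.
- by apply: filterS fg => x -> _.
Qed.

Lemma ae_eq_integrable d0 (T : measurableType d0) (mu : {measure set T -> \bar R}) (f g : T -> R) :
  measurable_fun setT g -> {ae mu, forall x, f x = g x} ->
  mu.-integrable setT (EFin \o f) -> mu.-integrable setT (EFin \o g).
Proof.
move=> mg fg /integrableP[mf foo].
have mG : measurable_fun setT (EFin \o g) by exact/measurable_EFinP.
apply/integrableP; split => //; rewrite -(@ae_eq_integral _ _ _ _ _ _ (fun x => `|(EFin \o f) x|)%E)//.
- exact: measurableT_comp.
- exact: measurableT_comp.
- by apply: filterS fg => x /= -> _.
Qed.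

(** The atoms carry finite values, so integrability does not depend on the history; it can be moved
    from a part of the draws to all of them. *)
Lemma pstep_integrableP (f : A -> R) s : measurable_fun setT f ->
  (pstep alpha_gt0 s).-integrable setT (EFin \o f) <-> alpha.-integrable setT (EFin \o f).
Proof.
move=> mf; have mF : measurable_fun setT (EFin \o f) by exact/measurable_EFinP.
have E : (\int[pstep alpha_gt0 s]_a `|(EFin \o f) a| =
    ((c + (size s)%:R)^-1)%:E * (\int[alpha]_a `|(EFin \o f) a| + \sum_(b <- s) `|(EFin \o f) b|))%E.
  by rewrite -ge0_integral_polya_step//; exact: measurableT_comp.
have S : (\sum_(b <- s) `|(EFin \o f) b| = (\sum_(b <- s) `|f b|)%:E)%E by rewrite -sumEFin.
have k0 : 0 < (c + (size s)%:R)^-1 by rewrite invr_gt0 mass_addn_gt0.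
split=> /integrableP[_ h]; apply/integrableP; split => //.
  move: h; rewrite E S; set I := (\int[alpha]_a `|(EFin \o f) a|)%E.
  have : (0 <= I)%E by exact: integral_ge0.
  case: I => [r||]//; first by move=> _ _; rewrite ltey.
  by rewrite addye// gt0_muley// lte_fin.
rewrite E S lte_mul_pinfty// ?lee_fin ?ltW//.
by rewrite lte_add_pinfty// ltey.
Qed.

Lemma Rintegral_pstep (f : A -> R) s : measurable_fun setT f ->
  alpha.-integrable setT (EFin \o f) ->
  (c + (size s)%:R) * \int[pstep alpha_gt0 s]_a f a = \int[alpha]_a f a + \sum_(b <- s) f b.
Proof.
move=> mf fi; have mF : measurable_fun setT (EFin \o f) by exact/measurable_EFinP.
have k0 : 0 < c + (size s)%:R by exact: mass_addn_gt0.
rewrite /Rintegral integralE.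
rewrite (@ge0_integral_polya_step _ _ _ alpha s ((EFin \o f)^\+)%E)//; last exact: measurable_funepos.
rewrite (@ge0_integral_polya_step _ _ _ alpha s ((EFin \o f)^\-)%E)//; last exact: measurable_funeneg.
have p1 : (\int[alpha]_a (EFin \o f)^\+ a)%E \is a fin_num.
  by apply: integrable_fin_num => //; exact: integrable_funepos.
have n1 : (\int[alpha]_a (EFin \o f)^\- a)%E \is a fin_num.
  by apply: integrable_fin_num => //; exact: integrable_funeneg.
have pE b : ((EFin \o f)^\+ b = (Num.max (f b) 0)%:E)%E by rewrite funeposE /= EFin_max.
have nE b : ((EFin \o f)^\- b = (Num.max (- f b) 0)%:E)%E by rewrite funenegE /= EFin_max.
under eq_bigr do rewrite pE; under [X in (_ - _ * (_ + X))%E]eq_bigr do rewrite nE.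
have kE (x : \bar R) (g : A -> R) : x \is a fin_num ->
    (((c + (size s)%:R)^-1)%:E * (x + \sum_(b <- s) (g b)%:E) =
     ((c + (size s)%:R)^-1 * (fine x + \sum_(b <- s) g b))%:E)%E.
  by move=> xf; rewrite -[in LHS](fineK xf) sumEFin.
rewrite !kE// [in RHS]integralE -(fineK p1) -(fineK n1) -!EFinB /=.
rewrite -mulrBr mulrA divff ?mul1r ?gt_eqF// opprD addrACA -sumrB; congr (_ + _).
apply: eq_bigr => b _; have [h|/ltW h] := leP (f b) 0.
  by rewrite max_l ?oppr_ge0// sub0r opprK.
by rewrite max_r ?oppr_le0// subr0.
Qed.

(** This is the cancellation device: without the normalising constants, a longer history adds only a
    sum over the added draws. If the integral of [f] vanishes for [s], nothing but that sum remains
    for [z]. *)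
Lemma Rintegral_pstep_compare (f : A -> R) s u z : measurable_fun setT f ->
  (pstep alpha_gt0 s).-integrable setT (EFin \o f) -> perm_eq z (s ++ u) ->
  (c + (size z)%:R) * \int[pstep alpha_gt0 z]_a f a =
  (c + (size s)%:R) * \int[pstep alpha_gt0 s]_a f a + \sum_(b <- u) f b.
Proof.
move=> mf /(pstep_integrableP _ mf) fi zsu.
rewrite !Rintegral_pstep// (perm_big _ zsu) big_cat /=.
by rewrite addrA.
Qed.

Definition totuple n (s : seq A) : n.-tuple A := [tuple nth point s i | i < n].

Lemma totupleK n (t : n.-tuple A) : totuple n t = t.
Proof. by apply: eq_from_tnth => i; rewrite tnth_mktuple (tnth_nth point). Qed.

Lemma measurable_totuple d1 (T1 : measurableType d1) (phi : T1 -> seq A) n :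
  (forall i, measurable_fun setT (fun x => nth point (phi x) i)) ->
  measurable_fun setT (fun x => totuple n (phi x)).
Proof.
move=> mphi; apply/measurable_fun_tnthP => i.
rewrite (_ : _ \o _ = (fun x => nth point (phi x) i)); first exact: mphi.
by apply/funext => x /=; rewrite tnth_mktuple.
Qed.

(* Kernels are functions on sequences, measurable at every length; only their
   values on sequences of length n matter for intD n. By exchangeability the
   vanishing conditional expectation can be taken given the last n-1 variables,
   which makes the first one the urn's next draw. *)
Definition degenerate n (F : seq A -> R) : Prop :=
  if n is m.+1 then forall U : set (m.-tuple A), measurable U ->
    \int[law m.+1]_t (F t * \1_U (totuple m (behead t))) = 0
  else True.

(** The definition tests [F] against indicators, a condition stable under linear combinations and
    limits, whereas the key identity needs the urn step to vanish on almost every history. Both say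
    the same because a function whose integral over every measurable set is zero vanishes almost
    everywhere. *)
Lemma degenerateP n F : seq_measurable F ->
  (law n.+1).-integrable setT (EFin \o seqf F (n:=n.+1)) ->
  degenerate n.+1 F <-> {ae law n, forall t : n.-tuple A, stepE F t = 0}.
Proof.
move=> mF iF; have [_ iS _] := law_step mF iF.
have mI (U : set (n.-tuple A)) : measurable U ->
    seq_measurable (fun s => \1_U (totuple n (behead s)) : R).
  move=> mU k; apply: measurableT_comp; first exact: measurable_indic.
  apply: measurable_totuple => i; under eq_fun do rewrite nth_behead.
  exact: measurable_nth_tuple.
have E (U : set (n.-tuple A)) : measurable U ->
    \int[law n.+1]_t (F t * \1_U (totuple n (behead t))) =
    \int[law n]_t (stepE F t * \1_U t).
  move=> mU; have mFI : seq_measurable (fun s => F s * \1_U (totuple n (behead s))).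
    by move=> k; apply: measurable_funM; [exact: mF|exact: mI].
  have iFI : (law n.+1).-integrable setT
      (EFin \o seqf (fun s => F s * \1_U (totuple n (behead s))) (n:=n.+1)).
    apply: (le_integrable measurableT _ _ iF); first by apply/measurable_EFinP; exact: mFI.
    move=> t _; rewrite lee_fin /seqf normrM ler_piMr// indicE.
    by case: (_ \in _); rewrite /= ?normr1 ?normr0.
  have [_ _ ->] := law_step mFI iFI.
  apply: eq_Rintegral => t _; rewrite /stepE /=; under eq_Rintegral do rewrite totupleK.
  rewrite indicE; case: (_ \in _); rewrite /= ?mulr1 ?mulr0.
    by under eq_Rintegral do rewrite mulr1.
  by under eq_Rintegral do rewrite mulr0; rewrite /Rintegral integral0.
split=> [dF|ae0 U mU]; last first.
  rewrite E//; rewrite /Rintegral (ae_eq_integral (cst 0%E)) ?integral0//.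
    apply/measurable_EFinP; apply: measurable_funM; first exact: seq_measurable_step.
    exact: measurable_indic.
  by apply: filterS ae0 => t /= -> _; rewrite mul0r.
have H : ae_eq (law n) setT (EFin \o seqf (stepE F) (n:=n)) (cst 0%E).
  apply: (integral_ae_eq measurableT iS (measurable_cst _)) => U _ mU; rewrite integral0.
  have := dF U mU; rewrite E// /Rintegral => h; rewrite integral_mkcond.
  have -> : ((EFin \o seqf (stepE F) (n:=n)) \_ U = fun t => (stepE F t * \1_U t)%:E)%E.
    apply/funext => t; rewrite /patch indicE; case: (_ \in _); rewrite ?mulr1 ?mulr0//.
  rewrite -[LHS]fineK ?h//; apply: integrable_fin_num => //.
  apply: (le_integrable measurableT _ _ iS).
    by apply/measurable_EFinP; apply: measurable_funM; [exact: seq_measurable_step|exact: measurable_indic].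
  move=> t _; rewrite lee_fin /seqf normrM ler_piMr// indicE.
  by case: (_ \in _); rewrite /= ?normr1 ?normr0.
by apply: filterS H => t /(_ I) [].
Qed.

Definition seq_symmetric n (F : seq A -> R) : Prop :=
  forall s s', size s = n -> perm_eq s s' -> F s = F s'.

Definition degenerate_kernel n (F : seq A -> R) : Prop :=
  [/\ seq_measurable F, seq_symmetric n F, sq_integrable (law n) (seqf F (n:=n)) &
      degenerate n F].

Lemma seq_measurable_nth b i : seq_measurable (fun s : seq A => nth point (mask b s) i).
Proof.
move=> n; have [ik|ik] := ltnP i (size (mask b (iota 0 n))).
  rewrite (_ : (fun _ => _) = (fun t : n.-tuple A => nth point t (nth 0%N (mask b (iota 0 n)) i))).
    exact: measurable_nth_tuple.
  apply/funext => t; rewrite -[in LHS](mkseq_nth point t) /mkseq size_tuple -map_mask.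
  by rewrite (nth_map 0%N).
under eq_fun => t.
  rewrite nth_default; last first.
    by rewrite -(mkseq_nth point t) /mkseq size_tuple -map_mask size_map.
  over.
exact: measurable_cst.
Qed.

Lemma seq_measurable_mask (F : seq A -> R) b : seq_measurable F ->
  seq_measurable (fun s => F (mask b s)).
Proof.
move=> mF n; apply: (measurable_seq_comp mF (k := size (mask b (iota 0 n)))).
  move=> t; rewrite -(size_map (nth point t)) map_mask; congr (size (mask _ _)).
  by rewrite -[in LHS](mkseq_nth point t) /mkseq size_tuple.
by move=> i _; exact: seq_measurable_nth.
Qed.

Lemma seq_measurable_drop d2 (S : measurableType d2) (F : seq A -> S) q : seq_measurable F ->
  seq_measurable (fun s => F (drop q s)).
Proof.
move=> mF n; apply: (measurable_seq_comp mF (k := (n - q)%N)).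
  by move=> t; rewrite size_drop size_tuple.
by move=> i _; under eq_fun do rewrite nth_drop; exact: measurable_nth_tuple.
Qed.

Lemma drop_mask (q : nat) (s : seq A) : (q <= size s)%N ->
  drop q s = mask (nseq q false ++ nseq (size s - q) true) s.
Proof.
move=> qs; rewrite -[in RHS](cat_take_drop q s) mask_cat; last first.
  by rewrite size_nseq size_takel.
by rewrite mask_false /= cat_take_drop mask_true// size_drop.
Qed.

Lemma selects_drop q m : selects (q + m) m (drop q).
Proof.
have := @selects_mask (q + m) m (nseq q false ++ nseq m true).
rewrite size_cat !size_nseq count_cat !count_nseq /= mul0n mul1n => /(_ erefl erefl)[J uJ h].
exists J => // t; rewrite -h drop_mask ?size_tuple ?leq_addr//; congr (mask (_ ++ nseq _ _) _).
by rewrite addKn.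
Qed.

(** * Expectation of a product of two random integrals *)

Section key_identity.
Variables (m : nat) (G : seq A -> R).
Hypotheses (mG : seq_measurable G) (iG : sq_integrable (law m) (seqf G (n:=m))).
Variables (n : nat) (F : seq A -> R).
Hypothesis hF : degenerate_kernel n F.

Let mF : seq_measurable F. Proof. by case: hF. Qed.
Let symF : seq_symmetric n F. Proof. by case: hF. Qed.
Let iF : sq_integrable (law n) (seqf F (n:=n)). Proof. by case: hF. Qed.

(* G sees the last m variables, F sees the first q and r of those seen by G. *)
Let J q r : R := \sum_(S <- masks m r)
  \int[law (q + m)]_t (G (drop q t) * F (mask (nseq q true ++ S) t)).

Let selS q r S : (q + r = n)%N -> S \in masks m r ->
  selects (q + m) n (mask (nseq q true ++ S)).
Proof.
move=> qr /masksP[sS cS]; apply: selects_mask.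
  by rewrite size_cat size_nseq sS.
by rewrite count_cat count_nseq /= mul1n cS.
Qed.

Let iJ q r S : (q + r = n)%N -> S \in masks m r ->
  (law (q + m)).-integrable setT
    (EFin \o seqf (fun s => G (drop q s) * F (mask (nseq q true ++ S) s)) (n := q + m)).
Proof.
move=> qr hS.
have := sq_integrable_mul (law_select_sq_integrable (selects_drop q m) mG iG)
  (law_select_sq_integrable (selS qr hS) mF iF).
by congr (integrable _ _ _).
Qed.

(** Integrate out the front variable, which [F] alone sees. Given the other variables of [F] its
    integral is zero, so only the variables of [G] outside [S] contribute, each by a point
    evaluation that enlarges [S] by one element; a set of size [r + 1] is reached in [r + 1]
    ways. *)
Let J_step q r : (q.+1 + r = n)%N ->
  (c + (q + m)%:R) * J q.+1 r = r.+1%:R * J q r.+1.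
Proof.
move=> qr; have qr' : (q + r.+1 = n)%N by rewrite addnS -addSn.
have qr1 : n = (q + r).+1 by rewrite -qr addSn.
pose H S (t : (q + m).-tuple A) : R := G (drop q t) *
  \sum_(b <- mask (map negb S) (drop q t)) F (b :: mask (nseq q true ++ S) t).
have step S : S \in masks m r ->
    (law (q + m)).-integrable setT (EFin \o H S) /\
    (c + (q + m)%:R) * \int[law (q.+1 + m)]_t (G (drop q.+1 t) * F (mask (nseq q.+1 true ++ S) t)) =
    \int[law (q + m)]_t H S t.
  move=> hS; have [sS cS] := masksP hS.
  have mPhi : seq_measurable (fun s => G (drop q.+1 s) * F (mask (nseq q.+1 true ++ S) s)).
    by move=> k; apply: measurable_funM; [exact: seq_measurable_drop|exact: seq_measurable_mask].
  have [aeP iP ->] := law_step mPhi (iJ qr hS).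
  have sel : selects (q + m) (q + r) (mask (nseq q true ++ S)).
    apply: selects_mask; first by rewrite size_cat size_nseq sS.
    by rewrite count_cat count_nseq /= mul1n cS.
  have iF' : (law (q + r).+1).-integrable setT (EFin \o seqf F (n := (q + r).+1)).
    by rewrite -qr1; exact: sq_integrable_integrable iF.
  have [aeF _ _] := law_step mF iF'.
  have dF : degenerate (q + r).+1 F by rewrite -qr1; case: hF.
  have ae0 := (degenerateP mF iF').1 dF.
  have aeH : {ae law (q + m), forall t : (q + m).-tuple A,
      (c + (q + m)%:R) * stepE (fun s => G (drop q.+1 s) * F (mask (nseq q.+1 true ++ S) s)) t = H S t}.
    have h1 := law_select_ae sel (Q := fun s => (pstep alpha_gt0 s).-integrable setT
      (fun a => (F (a :: s))%:E)) aeF.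
    have h2 := law_select_ae sel (Q := fun s => stepE F s = 0) ae0.
    apply: filterS2 h1 h2 => t h1 h2.
    have mFa : measurable_fun setT (fun a => F (a :: mask (nseq q true ++ S) t)).
      apply: (measurable_seq_comp mF (k := (size (mask (nseq q true ++ S) t)).+1)) => // -[|i] _ /=.
        exact: measurable_id.
      exact: measurable_cst.
    (* The full history consists of the variables seen by [F] and of those of [G] that [S] leaves
       out. *)
    have pt : perm_eq t (mask (nseq q true ++ S) t ++ mask (map negb S) (drop q t)).
      rewrite -[in X in perm_eq X _](cat_take_drop q t).
      have -> : mask (nseq q true ++ S) t = take q t ++ mask S (drop q t).
        rewrite -[in LHS](cat_take_drop q t) mask_cat ?mask_true//; first by rewrite size_takel// size_tuple leq_addr.
        by rewrite size_nseq size_takel// size_tuple leq_addr.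
      rewrite -catA perm_cat2l; apply: perm_mask_negb.
      by rewrite size_drop size_tuple addKn.
    (* Integrability is known for the part of the history seen by [F] and reaches the whole history
       through [alpha]. *)
    rewrite /stepE /= RintegralZl//; last first.
      exact: ((pstep_integrableP t mFa).2 ((pstep_integrableP _ mFa).1 h1)).
    rewrite /H mulrCA; congr (_ * _).
    have := Rintegral_pstep_compare mFa h1 pt; rewrite size_tuple => ->.
    by rewrite -[X in _ * X]/(stepE F _) h2 mulr0 add0r.
  have mH : measurable_fun setT (H S).
    apply: measurable_funM; first exact: (seq_measurable_drop q mG).
    have sz (t : (q + m).-tuple A) : size (mask (map negb S) (drop q t)) = count id (map negb S).
      by rewrite size_mask// size_map sS size_drop size_tuple addKn.
    rewrite (_ : (fun _ => _) = (fun t : (q + m).-tuple A => \sum_(0 <= i < count id (map negb S))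
        F (nth point (mask (map negb S) (drop q t)) i :: mask (nseq q true ++ S) t))); last first.
      by apply/funext => t; rewrite (big_nth point) sz.
    apply: measurable_sum => i.
    have szm (t : (q + m).-tuple A) : size (mask (nseq q true ++ S) t) = (q + r)%N.
      by rewrite size_mask ?size_cat ?size_nseq ?sS ?size_tuple// count_cat count_nseq /= mul1n cS.
    apply: (measurable_seq_comp mF (k := (q + r).+1)) => [t|[|l] hl] /=; first by rewrite szm.
      exact: (seq_measurable_drop q (seq_measurable_nth (map negb S) i)).
    exact: (seq_measurable_nth (nseq q true ++ S) l).
  have mstep := seq_measurable_step mPhi.
  have mcs : measurable_fun setT (fun t : (q + m).-tuple A => (c + (q + m)%:R) *
      stepE (fun s => G (drop q.+1 s) * F (mask (nseq q.+1 true ++ S) s)) t).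
    by apply: measurable_funM; [exact: measurable_cst|exact: mstep].
  split.
    apply: (ae_eq_integrable mH aeH).
    by have := integrableZl measurableT (c + (q + m)%:R) iP; congr (integrable _ _ _).
  by rewrite -RintegralZl//; exact: ae_eq_Rintegral.
have -> : (c + (q + m)%:R) * J q.+1 r = \int[law (q + m)]_t \sum_(S <- masks m r) H S t.
  have [|_ ->] := @Rintegral_sum _ _ (law (q + m)) _ (masks m r) H; first by move=> S /step[].
  by rewrite /J mulr_sumr; apply: eq_big_seq => S /step[].
rewrite /J; have [|iS <-] := @Rintegral_sum _ _ (law (q + m)) _ (masks m r.+1)
  (fun S t => G (drop q t) * F (mask (nseq q true ++ S) t)).
  by move=> S hS; exact: (iJ qr' hS).
rewrite -RintegralZl//; apply: eq_Rintegral => t _.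
have sy : size (drop q t) = m by rewrite size_drop size_tuple addKn.
have qt : (q <= size t)%N by rewrite size_tuple leq_addr.
have maskE S : mask (nseq q true ++ S) t = take q t ++ mask S (drop q t).
  by rewrite -[in LHS](cat_take_drop q t) mask_cat ?mask_true//; rewrite ?size_nseq size_takel.
rewrite /H -mulr_sumr -mulr_sumr mulrCA; congr (_ * _).
under [in RHS]eq_bigr do rewrite maskE.
have := @sum_mask_insert A R r (fun u => F (take q t ++ u)) (drop q t).
rewrite /subsum sy => <-; last first.
  by move=> u v su uv; apply: symF; rewrite ?perm_cat2l// size_cat size_takel// su.
apply: eq_big_seq => S /masksP[sS cS]; apply: eq_bigr => b _.
rewrite maskE; apply: symF.
  by rewrite /= size_cat size_takel// size_mask ?sS// cS -addnS.
by rewrite -cat1s perm_catCA.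
Qed.

Lemma expectation_intD_mul :
  (\prod_(q < n) (c + (q + m)%:R)) * \int[P]_w (intD n F w * intD m G w) =
  n`!%:R * \sum_(S <- masks m n) \int[law m]_t (G t * F (mask S t)).
Proof.
have -> : \sum_(S <- masks m n) \int[law m]_t (G t * F (mask S t)) = J 0 n.
  by rewrite /J; apply: eq_bigr => S _; apply: eq_Rintegral => t _; rewrite drop0.
(* For [r = 0] the two kernels see disjoint variables, so on almost every fibre the integral over
   [n + m] variables factors. *)
have -> : \int[P]_w (intD n F w * intD m G w) = J n 0.
  rewrite /J masks0 big_seq1.
  have n0 : (n + 0 = n)%N by rewrite addn0.
  have hS : nseq m false \in masks m 0 by rewrite masks0 mem_head.
  have mFG : seq_measurable (fun s => F (take n s) * G (drop n s)).
    move=> k; apply: measurable_funM; last exact: seq_measurable_drop.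
    apply: (measurable_seq_comp mF (k := minn n k)) => [t|i].
      by rewrite size_take_min size_tuple.
    rewrite leq_min => /andP[i_n _]; under eq_fun do rewrite nth_take//.
    exact: measurable_nth_tuple.
  have E (t : (n + m).-tuple A) : G (drop n t) * F (mask (nseq n true ++ nseq m false) t) =
      F (take n t) * G (drop n t).
    rewrite mulrC; congr (F _ * _).
    rewrite -[in LHS](cat_take_drop n t) mask_cat ?mask_true ?mask_false ?cats0//;
      by rewrite ?size_nseq size_takel// size_tuple leq_addr.
  under [RHS]eq_Rintegral do rewrite E.
  have iFG : (law (n + m)).-integrable setT
      (EFin \o seqf (fun s => F (take n s) * G (drop n s)) (n := n + m)).
    have := iJ n0 hS; congr (integrable _ _ _); apply/funext => t /=.
    by rewrite /seqf E.
  rewrite (expectation_intD iFG).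
  apply: ae_eq_Rintegral.
  - by apply: measurable_funM; exact: measurable_intD.
  - exact: measurable_intD.
  - have i1 := intD_ae_integrable (sq_integrable_integrable iF).
    have i2 := intD_ae_integrable (sq_integrable_integrable iG).
    by apply: filterS2 i1 i2 => w h1 h2; rewrite intD_mul.
(* Each use of [J_step] exchanges a factor [c + q + m] for a factor [r + 1]; the weight [r!] makes
   the latter telescope to [n!]. *)
have H : forall q r, (q + r = n)%N ->
    \prod_(q' < q) (c + (q' + m)%:R) * J q r * (r`!)%:R = n`!%:R * J 0 n.
  elim=> [|q IH] r qr; first by rewrite big_ord0 mul1r mulrC -qr.
  rewrite -(IH r.+1) ?addnS -?addSn// big_ord_recr /= -[_ * _ * J q.+1 r]mulrA (J_step qr).
  by rewrite factS natrM; ring.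
by have := H n 0%N (addn0 n); rewrite fact0 mulr1.
Qed.

End key_identity.

(** * Hoeffding decomposition *)

(** Boundedness makes every urn step and every random integral well defined at every point, so the
    algebra of the decomposition holds without exceptional sets. *)
Definition bounded_kernel (F : seq A -> R) : Prop :=
  seq_measurable F /\ exists K : R, forall s, `|F s| <= K.

Lemma bounded_integrable d0 (T : measurableType d0) (mu : probability T R) (f : T -> R) K :
  measurable_fun setT f -> (forall x, `|f x| <= K) -> mu.-integrable setT (EFin \o f).
Proof. by move=> mf fK; exact: sq_integrable_integrable (sq_integrable_bounded mu mf fK). Qed.

Lemma Rintegral_cst_prob d0 (T : measurableType d0) (mu : probability T R) (k : R) :
  \int[mu]_x (cst k x) = k.
Proof.
rewrite Rintegral_cst//; have -> : fine (mu setT) = 1 by rewrite probability_setT.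
by rewrite mulr1.
Qed.

Lemma measurable_cons_seq (F : seq A -> R) s : seq_measurable F ->
  measurable_fun setT (fun a => F (a :: s)).
Proof.
move=> mF; apply: (measurable_seq_comp mF (k := (size s).+1)) => // -[|i] _ /=.
  exact: measurable_id.
exact: measurable_cst.
Qed.

Lemma bounded_pstep F s z : bounded_kernel F ->
  (pstep alpha_gt0 z).-integrable setT (EFin \o (fun a => F (a :: s))).
Proof.
move=> [mF [K FK]]; apply: (@bounded_integrable _ _ (pstep alpha_gt0 z) _ K).
  exact: measurable_cons_seq.
by move=> a; exact: FK.
Qed.

Lemma bounded_step F : bounded_kernel F -> bounded_kernel (stepE F).
Proof.
move=> bF; have [mF [K FK]] := bF; split; first exact: seq_measurable_step.
exists K => s; have K0 : 0 <= K by apply: le_trans (FK [::]).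
apply: le_trans (le_normr_Rintegral measurableT (bounded_pstep s s bF)) _.
apply: (@le_trans _ _ (\int[pstep alpha_gt0 s]_a cst K a)).
  apply: le_Rintegral => //.
    have := integrable_norm (bounded_pstep s s bF); congr (integrable _ _ _).
  exact: (@bounded_integrable _ _ (pstep alpha_gt0 s) _ `|K|).
by rewrite (Rintegral_cst_prob (pstep alpha_gt0 s)).
Qed.

Lemma step_symmetric n F : bounded_kernel F -> seq_symmetric n.+1 F ->
  seq_symmetric n (stepE F).
Proof.
move=> bF symF s s' sn ss'; have [mF _] := bF.
have ps : perm_eq s' (s ++ [::]) by rewrite cats0 perm_sym.
have := Rintegral_pstep_compare (measurable_cons_seq s mF) (bounded_pstep s s bF) ps.
rewrite big_nil addr0 (perm_size ss') => /(mulfI _) => H.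
rewrite /stepE -H ?gt_eqF ?mass_addn_gt0//; apply: eq_Rintegral => a _.
by apply: symF; rewrite ?perm_cons//= sn.
Qed.

(** Split the subsequences according to whether they contain the new draw. Those without it are
    unaffected; for the others, comparing the history [x] with the selected part gives the urn step
    of [g] plus insertions, and the insertions are again sums over [k + 1] entries. *)
Lemma step_subsum k (g : seq A -> R) x : bounded_kernel g -> seq_symmetric k.+1 g ->
  (c + (size x)%:R) * stepE (subsum k.+1 g) x =
  (c + (size x)%:R + k.+1%:R) * subsum k.+1 g x + (c + k%:R) * subsum k (stepE g) x.
Proof.
move=> bg symg; have [mg _] := bg; rewrite /stepE.
under eq_Rintegral do rewrite subsumS.
have [|ig IG] := @Rintegral_sum _ _ (pstep alpha_gt0 x) _ (masks (size x) k)
  (fun S a => g (a :: mask S x)); first by move=> S _; exact: bounded_pstep.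
rewrite RintegralD//; last first.
  by apply: (@bounded_integrable _ _ (pstep alpha_gt0 x) _ `|subsum k.+1 g x|) => //.
rewrite (Rintegral_cst_prob (pstep alpha_gt0 x)).
rewrite [X in _ * (_ + X)]IG mulrDr [X in _ + X]mulr_sumr.
rewrite [X in _ + X](eq_big_seq (fun S => (c + k%:R) * stepE g (mask S x) +
    \sum_(b <- mask (map negb S) x) g (b :: mask S x))); last first.
  move=> S /masksP[sS cS].
  have := Rintegral_pstep_compare (measurable_cons_seq (mask S x) mg)
    (bounded_pstep (mask S x) (mask S x) bg) (perm_mask_negb sS).
  by rewrite size_mask// cS.
rewrite big_split /= sum_mask_insert// -mulr_sumr.
rewrite -/(subsum k.+1 g x) -/(subsum k (stepE g) x) [in RHS]mulrDl -[in RHS]addrA; congr (_ + _).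
by rewrite addrC.
Qed.

Lemma seq_measurable_subsum k (F : seq A -> R) : seq_measurable F ->
  seq_measurable (fun s => subsum k F s : R).
Proof.
move=> mF n; rewrite /subsum; under eq_fun do rewrite size_tuple.
by apply: measurable_sum => S; exact: (seq_measurable_mask S mF).
Qed.

Lemma bounded_mask F S : bounded_kernel F -> bounded_kernel (fun s => F (mask S s)).
Proof. by move=> [mF [K FK]]; split; [exact: seq_measurable_mask|exists K]. Qed.

Lemma intD_subsum n k F w : bounded_kernel F ->
  intD n (subsum k F) w = (size (masks n k))%:R * intD k F w.
Proof.
move=> bF; have [mF [K FK]] := bF; rewrite /intD /subsum.
under eq_Rintegral do rewrite size_tuple.
have [|_ ->] := @Rintegral_sum _ _ (Dpow n w) _ (masks n k) (fun S t => F (mask S t)).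
  move=> S _; apply: (@bounded_integrable _ _ (Dpow n w) _ K) => //.
  exact: (seq_measurable_mask S mF).
rewrite (eq_big_seq (fun=> intD k F w)); last first.
  by move=> S /masksP[sS cS]; rewrite -(intD_select (selects_mask sS cS)).
by rewrite big_const_seq count_predT iter_addr_0 mulr_natl.
Qed.

Definition hoeffding_sum N (Y : Omega -> R) : Prop :=
  exists2 F : nat -> seq A -> R,
    (forall l, (l <= N)%N -> degenerate_kernel l (F l)) &
    {ae P, forall w, Y w = \sum_(l < N.+1) intD l (F l) w}.

Lemma degenerate_kernel_lin n F G (a : R) : degenerate_kernel n F -> degenerate_kernel n G ->
  degenerate_kernel n (fun s => a * F s + G s).
Proof.
move=> [mF sF iF dF] [mG sG iG dG]; split.
- move=> k; apply: measurable_funD; last exact: mG.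
  by apply: measurable_funM; [exact: measurable_cst|exact: mF].
- by move=> s s' sn ss'; rewrite (sF _ _ sn ss') (sG _ _ sn ss').
- exact: sq_integrable_lin.
case: n iF iG dF dG {sF sG} => [//|n] iF iG dF dG U mU.
have mU1 : measurable_fun setT (fun t : n.+1.-tuple A => \1_U (totuple n (behead t)) : R).
  apply: measurableT_comp; first exact: measurable_indic.
  by apply: measurable_totuple => i; under eq_fun do rewrite nth_behead; exact: measurable_nth_tuple.
have i1 H : seq_measurable H -> sq_integrable (law n.+1) (seqf H (n:=n.+1)) ->
    (law n.+1).-integrable setT (EFin \o (fun t : n.+1.-tuple A => H t * \1_U (totuple n (behead t)))).
  move=> mH iH; apply: (sq_integrable_mul iH); apply: (@sq_integrable_bounded _ _ _ _ _ 1) => //.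
  by move=> t; rewrite indicE; case: (_ \in _); rewrite /= ?normr1 ?normr0.
under eq_Rintegral do rewrite mulrDl -mulrA.
rewrite RintegralD//; last exact: i1.
  by rewrite RintegralZl//; [rewrite (dF U mU) (dG U mU) mulr0 addr0|exact: i1].
by have := integrableZl measurableT a (i1 F mF iF); congr (integrable _ _ _).
Qed.

Lemma degenerate_kernel0 n : degenerate_kernel n (fun=> 0).
Proof.
split.
- by move=> k; exact: measurable_cst.
- by [].
- exact: sq_integrable_cst.
- by case: n => // n U mU; under eq_Rintegral do rewrite mul0r; rewrite /Rintegral integral0.
Qed.

Lemma degenerate_law_integrable n F : degenerate_kernel n F ->
  (law n).-integrable setT (EFin \o seqf F (n:=n)).
Proof. by move=> [_ _ iF _]; exact: sq_integrable_integrable iF. Qed.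

Lemma ae_forall_ord d0 (T : measurableType d0) (mu : {measure set T -> \bar R}) N
    (Q : nat -> T -> Prop) : (forall l, (l < N)%N -> {ae mu, forall x, Q l x}) ->
  {ae mu, forall x, forall l : 'I_N, Q l x}.
Proof.
move=> h; have : {ae mu, forall x, forall l, (l < N)%N -> Q l x}.
  apply: ae_foralln => l; have [lN|lN] := ltnP l N; first by apply: filterS (h l lN).
  by apply: aeW => x.
by apply: filterS => x hx l; exact: hx.
Qed.

Lemma hoeffding_sum_lin N Y Z (a : R) : hoeffding_sum N Y -> hoeffding_sum N Z ->
  hoeffding_sum N (fun w => a * Y w + Z w).
Proof.
move=> [F hF YF] [G hG ZG]; exists (fun l s => a * F l s + G l s).
  by move=> l lN; apply: degenerate_kernel_lin; [exact: hF|exact: hG].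
have : {ae P, forall w, forall l : 'I_N.+1, intD l (fun s => a * F l s + G l s) w =
    a * intD l (F l) w + intD l (G l) w}.
  apply: (ae_forall_ord (Q := fun l w => intD l (fun s => a * F l s + G l s) w =
    a * intD l (F l) w + intD l (G l) w)) => l lN.
  by apply: intD_lin; apply: degenerate_law_integrable; [exact: hF|exact: hG].
apply: filterS3 YF ZG => w -> -> h.
by rewrite (eq_bigr _ (fun l _ => h l)) big_split /= -mulr_sumr.
Qed.

Lemma hoeffding_sum_degenerate N n F : (n <= N)%N -> degenerate_kernel n F ->
  hoeffding_sum N (intD n F).
Proof.
move=> nN hF; exists (fun l => if l == n then F else fun=> 0).
  by move=> l _; case: eqP => [->|_]; [exact: hF|exact: degenerate_kernel0].
apply: aeW => w; have nN' : (n < N.+1)%N by [].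
rewrite (bigD1 (Ordinal nN'))//= eqxx big1 ?addr0// => l ln.
have -> : (l == n :> nat) = false by apply/negbTE; move: ln; apply: contra => /eqP ln; exact/eqP/val_inj.
by rewrite /intD /Rintegral integral0.
Qed.

Lemma hoeffding_sum_mono M N Y : (M <= N)%N -> hoeffding_sum M Y -> hoeffding_sum N Y.
Proof.
move=> MN [F hF YF]; exists (fun l => if (l <= M)%N then F l else fun=> 0).
  by move=> l _; case: ifP => lM; [exact: hF|exact: degenerate_kernel0].
apply: filterS YF => w ->.
rewrite (big_ord_widen N.+1 (fun l => intD l (F l) w)) ?ltnS// big_mkcond /=.
apply: eq_bigr => l _; rewrite ltnS; case: ifP => // _.
by rewrite /intD /Rintegral integral0.
Qed.

(* The recursion makes sum_k cc k * subsum k (h k) degenerate: by step_subsum the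
   urn step sends consecutive terms to multiples of the same sum. *)
Lemma hoeffding_coefficients M : exists2 cc : nat -> R, cc M.+1 = 1 &
  forall k, (k <= M)%N -> cc k * (c + M%:R + k%:R) + cc k.+1 * (c + k%:R) = 0.
Proof.
(* The value [cf j] is the coefficient with index [M.+1 - j]: the recurrence is solved downwards
   from the top, dividing by the positive number [c + M + k]. *)
pose fix cf j : R := if j is j'.+1 then
  - cf j' * (c + (M - j')%:R) / (c + M%:R + (M - j')%:R) else 1.
exists (fun k => cf (M.+1 - k)%N); first by rewrite subnn.
move=> k kM; rewrite subSn// subSS /= subKn// mulfVK; last first.
  by rewrite gt_eqF// ltr_wpDr// mass_addn_gt0.
by rewrite mulNr addNr.
Qed.

Lemma hoeffding_bounded M F : bounded_kernel F -> seq_symmetric M F ->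
  hoeffding_sum M (intD M F).
Proof.
elim/ltn_ind: M F => -[|M] IH F bF symF.
  apply: hoeffding_sum_degenerate => //; have [mF [K FK]] := bF; split => //.
  by apply: (@sq_integrable_bounded _ _ _ _ _ K); [exact: mF|move=> t; exact: FK].
have [cc ccM ccE] := hoeffding_coefficients M.
pose h k := iter (M.+1 - k) stepE F.
have hS k : (k <= M)%N -> h k = stepE (h k.+1) by move=> kM; rewrite /h subSn// subSS.
have hM : h M.+1 = F by rewrite /h subnn.
have hb : forall k, bounded_kernel (h k) by move=> k; rewrite /h; elim: (M.+1 - k)%N => //= j; exact: bounded_step.
have hs k : (k <= M.+1)%N -> seq_symmetric k (h k).
  have H j : (j <= M.+1)%N -> seq_symmetric (M.+1 - j) (iter j stepE F).
    elim: j => [_|j IHj jM]; first by rewrite subn0.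
    apply: step_symmetric; last by rewrite -subSn// subSS; apply: IHj; exact: ltnW.
    by elim: j {IHj jM} => //= j; exact: bounded_step.
  by move=> kM; have := H _ (leq_subr k M.+1); rewrite subKn.
pose H s := \sum_(k < M.+2) cc k * subsum k (h k) s.
have mH : seq_measurable H.
  move=> n; apply: measurable_sum => k; apply: measurable_funM; first exact: measurable_cst.
  by apply: seq_measurable_subsum; have [] := hb k.
have iS n k : sq_integrable (law n) (seqf (subsum k (h k)) (n:=n)).
  rewrite (_ : seqf _ = (fun t => \sum_(S <- masks n k) h k (mask S t))); last first.
    by apply/funext => t; rewrite /seqf /subsum size_tuple.
  elim: (masks n k) => [|S s [IHm IHi]].
    by rewrite (_ : (fun _ => _) = cst 0); [exact: sq_integrable_cst|apply/funext => t; rewrite big_nil].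
  rewrite (_ : (fun _ => _) = (fun t : n.-tuple A => 1 * h k (mask S t) + \sum_(S <- s) h k (mask S t))); last first.
    by apply/funext => t; rewrite big_cons mul1r.
  apply: sq_integrable_lin => //; have [mb [K hK]] := bounded_mask S (hb k).
  by apply: (@sq_integrable_bounded _ _ _ _ _ K); [exact: mb|move=> t; exact: hK].
have iH : sq_integrable (law M.+1) (seqf H (n:=M.+1)).
  rewrite /seqf /H; elim: M.+2 => [|n IHn].
    by rewrite (_ : (fun _ => _) = cst 0); [exact: sq_integrable_cst|apply/funext => t; rewrite big_ord0].
  rewrite (_ : (fun _ => _) = (fun t : M.+1.-tuple A => cc n * subsum n (h n) t +
    \sum_(k < n) cc k * subsum k (h k) t)); last first.
    by apply/funext => t; rewrite big_ord_recr addrC.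
  by apply: sq_integrable_lin => //; exact: iS.
(* After [step_subsum], the sum over [k] entries receives [cc k * (c + M + k)] from its own term and
   [cc k.+1 * (c + k)] from the next one; the coefficients are chosen so that these cancel. *)
have stepH (x : M.-tuple A) : stepE H x = 0.
  have ik k : (pstep alpha_gt0 x).-integrable setT
      (EFin \o (fun a => cc k * subsum k (h k) (a :: x))).
    have [|i1 _] := @Rintegral_sum _ _ (pstep alpha_gt0 x) _ (masks (size x).+1 k)
      (fun S a => h k (mask S (a :: x))).
      by move=> S _; exact: (bounded_pstep x x (bounded_mask S (hb k))).
    by have := integrableZl measurableT (cc k) i1; congr (integrable _ _ _).
  have E : stepE H x = \sum_(k < M.+2) cc k * stepE (subsum k (h k)) x.
    rewrite /stepE /H; have [|_ ->] := @Rintegral_sum _ _ (pstep alpha_gt0 x) _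
      (index_enum 'I_M.+2) (fun k a => cc k * subsum k (h k) (a :: x)); first by move=> k _; exact: ik.
    apply: eq_bigr => k _; have [|i1 _] := @Rintegral_sum _ _ (pstep alpha_gt0 x) _
      (masks (size x).+1 k) (fun S a => h k (mask S (a :: x))).
      by move=> S _; exact: (bounded_pstep x x (bounded_mask S (hb k))).
    by rewrite RintegralZl.
  have c0 : c + M%:R != 0 by rewrite gt_eqF// mass_addn_gt0.
  apply: (mulfI c0); rewrite mulr0 E mulr_sumr big_ord_recl /=.
  have -> : stepE (subsum 0 (h 0%N)) x = subsum 0 (h 0%N) x.
    rewrite /stepE; under eq_Rintegral do rewrite subsum0.
    by rewrite (Rintegral_cst_prob (pstep alpha_gt0 x)) subsum0.
  rewrite (eq_bigr (fun k : 'I_M.+1 => cc k.+1 * (c + M%:R + k.+1%:R) * subsum k.+1 (h k.+1) x +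
      cc k.+1 * (c + k%:R) * subsum k (h k) x)); last first.
    move=> k _; rewrite /bump /= add1n mulrCA.
    have := step_subsum x (hb k.+1) (hs _ (ltn_ord k)); rewrite size_tuple -hS; last by rewrite -ltnS.
    by move=> ->; rewrite mulrDr !mulrA.
  rewrite big_split /= addrA.
  (* The two ends fit: the urn step fixes the constant term, and the term of index [M + 1] vanishes
     since [x] has only [M] entries. *)
  have -> : (c + M%:R) * (cc 0%N * subsum 0 (h 0%N) x) +
      \sum_(k < M.+1) cc k.+1 * (c + M%:R + k.+1%:R) * subsum k.+1 (h k.+1) x =
      \sum_(k < M.+1) cc k * (c + M%:R + k%:R) * subsum k (h k) x.
    rewrite [in LHS]big_ord_recr /= (@subsum_gt _ _ M.+1) ?size_tuple// mulr0 addr0.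
    by rewrite [in RHS]big_ord_recl /= addr0; congr (_ + _); rewrite mulrCA mulrA.
  rewrite -big_split big1// => k _ /=; rewrite -mulrDl ccE ?mul0r//.
  by rewrite -ltnS.
have dH : degenerate_kernel M.+1 H.
  split => //.
    move=> s s' sM ss'; apply: eq_bigr => k _; congr (_ * _); apply: subsum_perm => //.
    by apply: hs; rewrite -ltnS.
  apply/(degenerateP mH (sq_integrable_integrable iH)).
  by apply: aeW => t; exact: stepH.
(* Every choice of [k] coordinates has the same integral under [D^(M+1)], so a sum over subsets
   becomes their number times one integral. As the top coefficient is 1, the integral of [F] can be
   solved for. *)
pose a k : R := - (cc k * (size (masks M.+1 k))%:R).
have E w : intD M.+1 F w = intD M.+1 H w + \sum_(k < M.+1) a k * intD k (h k) w.
  have -> : intD M.+1 H w = \sum_(k < M.+2) cc k * (size (masks M.+1 k))%:R * intD k (h k) w.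
    have i1 k : (Dpow M.+1 w).-integrable setT (EFin \o (fun t : M.+1.-tuple A => subsum k (h k) t)).
      have [|i1 _] := @Rintegral_sum _ _ (Dpow M.+1 w) _ (masks M.+1 k)
        (fun S (t : M.+1.-tuple A) => h k (mask S t)).
        move=> S _; have [mb [K hK]] := bounded_mask S (hb k).
        by apply: (@bounded_integrable _ _ (Dpow M.+1 w) _ K); [exact: mb|move=> t; exact: hK].
      by move: i1; congr (integrable _ _ _); apply/funext => t /=; rewrite /subsum size_tuple.
    rewrite {1}/intD /H; have [|_ ->] := @Rintegral_sum _ _ (Dpow M.+1 w) _
      (index_enum 'I_M.+2) (fun k (t : M.+1.-tuple A) => cc k * subsum k (h k) t).
      by move=> k _; have := integrableZl measurableT (cc k) (i1 k); congr (integrable _ _ _).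
    apply: eq_bigr => k _; rewrite RintegralZl//.
    by rewrite -[X in _ * X]/(intD M.+1 (subsum k (h k)) w) intD_subsum// mulrA.
  rewrite big_ord_recr ccM masks_full hM mul1r mulr1n mul1r addrAC -big_split big1 ?add0r// => k _.
  by rewrite /a /= -mulrDl addrN mul0r.
have HS n : (n <= M.+1)%N -> hoeffding_sum M.+1
    (fun w => intD M.+1 H w + \sum_(k < n) a k * intD k (h k) w).
  elim: n => [_|n IHn nM].
    under eq_fun do rewrite big_ord0 addr0; exact: hoeffding_sum_degenerate.
  rewrite (_ : (fun _ => _) = (fun w => a n * intD n (h n) w +
    (intD M.+1 H w + \sum_(k < n) a k * intD k (h k) w))); last first.
    by apply/funext => w; rewrite big_ord_recr /= addrA addrC.
  apply: hoeffding_sum_lin; last exact/IHn/ltnW.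
  apply: (hoeffding_sum_mono (ltnW nM)); apply: IH => //.
  by apply: hs; exact: ltnW.
have -> : intD M.+1 F = (fun w => intD M.+1 H w + \sum_(k < M.+1) a k * intD k (h k) w).
  by apply/funext => w; exact: E.
exact: HS.
Qed.

Lemma masks_fullE n (F : seq A -> R) (t : n.-tuple A) :
  F (mask (nseq n true) t) = F t.
Proof. by rewrite mask_true// size_tuple. Qed.

Lemma degenerate_orthogonal n m F G : n != m -> degenerate_kernel n F -> degenerate_kernel m G ->
  \int[P]_w (intD n F w * intD m G w) = 0.
Proof.
wlog nm : n m F G / (m < n)%N => [H nm hF hG|_ hF hG].
  have [nm'|mn|E] := ltngtP n m; last by rewrite E eqxx in nm.
    by under eq_Rintegral do rewrite mulrC; apply: H => //; rewrite eq_sym.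
  exact: H.
have [mG _ iG _] := hG.
have := expectation_intD_mul mG iG hF; rewrite masks_gt// big_nil mulr0 => /eqP.
rewrite mulf_eq0 => /orP[|/eqP //].
rewrite prodf_seq_eq0 => /hasP[q _ /=]; rewrite gt_eqF//; exact: mass_addn_gt0.
Qed.

(** * Control of the kernels by the random integrals, and closedness *)

Lemma sqnE d0 (T : measurableType d0) (mu : probability T R) f : sq_integrable mu f ->
  sqn mu f = (\int[mu]_x (f x ^+ 2))%:E.
Proof.
move=> fi; rewrite /Rintegral fineK//; apply: integrable_fin_num => //.
by have := sq_integrable_mul fi fi; congr (integrable _ _ _).
Qed.

Lemma sqn_degenerate n F : degenerate_kernel n F ->
  ((\prod_(q < n) (c + (q + n)%:R))%:E * sqn P (intD n F) =
   (n`!%:R)%:E * sqn (law n) (seqf F (n:=n)))%E.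
Proof.
move=> hF; have [mF _ iF _] := hF.
rewrite !sqnE//; last exact: sq_integrable_intD.
have := expectation_intD_mul mF iF hF; rewrite masks_full big_seq1 => H.
rewrite -!EFinM; congr EFin; under eq_Rintegral do rewrite expr2; rewrite H.
by congr (_ * _); apply: eq_Rintegral => t _; rewrite masks_fullE.
Qed.

Definition intD_sum N (F : nat -> seq A -> R) w : R := \sum_(l < N) intD l (F l) w.

Lemma sq_integrable_intD_sum N F : (forall l, (l < N)%N -> degenerate_kernel l (F l)) ->
  sq_integrable P (intD_sum N F).
Proof.
rewrite /intD_sum; elim: N => [|N IH] hF.
  by rewrite (_ : (fun _ => _) = cst 0); [exact: sq_integrable_cst|apply/funext => w; rewrite big_ord0].
rewrite (_ : (fun _ => _) = (fun w => 1 * \sum_(l < N) intD l (F l) w + intD N (F N) w)); last first.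
  by apply/funext => w; rewrite big_ord_recr /= mul1r.
apply: sq_integrable_lin; first by apply: IH => l lN; apply: hF; exact: ltnW.
by have [mF _ iF _] := hF N (leqnn _); exact: sq_integrable_intD.
Qed.

Lemma pythagoras N F : (forall l, (l < N)%N -> degenerate_kernel l (F l)) ->
  \int[P]_w (intD_sum N F w ^+ 2) = \sum_(l < N) \int[P]_w (intD l (F l) w ^+ 2).
Proof.
elim: N => [|N IH] hF.
  rewrite big_ord0 /intD_sum; under eq_Rintegral do rewrite big_ord0 expr0n.
  by rewrite /Rintegral integral0.
have hF' l : (l < N)%N -> degenerate_kernel l (F l) by move=> lN; apply: hF; exact: ltnW.
have [mN _ iN _] := hF N (leqnn _).
have sN := sq_integrable_intD mN iN; have sS := sq_integrable_intD_sum hF'.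
have E w : intD_sum N.+1 F w ^+ 2 =
    intD_sum N F w ^+ 2 + (2 * (intD_sum N F w * intD N (F N) w) + intD N (F N) w ^+ 2).
  by rewrite /intD_sum big_ord_recr /=; ring.
under eq_Rintegral do rewrite E.
have i1 : P.-integrable setT (EFin \o (fun w => intD_sum N F w ^+ 2)).
  by have := sq_integrable_mul sS sS; congr (integrable _ _ _).
have i2 : P.-integrable setT (EFin \o (fun w => intD N (F N) w ^+ 2)).
  by have := sq_integrable_mul sN sN; congr (integrable _ _ _).
have i3 : P.-integrable setT (EFin \o (fun w => intD_sum N F w * intD N (F N) w)).
  by have := sq_integrable_mul sS sN; congr (integrable _ _ _).
have i4 : P.-integrable setT (EFin \o (fun w => 2 * (intD_sum N F w * intD N (F N) w))).
  by have := integrableZl measurableT 2 i3; congr (integrable _ _ _).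
have i5 : P.-integrable setT (EFin \o (fun w => 2 * (intD_sum N F w * intD N (F N) w) + intD N (F N) w ^+ 2)).
  by have := integrableD measurableT i4 i2; congr (integrable _ _ _).
rewrite RintegralD// RintegralD// RintegralZl// IH// big_ord_recr /=.
suff -> : \int[P]_w (intD_sum N F w * intD N (F N) w) = 0 by rewrite mulr0 add0r.
rewrite /intD_sum; under eq_Rintegral do rewrite mulr_suml.
have [|_ ->] := @Rintegral_sum _ _ P _ (index_enum 'I_N) (fun l w => intD l (F l) w * intD N (F N) w).
  move=> l _; have [ml _ il _] := hF' l (ltn_ord l).
  by have := sq_integrable_mul (sq_integrable_intD ml il) sN; congr (integrable _ _ _).
apply: big1 => l _; apply: degenerate_orthogonal; rewrite ?ltn_eqF//; first exact: hF'.
exact: hF.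
Qed.

Lemma sqn_intD_sum_ge N F l : (l < N)%N -> (forall l, (l < N)%N -> degenerate_kernel l (F l)) ->
  (sqn P (intD l (F l)) <= sqn P (intD_sum N F))%E.
Proof.
move=> lN hF; have [ml _ il _] := hF l lN.
rewrite !sqnE//; [|exact: sq_integrable_intD_sum|exact: sq_integrable_intD].
rewrite lee_fin pythagoras// (bigD1 (Ordinal lN))//= lerDl sumr_ge0// => i _.
by apply: Rintegral_ge0 => w _; exact: sqr_ge0.
Qed.

(** A converse to the contraction [sqn_intD]: the norm of each kernel is bounded by that of the
    whole sum, by orthogonality and the key identity with [n = m]; the factorial there is at least 1
    and is dropped. *)
Lemma sqn_degenerate_le N F l : (l < N)%N -> (forall l, (l < N)%N -> degenerate_kernel l (F l)) ->
  (sqn (law l) (seqf (F l) (n:=l)) <=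
   (\prod_(q < l) (c + (q + l)%:R))%:E * sqn P (intD_sum N F))%E.
Proof.
move=> lN hF; have := sqn_degenerate (hF l lN) => E.
apply: (@le_trans _ _ ((\prod_(q < l) (c + (q + l)%:R))%:E * sqn P (intD l (F l)))%E); last first.
  apply: lee_wpmul2l; last exact: sqn_intD_sum_ge.
  by rewrite lee_fin; apply: prodr_ge0 => q _; rewrite ltW// mass_addn_gt0.
rewrite E -[leLHS]mul1e; apply: lee_wpmul2r; first exact: sqn_ge0.
by rewrite lee_fin ler1n fact_gt0.
Qed.

Lemma totuple_id n (s : seq A) : size s = n -> totuple n s = s :> seq A.
Proof.
move=> /eqP sn; have := congr1 (@tval _ _) (totupleK (Tuple sn)); exact.
Qed.

Lemma degenerate_kernel_totuple n F : degenerate_kernel n F ->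
  degenerate_kernel n (fun s => F (totuple n s)).
Proof.
move=> [mF sF iF dF]; split.
- move=> k; apply: (measurableT_comp (mF n)); apply: measurable_totuple => i.
  exact: measurable_nth_tuple.
- move=> s s' sn ss'; apply: sF; first by rewrite size_tuple.
  by rewrite !totuple_id// -(perm_size ss').
- move: iF; congr (sq_integrable _ _); apply/funext => t.
  by rewrite /seqf totupleK.
case: n dF {sF iF} => // n dF U mU; rewrite -[RHS](dF U mU).
by apply: eq_Rintegral => t _; rewrite totupleK.
Qed.

(** Symmetry passes to the limit at every point because the limit depends on [x] only through the
    values of the kernels there; degeneracy passes because it consists of integrals against bounded
    functions. *)
Lemma degenerate_kernel_limit n (F : nat -> seq A -> R) :
  (forall k, degenerate_kernel n (F k)) ->
  (forall e : R, 0 < e -> exists K, forall i j, (K <= i)%N -> (K <= j)%N ->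
     (sqn (law n) (seqf (fun s => ((-1) * F j s + F i s)%R) (n:=n)) <= e%:E)%E) ->
  exists2 G, degenerate_kernel n G &
    sq_cvg (law n) (fun k => seqf (F k) (n:=n)) (seqf G (n:=n)).
Proof.
move=> hF cauchy.
have [||g [ig Fg gE]] := @sq_cauchy_cvg _ _ _ (law n) (fun k => seqf (F k) (n:=n)).
- by move=> k; case: (hF k).
- move=> e /cauchy[K hK]; exists K => i j Ki Kj; have := hK i j Ki Kj.
  by congr (sqn _ _ <= _)%E; apply/funext => t; rewrite /seqf mulN1r addrC.
have gK : seqf (fun s => g (totuple n s)) (n:=n) = g.
  by apply/funext => t; rewrite /seqf totupleK.
exists (fun s => g (totuple n s)); last by rewrite gK.
have mG : seq_measurable (fun s => g (totuple n s)).
  move=> k; apply: measurableT_comp; first by case: ig.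
  by apply: measurable_totuple => i; exact: measurable_nth_tuple.
split => //.
- move=> s s' sn ss'; apply: gE => k; have [_ sF _ _] := degenerate_kernel_totuple (hF k).
  exact: sF.
- by rewrite gK.
case: n F hF cauchy g ig Fg gE gK mG => // n F hF _ g ig Fg _ gK mG U mU.
under eq_Rintegral do rewrite totupleK.
set b := fun t : n.+1.-tuple A => \1_U (totuple n (behead t)) : R.
have mb : measurable_fun setT b.
  apply: measurableT_comp; first exact: measurable_indic.
  by apply: measurable_totuple => i; under eq_fun do rewrite nth_behead; exact: measurable_nth_tuple.
have b1 t : `|b t| <= 1 by rewrite /b indicE; case: (_ \in _); rewrite /= ?normr1 ?normr0.
have ib := sq_integrable_bounded (law n.+1) mb b1.
(* As [F k] integrates to 0 against [b], the integral of [g] against [b] is, up to sign, that of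
   [F k - g], and [b] is bounded by 1. *)
have h k : (\int[law n.+1]_t (g t * b t)) ^+ 2 <=
    fine (sqn (law n.+1) (seqf (F k) (n:=n.+1) \- g)).
  have [mF _ iF dF] := hF k.
  have iD : sq_integrable (law n.+1) (fun t => (-1) * g t + seqf (F k) (n:=n.+1) t).
    exact: sq_integrable_lin.
  have E : \int[law n.+1]_t (((-1) * g t + seqf (F k) (n:=n.+1) t) * b t) =
      - \int[law n.+1]_t (g t * b t).
    under eq_Rintegral do rewrite mulrDl -mulrA.
    rewrite RintegralD//; [|by have := integrableZl measurableT (-1) (sq_integrable_mul ig ib); congr (integrable _ _ _)|exact: (sq_integrable_mul iF ib)].
    rewrite RintegralZl//; last exact: (sq_integrable_mul ig ib).
    by rewrite (dF U mU) addr0 mulN1r.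
  have mDb : measurable_fun setT (fun t => ((-1) * g t + seqf (F k) (n:=n.+1) t) * b t).
    by apply: measurable_funM => //; case: iD.
  have iDb : sq_integrable (law n.+1) (fun t => ((-1) * g t + seqf (F k) (n:=n.+1) t) * b t).
    split => //; apply: le_lt_trans (iD.2); apply: sqn_le_ae => //; first by case: iD.
    by apply: aeW => t; rewrite normrM ler_piMr.
  have iDb2 := sq_integrable_mul iDb iDb.
  rewrite -sqrrN -E; apply: (le_trans (Rintegral_sqr_le (sq_integrable_mul iD ib) _)).
    by move: iDb2; congr (integrable _ _ _).
  rewrite (_ : _ \- _ = (fun t => (-1) * g t + seqf (F k) (n:=n.+1) t)); last first.
    by apply/funext => t; rewrite /= mulN1r addrC.
  rewrite sqnE//=; apply: le_Rintegral => //.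
    by have := sq_integrable_mul iD iD; congr (integrable _ _ _).
  move=> t _; rewrite exprMn ler_piMr ?sqr_ge0//.
  by rewrite -(ger0_norm (sqr_ge0 _)) normrX exprn_ile1.
apply/eqP; rewrite -sqrf_eq0 eq_le sqr_ge0 andbT.
apply/ler_addgt0Pr => e e0; rewrite add0r.
have [K _ /(_ K (leqnn K)) hK] := Fg e e0.
apply: (le_trans (h K)); rewrite -lee_fin fineK//.
by rewrite ge0_fin_numE ?sqn_ge0//; apply: le_lt_trans hK _; rewrite ltey.
Qed.

Lemma sq_cvg_intD n (F : nat -> seq A -> R) G : (forall k, degenerate_kernel n (F k)) ->
  degenerate_kernel n G -> sq_cvg (law n) (fun k => seqf (F k) (n:=n)) (seqf G (n:=n)) ->
  sq_cvg P (fun k => intD n (F k)) (intD n G).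
Proof.
move=> hF hG FG e e0; apply: filterS (FG e e0) => k; apply: le_trans.
have hD := degenerate_kernel_lin (-1) hG (hF k); have [mD _ iD _] := hD.
have [mG _ _ _] := hG; have [mF _ _ _] := hF k.
have := sqn_intD mD iD.
rewrite (_ : seqf _ = (fun t : n.-tuple A => F k t) \- (fun t => G t)); last first.
  by apply/funext => t; rewrite /seqf /= mulN1r addrC.
apply: le_trans; rewrite le_eqVlt; apply/orP; left; apply/eqP.
apply: eq_sqn_ae.
- by apply: measurable_funB; exact: measurable_intD.
- exact: measurable_intD.
have := intD_lin (-1) (degenerate_law_integrable hG) (degenerate_law_integrable (hF k)).
by apply: filterS => w ->; rewrite mulN1r addrC.
Qed.

Lemma measurable_intD_sum N F : (forall l, (l < N)%N -> degenerate_kernel l (F l)) ->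
  measurable_fun setT (intD_sum N F).
Proof. by move=> /sq_integrable_intD_sum[]. Qed.

(** By [sqn_degenerate_le] the kernels of each degree form a Cauchy sequence. Their limits are
    degenerate kernels, and the contraction brings the convergence back to the random integrals. *)
Lemma hoeffding_sum_closed N (Yk : nat -> Omega -> R) Y :
  (forall k, hoeffding_sum N (Yk k)) -> (forall k, measurable_fun setT (Yk k)) ->
  measurable_fun setT Y -> sq_cvg P Yk Y -> hoeffding_sum N Y.
Proof.
move=> hY mYk mY YkY.
have /choice[F hF] : forall k, exists F : nat -> seq A -> R,
    (forall l, (l <= N)%N -> degenerate_kernel l (F l)) /\
    {ae P, forall w, Yk k w = intD_sum N.+1 F w}.
  by move=> k; have [F hF YF] := hY k; exists F.
have hFk k l : (l < N.+1)%N -> degenerate_kernel l (F k l) by move=> lN; apply: (hF k).1.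
have H l : (l <= N)%N -> exists G, degenerate_kernel l G /\
    sq_cvg (law l) (fun k => seqf (F k l) (n:=l)) (seqf G (n:=l)).
  move=> lN; have [|e e0|G hG FG] := @degenerate_kernel_limit l (fun k => F k l).
  - by move=> k; exact: hFk.
  - set kap := \prod_(q < l) (c + (q + l)%:R).
    have kap0 : 0 < kap by apply: prodr_gt0 => q _; exact: mass_addn_gt0.
    (* Two triangle terms with factor 2, multiplied by [kap], then add up to [e]. *)
    have e1 : 0 < e / kap / 4 by rewrite !divr_gt0.
    have [K _ hK] := YkY _ e1; exists K => i j Ki Kj.
    have hD l0 : (l0 < N.+1)%N -> degenerate_kernel l0 (fun s => -1 * F j l0 s + F i l0 s).
      by move=> l0N; apply: degenerate_kernel_lin; exact: hFk.
    apply: (le_trans (@sqn_degenerate_le N.+1 (fun l s => (-1) * F j l s + F i l s) l lN hD)).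
    rewrite (@eq_sqn_ae _ _ _ _ _ (Yk i \- Yk j)); last 3 first.
    + exact: measurable_intD_sum.
    + exact: measurable_funB.
    + have hae : {ae P, forall w, forall l : 'I_N.+1, intD l (fun s => (-1) * F j l s + F i l s) w =
          (-1) * intD l (F j l) w + intD l (F i l) w}.
        apply: (ae_forall_ord (Q := fun l w => intD l (fun s => (-1) * F j l s + F i l s) w =
          (-1) * intD l (F j l) w + intD l (F i l) w)) => l0 l0N.
        by apply: intD_lin; apply: degenerate_law_integrable; exact: hFk.
      apply: filterS3 (hF i).2 (hF j).2 hae => w /= -> -> h.
      rewrite /intD_sum (eq_bigr _ (fun l _ => h l)) big_split /= -mulr_sumr mulN1r addrC//.
    apply: (@le_trans _ _ (kap%:E * (2%:E * (e / kap / 4)%:E + 2%:E * (e / kap / 4)%:E))%E).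
      apply: lee_wpmul2l; first by rewrite lee_fin ltW.
      apply: (le_trans (sqn_triangle P (mYk i) mY (mYk j))).
      by apply: leeD; apply: lee_wpmul2l => //; [|rewrite sqnB]; exact: hK.
    rewrite -EFinM lee_fin le_eqVlt; apply/orP; left; apply/eqP.
    by field; rewrite gt_eqF.
  by exists G.
have /choice[G hG] : forall l, exists G, (l <= N)%N -> degenerate_kernel l G /\
    sq_cvg (law l) (fun k => seqf (F k l) (n:=l)) (seqf G (n:=l)).
  move=> l; have [lN|lN] := leqP l N; first by have [G hG] := H l lN; exists G.
  by exists (fun=> 0).
exists G; first by move=> l lN; case: (hG l lN).
have hG1 l : (l < N.+1)%N -> degenerate_kernel l (G l) by move=> lN; case: (hG l lN).
have FG : sq_cvg P (fun k => intD_sum N.+1 (F k)) (intD_sum N.+1 G).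
  have : (N.+1 <= N.+1)%N by [].
  move: {-2}N.+1 => M; elim: M => [_|M IH MN].
    rewrite (_ : (fun _ => _) = (fun=> intD_sum 0 G)); first exact: sq_cvg_cst.
    by apply/funext => k; apply/funext => w; rewrite /intD_sum !big_ord0.
  rewrite (_ : (fun _ => _) = (fun k w => 1 * intD_sum M (F k) w + intD M (F k M) w)); last first.
    by apply/funext => k; apply/funext => w; rewrite /intD_sum big_ord_recr /= mul1r.
  rewrite (_ : intD_sum M.+1 G = (fun w => 1 * intD_sum M G w + intD M (G M) w)); last first.
    by apply/funext => w; rewrite /intD_sum big_ord_recr /= mul1r.
  have lt l : (l < M)%N -> (l < N.+1)%N by move=> lM; apply: ltn_trans MN.
  apply: sq_cvg_lin.
  - by move=> k; apply: measurable_intD_sum => l lM; apply: hFk; exact: lt.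
  - by apply: measurable_intD_sum => l lM; apply: hG1; exact: lt.
  - by move=> k; apply: measurable_intD; case: (hFk k _ MN).
  - by apply: measurable_intD; case: (hG1 _ MN).
  - by apply: IH; exact: ltnW.
  apply: (@sq_cvg_intD M (fun k => F k M)); [by move=> k; exact: hFk|exact: hG1|].
  by case: (hG M MN).
have YkG : sq_cvg P Yk (intD_sum N.+1 G).
  move=> e e0; apply: filterS (FG e e0) => k; apply: le_trans.
  rewrite le_eqVlt; apply/orP; left; apply/eqP; apply: eq_sqn_ae.
  - by apply: measurable_funB => //; exact: measurable_intD_sum.
  - by apply: measurable_funB; apply: measurable_intD_sum => // l lN; exact: hFk.
  by apply: filterS (hF k).2 => w /= ->.
exact: (sq_cvg_unique mYk mY (measurable_intD_sum hG1) YkY YkG).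
Qed.

(** * Closed subspaces generated by monomials *)

Implicit Types V S : set (Omega -> R).

Lemma L2_sq_integrable Y : L2 P D Y -> sq_integrable P Y.
Proof. by move=> [_ /Lfun2P]. Qed.

Lemma L2_measurable Y : L2 P D Y -> measurable_fun setT Y.
Proof. by move=> /L2_sq_integrable[]. Qed.

Lemma L2_lin Y Z (a : R) : L2 P D Y -> L2 P D Z -> L2 P D (fun w => a * Y w + Z w).
Proof.
move=> hY hZ; split; last first.
  by apply/Lfun2P; apply: sq_integrable_lin; exact: L2_sq_integrable.
have /measurable_wrtP mY := hY.1; have /measurable_wrtP mZ := hZ.1.
apply/measurable_wrtP; apply: measurable_funD => //.
by apply: measurable_funM => //; exact: measurable_cst.
Qed.

(** A constant sequence converges in mean square to anything almost surely equal to it, so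
    closedness already contains saturation. *)
Lemma closed_subspace_ae V Y Z : closed_subspace P D V -> V Y -> L2 P D Z ->
  {ae P, forall w, Y w = Z w} -> V Z.
Proof.
move=> [VL _ _ Vc] VY LZ YZ; apply: (Vc (fun=> Y)) => //.
apply/L2_cvgP; apply: sq_cvg_ae_eq => //; first exact/L2_measurable/VL.
exact: L2_measurable.
Qed.

Lemma closed_subspace_span S : closed_subspace P D (L2 P D) -> S `<=` L2 P D ->
  closed_subspace P D (closed_span P D S).
Proof.
move=> hL SL; split.
- by apply: smallest_sub.
- by move=> V [[_ V0 _ _] _].
- by move=> a Y Z hY hZ V [cV SV]; have [_ _ Vl _] := cV; apply: Vl; [exact: hY|exact: hZ].
- by move=> F Y hF LY FY V [cV SV]; have [_ _ _ Vc] := cV; apply: (Vc F) => // k; exact: hF.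
Qed.

Definition hoeffding_space N : set (Omega -> R) :=
  [set Y | L2 P D Y /\ hoeffding_sum N Y].

Lemma L2_cst (k : R) : L2 P D (cst k).
Proof.
split; last by apply/Lfun2P; exact: sq_integrable_cst.
by apply/measurable_wrtP; exact: measurable_cst.
Qed.

Lemma hoeffding_space_closed N : closed_subspace P D (hoeffding_space N).
Proof.
split.
- by move=> Y [].
- split; first exact: L2_cst.
  exists (fun _ _ => 0); first by move=> l _; exact: degenerate_kernel0.
  by apply: aeW => w; rewrite big1// => l _; rewrite /intD /Rintegral integral0.
- by move=> a Y Z [LY hY] [LZ hZ]; split; [exact: L2_lin|exact: hoeffding_sum_lin].
- move=> F Y hF LY /L2_cvgP FY; split => //.
  apply: (hoeffding_sum_closed (Yk := F)) => //.
  + by move=> k; case: (hF k).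
  + by move=> k; apply: L2_measurable; case: (hF k).
  + exact: L2_measurable.
Qed.

Lemma Rintegral_indicator d0 (T : measurableType d0) (mu : probability T R) U :
  measurable U -> \int[mu]_x (\1_U x) = fine (mu U).
Proof. by move=> mU; rewrite /Rintegral integral_indic// setIT. Qed.

Lemma indic_tbox n (B : 'I_n -> set A) (t : n.-tuple A) :
  \1_(tbox B) t = \prod_(i < n) \1_(B i) (tnth t i) :> R.
Proof.
rewrite indicE; have [Bt|nBt] := pselect (tbox B t).
  by rewrite mem_set// big1// => i _; rewrite indicE mem_set.
have /existsNP[i nBi] := nBt; rewrite memNset//.
by rewrite (bigD1 i)//= indicE memNset// mul0r.
Qed.

Lemma intD_box n (B : 'I_n -> set A) w : (forall i, measurable (B i)) ->
  intD n (fun s => \prod_(i < n) \1_(B i) (nth point s i)) w =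
  \prod_(i < n) fine (D w (B i)).
Proof.
move=> mB; rewrite /intD; under eq_Rintegral => t _.
  under eq_bigr do rewrite -tnth_nth.
  rewrite -indic_tbox; over.
by rewrite Rintegral_indicator ?Dpow_tbox//; exact: measurable_tbox.
Qed.

Lemma bounded_box n (B : 'I_n -> set A) (f : 'I_n -> 'I_n) : (forall i, measurable (B i)) ->
  bounded_kernel (fun s => \prod_(i < n) \1_(B (f i)) (nth point s i)).
Proof.
move=> mB; split.
  move=> k; apply: measurable_prod => i _; apply: measurableT_comp; last exact: measurable_nth_tuple.
  exact: measurable_indic.
exists 1 => s; rewrite normr_prod; apply: prodr_ile1 => i _.
by rewrite normr_ge0 indicE; case: (_ \in _); rewrite /= ?normr1 ?normr0.
Qed.

(** The random integral of the indicator of a box is a monomial of degree [l]; [sq_integrable_ind]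
    extends the membership to all square-integrable kernels, the contraction handling limits.
    Neither symmetry nor degeneracy is involved. *)
Lemma intD_in_span N V : closed_subspace P D V -> D_monomial D N `<=` V ->
  forall l F, (l <= N)%N -> seq_measurable F -> sq_integrable (law l) (seqf F (n:=l)) ->
  V (intD l F).
Proof.
move=> cV SV l F lN mF iF; have [VL V0 Vl Vc] := cV.
have mtot (f : l.-tuple A -> R) : measurable_fun setT f -> seq_measurable (fun s => f (totuple l s)).
  move=> mf k; apply: measurableT_comp => //; apply: measurable_totuple => i.
  exact: measurable_nth_tuple.
have seqE (f : l.-tuple A -> R) : seqf (fun s => f (totuple l s)) (n:=l) = f.
  by apply/funext => t; rewrite /seqf totupleK.
have Lf (f : l.-tuple A -> R) : sq_integrable (law l) f -> L2 P D (intD l (fun s => f (totuple l s))).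
  by move=> fi; apply: L2_intD; [apply: mtot; case: fi|rewrite seqE].
have boxV U : @tboxes _ A l U -> V (intD l (fun s => \1_U (totuple l s))).
  move=> [B mB ->]; apply: SV; exists l, B, (fun=> 1%N); split => //.
    by rewrite sum1_card card_ord.
  apply/funext => w; rewrite -(intD_box w mB) /intD; apply: eq_Rintegral => t _.
  by rewrite totupleK indic_tbox; apply: eq_bigr => i _; rewrite (tnth_nth point).
suff H : V (intD l (fun s => seqf F (n:=l) (totuple l s))).
  move: H; congr V; apply/funext => w; apply: eq_Rintegral => t _.
  by rewrite /seqf totupleK.
apply: (sq_integrable_ind (mu := law l) (G := @tboxes _ A l)
  (Q := fun f => V (intD l (fun s => f (totuple l s))))) => //.
- exact: measurable_tboxesE.
- exact: tboxesI.
- by apply: boxV; exact: tboxesT.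
- move=> a f g fi gi Vf Vg.
  apply: (closed_subspace_ae cV (Vl a _ _ Vf Vg)).
    by apply: (Lf (fun t => a * f t + g t)); exact: sq_integrable_lin.
  have := @intD_lin l (fun s => f (totuple l s)) (fun s => g (totuple l s)) a.
  rewrite !seqE => /(_ (sq_integrable_integrable fi) (sq_integrable_integrable gi)).
  by apply: filterS => w ->.
- move=> G f iG fi VG Gf; apply: (Vc _ _ VG (Lf f fi)); apply/L2_cvgP => e e0.
  apply: filterS (Gf e e0) => k; apply: le_trans.
  have iD := sq_integrable_lin (-1) fi (iG k).
  have := @sqn_intD l (fun s => (-1) * f (totuple l s) + G k (totuple l s)).
  rewrite (_ : seqf _ = G k \- f); last first.
    by apply/funext => t; rewrite /seqf /= totupleK mulN1r addrC.
  have mD : seq_measurable (fun s => (-1) * f (totuple l s) + G k (totuple l s)).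
    by apply: (mtot (fun t => -1 * f t + G k t)); case: iD.
  have iD' : sq_integrable (law l) (G k \- f).
    by move: iD; congr (sq_integrable _ _); apply/funext => t /=; rewrite mulN1r addrC.
  move=> /(_ mD iD'); apply: le_trans; rewrite le_eqVlt; apply/orP; left; apply/eqP; apply: eq_sqn_ae.
  + by apply: measurable_funB; apply: measurable_intD; apply: mtot; [case: (iG k)|case: fi].
  + exact: measurable_intD.
  have := @intD_lin l (fun s => f (totuple l s)) (fun s => G k (totuple l s)) (-1).
  rewrite !seqE => /(_ (sq_integrable_integrable fi) (sq_integrable_integrable (iG k))).
  by apply: filterS => w ->; rewrite mulN1r addrC.
Qed.

Lemma big_nth_setT N (L : seq (set A)) w : (size L <= N)%N ->
  \prod_(i < N) fine (D w (nth setT L i)) = \prod_(C <- L) fine (D w C).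
Proof.
move=> LN; rewrite -(big_mkord xpredT (fun i => fine (D w (nth setT L i)))).
rewrite (big_cat_nat _ LN)//= [X in _ * X]big1_seq ?mulr1; first by rewrite [RHS](big_nth setT).
move=> i /andP[_]; rewrite mem_index_iota => /andP[Li _].
by rewrite nth_default// prob_kernel.
Qed.

(** Each [C j] is repeated [k j] times, and the list is padded with the whole space, where [D w]
    equals 1. *)
Lemma D_monomialP N Y : D_monomial D N Y ->
  exists2 B : 'I_N -> set A, (forall i, measurable (B i)) &
    Y = (fun w => \prod_(i < N) fine (D w (B i))).
Proof.
move=> [n [C [k [mC _ kN ->]]]].
pose L := flatten [seq nseq (k j) (C j) | j <- index_enum 'I_n].
have sL : (size L <= N)%N.
  rewrite size_flatten /shape -map_comp sumnE big_map.
  by apply: leq_trans kN; under eq_bigr do rewrite /= size_nseq.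
exists (fun i => nth setT L i).
  move=> i; have [iL|iL] := ltnP i (size L); last by rewrite nth_default.
  have : all (fun U : set A => `[< measurable U >]) L.
    apply/allP => U /flattenP[_ /mapP[j _ ->]]; rewrite mem_nseq => /andP[_ /eqP ->].
    by apply/asboolP.
  by move=> /(all_nthP setT)/(_ _ iL)/asboolP.
apply/funext => w; rewrite big_nth_setT// big_flatten big_map.
by apply: eq_bigr => j _; rewrite big_nseq iter_mulr_1.
Qed.

(** The sequence form of the functions in [H_]: symmetrising provides the symmetry required by
    [hoeffding_bounded] and merely multiplies the random integral by [N!]. *)
Definition perm_kernel N (B : 'I_N -> set A) (s : seq A) : R :=
  \sum_(p : 'S_N) \prod_(j < N) \1_(B (p j)) (nth point s j).

Lemma bounded_sum (I : Type) (r : seq I) (F : I -> seq A -> R) :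
  (forall i, bounded_kernel (F i)) -> bounded_kernel (fun s => \sum_(i <- r) F i s).
Proof.
move=> hF; split; first by move=> k; apply: measurable_sum => i; exact: (hF i).1.
elim: r => [|i r [K hK]]; first by exists 0 => s; rewrite big_nil normr0.
have [_ [K' hK']] := hF i; exists (K' + K) => s; rewrite big_cons.
by apply: le_trans (ler_normD _ _) _; rewrite lerD.
Qed.

Lemma bounded_perm_kernel N (B : 'I_N -> set A) : (forall i, measurable (B i)) ->
  bounded_kernel (perm_kernel B).
Proof. by move=> mB; apply: bounded_sum => p; exact: bounded_box. Qed.

Lemma perm_kernel_symmetric N (B : 'I_N -> set A) : seq_symmetric N (perm_kernel B).
Proof.
move=> s s' sN; rewrite perm_sym => ss'.
have /eqP sN' : size s' = N by rewrite (perm_size ss').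
move/eqP: sN ss' => sN; rewrite -[s]/(tval (Tuple sN)) -[s']/(tval (Tuple sN')).
move: (Tuple sN) (Tuple sN') => t t' /tuple_permP[q tq].
rewrite /perm_kernel (reindex_inj (mulgI q^-1%g))/=; apply: eq_bigr => p _.
rewrite (reindex_inj (@perm_inj _ q))/=; apply: eq_bigr => j _.
rewrite permM permK; congr (\1_ _ _).
by rewrite tq -!tnth_nth tnth_mktuple.
Qed.

Lemma intD_perm_kernel N (B : 'I_N -> set A) w : (forall i, measurable (B i)) ->
  intD N (perm_kernel B) w = N`!%:R * \prod_(i < N) fine (D w (B i)).
Proof.
move=> mB; rewrite /intD /perm_kernel.
have [|_ ->] := @Rintegral_sum _ _ (Dpow N w) _ (index_enum 'S_N)
  (fun p (t : N.-tuple A) => \prod_(j < N) \1_(B (p j)) (nth point t j)).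
  move=> p _; have [mb [K hK]] := bounded_box p mB.
  by apply: (@bounded_integrable _ _ (Dpow N w) _ K); [exact: mb|move=> t; exact: hK].
rewrite (eq_bigr (fun=> \prod_(i < N) fine (D w (B i)))).
  by rewrite sumr_const card_Sn mulr_natl.
move=> p _; rewrite [RHS](reindex_inj (@perm_inj _ p)) -(intD_box w (fun i => mB (p i))).
by [].
Qed.

Lemma hoeffding_sum_prod N (B : 'I_N -> set A) : (forall i, measurable (B i)) ->
  hoeffding_sum N (fun w => \prod_(i < N) fine (D w (B i))).
Proof.
move=> mB.
have h := hoeffding_bounded (bounded_perm_kernel mB) (@perm_kernel_symmetric N B).
have h0 : hoeffding_sum N (fun=> 0).
  by case: (hoeffding_space_closed N) => _ [].
have := hoeffding_sum_lin (N`!%:R^-1) h h0.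
by congr hoeffding_sum; apply/funext => w; rewrite intD_perm_kernel// addr0 mulKf// pnatr_eq0 -lt0n fact_gt0.
Qed.

Lemma D_monomial_L2 N Y : D_monomial D N Y -> L2 P D Y.
Proof.
move=> /D_monomialP[B mB ->].
have [mb [K hK]] := bounded_box id mB.
rewrite (_ : (fun _ => _) = intD N (fun s => \prod_(i < N) \1_(B i) (nth point s i))).
  by apply: L2_intD => //; apply: (@sq_integrable_bounded _ _ _ _ _ K) => //; [exact: mb|move=> t; exact: hK].
by apply/funext => w; rewrite intD_box.
Qed.

Lemma L2_closed : closed_subspace P D (L2 P D).
Proof.
split => //; first exact: L2_cst.
by move=> a Y Z; exact: L2_lin.
Qed.

Lemma P_closed N : closed_subspace P D (P_ P D N).
Proof. apply: closed_subspace_span; [exact: L2_closed|exact: D_monomial_L2]. Qed.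

Lemma D_monomial_P N : D_monomial D N `<=` P_ P D N.
Proof. by move=> Y hY V [_]; exact. Qed.

(** One inclusion is the minimality of the closed span, once [hoeffding_space] is known to be
    closed; the other is [intD_in_span] applied degree by degree. *)
Lemma hoeffding_spaceE N : P_ P D N = hoeffding_space N.
Proof.
apply/seteqP; split.
  apply: smallest_sub; first exact: hoeffding_space_closed.
  move=> Y hY; split; first exact: D_monomial_L2 hY.
  by have [B mB ->] := D_monomialP hY; exact: hoeffding_sum_prod.
move=> Y [LY [F hF YF]].
have [VL V0 Vl Vc] := P_closed N.
apply: (closed_subspace_ae (P_closed N) _ LY (Y := intD_sum N.+1 F)); last first.
  by apply: filterS YF => w ->.
have : (N.+1 <= N.+1)%N by [].
move: {-2}N.+1 => M; elim: M => [_|M IH MN].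
  rewrite (_ : intD_sum 0 F = cst 0)//; apply/funext => w.
  by rewrite /intD_sum big_ord0.
rewrite (_ : intD_sum M.+1 F = (fun w => 1 * intD_sum M F w + intD M (F M) w)); last first.
  by apply/funext => w; rewrite /intD_sum big_ord_recr mul1r.
apply: Vl; first by apply: IH; exact: ltnW.
have [mF _ iF _] := hF M MN.
by apply: (intD_in_span (P_closed N) (@D_monomial_P N)).
Qed.

(** * Degenerate kernels and the spaces [M_] *)

Lemma totuple_X_prefix m n w : (m <= n)%N -> totuple m (X_prefix X n w) = X_prefix X m w.
Proof.
move=> mn; apply: eq_from_tnth => i; rewrite !tnth_mktuple.
have im : (i < n)%N by apply: leq_trans mn.
by rewrite -[i : nat]/(nat_of_ord (Ordinal im)) -tnth_nth tnth_mktuple.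
Qed.

Lemma symmetric_funP n (h : n.-tuple A -> R) :
  symmetric_fun h <-> seq_symmetric n (fun s => h (totuple n s)).
Proof.
split=> [sh s s' sn|sh p a]; last first.
  rewrite -[in RHS](totupleK a) -[in LHS](totupleK (mktuple _)).
  by apply: sh; rewrite ?size_tuple//; apply/tuple_permP; exists p.
have /eqP sn0 := sn; move=> ss'; have /eqP sn' : size s' = n by rewrite -(perm_size ss').
move: ss'; rewrite -[s]/(tval (Tuple sn0)) -[s']/(tval (Tuple sn')).
move: (Tuple sn0) (Tuple sn') => t t' /tuple_permP[p tp].
rewrite !totupleK -[RHS](sh p); congr h; exact: val_inj.
Qed.

(** [degenerate] conditions on the last [m] variables and [Xi] on the first [m]. A rotation of the
    coordinates preserves the law and the symmetric [F], and exchanges the two. *)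
Lemma law_step_back m F (U : set (m.-tuple A)) : measurable U -> seq_measurable F ->
  seq_symmetric m.+1 F ->
  \int[law m.+1]_t (F t * \1_U (totuple m (behead t))) =
  \int[law m.+1]_t (F t * \1_U (totuple m t)).
Proof.
move=> mU mF sF.
have mG : seq_measurable (fun s => F s * \1_U (totuple m (behead s))).
  move=> k; apply: measurable_funM; first exact: mF.
  apply: measurableT_comp; first exact: measurable_indic.
  by apply: measurable_totuple => i; under eq_fun do rewrite nth_behead; exact: measurable_nth_tuple.
rewrite -(law_select (selects_rotr m.+1) mG); apply: eq_Rintegral => t _.
congr (_ * \1_U _).
  by apply/esym; apply: sF; rewrite ?size_tuple// perm_sym perm_rotr.
apply: eq_from_tnth => i; rewrite !tnth_mktuple nth_behead.
case/tupleP: t => a t; have [b [s E]] : exists b s, a :: t = rcons s b :> seq A.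
  by exists (last a t), (belast a t); rewrite lastI.
rewrite /= E rotr1_rcons /= nth_rcons.
have -> : size s = m by have := congr1 size E; rewrite /= size_rcons size_tuple => -[].
by rewrite ltn_ord.
Qed.

(** The preimages under [X_prefix X m] are exactly the events of the conditioning sigma-field, so
    the vanishing conditional expectation is the family of integrals in [degenerate], up to
    [law_step_back]. *)
Lemma XiP m (h : m.+1.-tuple A -> R) :
  Xi X h <-> degenerate_kernel m.+1 (fun s => h (totuple m.+1 s)).
Proof.
set F := fun s => h (totuple m.+1 s).
have FE (t : m.+1.-tuple A) : F t = h t by rewrite /F totupleK.
have seqE : seqf F (n:=m.+1) = h by apply/funext => t; exact: FE.
have mF : measurable_fun setT h <-> seq_measurable F.
  split=> [mh k|/(_ m.+1)]; last by rewrite -/(seqf F (n:=m.+1)) seqE.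
  apply: measurableT_comp => //; apply: measurable_totuple => i.
  exact: measurable_nth_tuple.
have sqE : measurable_fun setT h -> 'E_P[fun w => (h (X_prefix X m.+1 w) ^+ 2)%R]%E = sqn (law m.+1) h.
  move=> mh; rewrite unlock /sqn.
  by rewrite /law ge0_integral_distribution//; [exact: measurable_sqr|move=> y; rewrite lee_fin sqr_ge0].
have key U : measurable U -> seq_measurable F -> seq_symmetric m.+1 F ->
    sq_integrable (law m.+1) h ->
    (\int[P]_(w in setT `&` X_prefix X m @^-1` U) (h (X_prefix X m.+1 w))%:E =
    (\int[law m.+1]_t (F t * \1_U (totuple m (behead t))))%:E)%E.
  move=> mU mF' sF ih; rewrite law_step_back//.
  have mb : measurable_fun setT (fun t : m.+1.-tuple A => \1_U (totuple m t) : R).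
    apply: measurableT_comp; first exact: measurable_indic.
    by apply: measurable_totuple => i; exact: measurable_nth_tuple.
  have ib : sq_integrable (law m.+1) (fun t : m.+1.-tuple A => \1_U (totuple m t) : R).
    apply: (@sq_integrable_bounded _ _ _ _ _ 1) => // t.
    by rewrite indicE; case: (_ \in _); rewrite /= ?normr1 ?normr0.
  have ihb := sq_integrable_mul ih ib.
  under [in RHS]eq_Rintegral do rewrite FE.
  have mhb : measurable_fun setT (fun t : m.+1.-tuple A => h t * \1_U (totuple m t)).
    by apply: measurable_funM => //; case: ih.
  rewrite (Rintegral_distribution P (X_prefix X m.+1) mhb).
  rewrite /Rintegral fineK; last first.
    by apply: integrable_fin_num => //; exact/(integrable_distribution P (X_prefix X m.+1) mhb).
  rewrite setTI [LHS]integral_mkcond; apply: eq_integral => w _; rewrite /patch totuple_X_prefix//.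
  rewrite indicE; have [Uw|nUw] := pselect (U (X_prefix X m w)).
    by rewrite !mem_set// mulr1.
  by rewrite !memNset// mulr0.
have dE : seq_measurable F -> seq_symmetric m.+1 F -> sq_integrable (law m.+1) h ->
    cond_expectation P (g_sigma_algebra_preimage (X_prefix X m)) (h \o X_prefix X m.+1) (cst 0) <->
    degenerate m.+1 F.
  move=> mF' sF ih; split=> [[_ _ hc] U mU|dF].
    have /hc : g_sigma_algebra_preimage (X_prefix X m) (setT `&` X_prefix X m @^-1` U).
      by exists U.
    rewrite integral0 => /esym; rewrite [X in X = _](key _ mU mF' sF ih).
    by move=> /eqP; rewrite eqe => /eqP.
  split.
  - move=> B mB; rewrite preimage_cst; case: ifP => _.
      by exists setT => //; rewrite setTI preimage_setT.
    by exists set0 => //; rewrite setTI preimage_set0.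
  - exact: integrable0.
  move=> _ [U mU <-]; rewrite [RHS](key _ mU mF' sF ih) (dF U mU) /=.
  by rewrite integral0.
split=> [[sh mh h2 hc]|[mF' sF iF dF]].
  have mF' := mF.1 mh; have sF := (symmetric_funP h).1 sh.
  have ih : sq_integrable (law m.+1) h by split => //; rewrite -sqE.
  by split => //; [rewrite seqE|exact/dE].
move: iF; rewrite seqE => ih; have mh := mF.2 mF'.
split => //; first exact/symmetric_funP.
  by rewrite sqE//; case: ih.
exact/dE.
Qed.

Lemma M_degenerate l Y : M_ X D l Y -> L2 P D Y /\
  exists2 F, degenerate_kernel l F & {ae P, forall w, Y w = intD l F w}.
Proof.
case: l => [[LY [k Yk]]|l [LY [h /XiP hh Yh]]]; split => //.
  exists (fun=> k).
    by split => //; exact: sq_integrable_cst.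
  by apply: filterS Yk => w ->; rewrite /intD (Rintegral_cst_prob (Dpow 0 w)).
exists (fun s => h (totuple l.+1 s)) => //.
apply: filterS Yh => w ->; rewrite /intD; apply: eq_Rintegral => t _.
by rewrite totupleK.
Qed.

Lemma degenerate_M l F : degenerate_kernel l F -> M_ X D l (intD l F).
Proof.
move=> hF; have [mF sF iF dF] := hF.
have L := L2_intD mF iF.
case: l hF mF sF iF dF L => [|l] hF mF sF iF dF L; split => //.
  (* [Dpow 0 w] is the point mass at the empty tuple, whatever [w] is. *)
  exists (\int[\d_([tuple] : 0.-tuple A)]_t F t).
  by apply: aeW.
exists (seqf F (n:=l.+1)); last by apply: aeW.
by apply/XiP; exact: degenerate_kernel_totuple hF.
Qed.

Lemma M_orthogonal l m Y Z : l != m -> M_ X D l Y -> M_ X D m Z -> ('E_P[(Y \* Z)%R] = 0)%E.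
Proof.
move=> lm /M_degenerate[LY [F hF YF]] /M_degenerate[LZ [G hG ZG]].
have := degenerate_orthogonal lm hF hG.
have mY := L2_measurable LY; have mZ := L2_measurable LZ.
rewrite -(@ae_eq_Rintegral _ _ P (Y \* Z)); first last.
- by apply: filterS2 YF ZG => w /= -> ->.
- by apply: measurable_funM; apply: measurable_intD; [case: hF|case: hG].
- exact: measurable_funM.
move=> E; rewrite unlock -[LHS]fineK; first by congr EFin.
apply: integrable_fin_num => //.
have := sq_integrable_mul (L2_sq_integrable LY) (L2_sq_integrable LZ).
by congr (integrable _ _ _).
Qed.

Lemma L2_sum n (Z : nat -> Omega -> R) : (forall l, (l < n)%N -> L2 P D (Z l)) ->
  L2 P D (fun w => \sum_(l < n) Z l w).
Proof.
elim: n => [|n IH] hZ; first by under eq_fun do rewrite big_ord0; exact: (L2_cst 0).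
rewrite (_ : (fun _ => _) = (fun w => 1 * \sum_(l < n) Z l w + Z n w)); last first.
  by apply/funext => w; rewrite big_ord_recr mul1r.
by apply: L2_lin; [apply: IH => l ln; apply: hZ; exact: ltnW|exact: hZ].
Qed.

Lemma P_direct_sum N : orthogonal_direct_sum P (M_ X D) N (P_ P D N).
Proof.
split; first by move=> l m Y Z _ _; exact: M_orthogonal.
rewrite hoeffding_spaceE; apply/seteqP; split=> Y.
  move=> [LY [F hF YF]].
  (* The direct sum demands equality at every point, while the expansion of [Y] is only almost sure.
     The discrepancy goes into the component of degree 0, whose elements need only be constant
     almost surely. *)
  pose Y' w := (-1) * \sum_(l < N) intD l.+1 (F l.+1) w + Y w.
  exists (fun l => if l is 0 then Y' else intD l (F l)); last first.
    by apply/funext => w; rewrite big_ord_recl /Y' /= mulN1r addrC addrA addrN add0r.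
  move=> [_|l lN]; last exact/degenerate_M/hF.
  split.
    apply: L2_lin => //; apply: (L2_sum (Z := fun l => intD l.+1 (F l.+1))) => l lN.
    by have [mF _ iF _] := hF l.+1 lN; exact: L2_intD.
  exists (\int[\d_([tuple] : 0.-tuple A)]_t F 0%N t).
  apply: filterS YF => w; rewrite /Y' => ->.
  by rewrite big_ord_recl /= mulN1r addrC -addrA addrN addr0.
move=> [Z hZ ->]; split.
  by apply: L2_sum => l; rewrite ltnS => /hZ/M_degenerate[].
have /choice[F hF] : forall l, exists F, (l <= N)%N -> degenerate_kernel l F /\
    {ae P, forall w, Z l w = intD l F w}.
  move=> l; have [lN|lN] := leqP l N; last by exists (fun=> 0).
  by have /M_degenerate[_ [F hF ZF]] := hZ l lN; exists F.
exists F; first by move=> l /hF[].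
have h : {ae P, forall w, forall l : 'I_N.+1, Z l w = intD l (F l) w}.
  by apply: (ae_forall_ord (Q := fun l w => Z l w = intD l (F l) w)) => l /hF[].
by apply: filterS h => w h; apply: eq_bigr => l _; exact: h.
Qed.

Definition sym_box N (C : 'I_N -> set A) (a : N.-tuple A) : R :=
  \sum_(s : 'S_N) \prod_(j < N) \1_(C (s j)) (tnth a j).

(** * U-statistics *)

Section U_statistics.
Variables (N : nat) (C : 'I_N -> set A).
Hypothesis mC : forall j, measurable (C j).

Let x K w (i : 'I_N) (k : 'I_K) : R := \1_(C i) (X k w).

Let x01 K w i (k : 'I_K) : 0 <= x w i k <= 1.
Proof. by rewrite /x indicE; case: (_ \in _); rewrite /= ?lexx ler01. Qed.

Let U_statisticE K w :
  U_statistic X (sym_box C) K w = ('C(K, N)%:R)^-1 * sorted_sum (x w : 'I_N -> 'I_K -> R).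
Proof.
rewrite /U_statistic /sorted_sum; congr (_ * _); apply: eq_bigr => j _.
by apply: eq_bigr => p _; apply: eq_bigr => i _; rewrite tnth_mktuple.
Qed.

Let U_statistic_cvg : {ae P, forall w,
  U_statistic X (sym_box C) K w @[K --> \oo] --> N`!%:R * \prod_(i < N) fine (D w (C i))}.
Proof.
have := @ae_forall_ord _ _ P N (fun i w => forall h : (i < N)%N,
  K%:R^-1 * \sum_(k < K) \1_(C (Ordinal h)) (X k w) @[K --> \oo] --> fine (D w (C (Ordinal h)))).
move=> [|Z [mZ PZ0 hZ]].
  by move=> l lN; apply: filterS (hXD (mC (Ordinal lN))) => w h lN'; rewrite (bool_irrelevance lN' lN).
exists Z; split => // w /= nw; apply: hZ => h; apply: nw.
have hw (i : 'I_N) : K%:R^-1 * \sum_(k < K) \1_(C i) (X k w) @[K --> \oo] --> fine (D w (C i)).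
  by have := h i (ltn_ord i); rewrite (_ : Ordinal _ = i)//; exact: val_inj.
pose e K : R := \prod_(i < N) (K%:R^-1 * \sum_(k < K) \1_(C i) (X k w)).
pose r K : R := K%:R ^+ N / 'C(K, N)%:R.
have he : e K @[K --> \oo] --> \prod_(i < N) fine (D w (C i)) by exact: cvg_prodr.
have hr : r K @[K --> \oo] --> (N`!%:R : R) by exact: cvg_binomial_ratio.
have hre : r K * e K @[K --> \oo] --> N`!%:R * \prod_(i < N) fine (D w (C i)) by exact: cvgM.
(* [sorted_sum_bound] divided by ['C(K, N)] encloses the statistic between these two sequences,
   whose gap [r K - N!] tends to 0. *)
apply: (squeeze_cvgr (f := fun K => r K * e K - (r K - N`!%:R)) (h := fun K => r K * e K)) => //.
- near=> K; have NK : (N < K)%N by near: K; exists N.+1.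
  have K0 : K%:R != 0 :> R by rewrite pnatr_eq0; case: (K) NK.
  have C0 : 0 < 'C(K, N)%:R :> R by rewrite ltr0n bin_gt0 ltnW.
  have /andP[h1 h2] := sorted_sum_bound (@x01 K w).
  have E : \prod_(i < N) \sum_(k < K) x w i k = K%:R ^+ N * e K.
    have -> : K%:R ^+ N = \prod_(i < N) K%:R :> R by rewrite prodr_const card_ord.
    by rewrite -big_split/=; apply: eq_bigr => i _; rewrite mulVKf.
  rewrite U_statisticE /r; rewrite E in h1 h2; apply/andP; split; last first.
    by rewrite mulrAC mulrC ler_pM2r ?invr_gt0.
  rewrite lerBlDr mulrAC ler_pdivrMr// mulrDl mulrBl mulrAC mulVf ?gt_eqF// mul1r.
  rewrite divfK ?gt_eqF//; move: h2; rewrite natrM [_ * N`!%:R]mulrC; exact.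
- rewrite -[X in _ --> X](subr0 (N`!%:R * _)) -(subrr (N`!%:R : R)).
  by apply: (cvgB hre (cvgB hr _)); exact: cvg_cst.
Unshelve. all: by end_near. Qed.

(** The bound is uniform in [K], as dominated convergence requires. For [K < N] the statistic is 0,
    since the inverse of a zero binomial coefficient is 0. *)
Let U_statistic_bound K w : `|U_statistic X (sym_box C) K w| <= N`!%:R.
Proof.
rewrite U_statisticE; have [NK|KN] := leqP N K; last first.
  by rewrite bin_small// invr0 mul0r normr0.
have C0 : 0 < 'C(K, N)%:R :> R by rewrite ltr0n bin_gt0.
have s0 : 0 <= sorted_sum (@x K w).
  apply: sumr_ge0 => j _; apply: sumr_ge0 => p _; apply: prodr_ge0 => i _.
  by case/andP: (x01 w (p i) (tnth j i)).
rewrite ger0_norm; last by rewrite mulr_ge0 ?invr_ge0// ltW.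
rewrite mulrC ler_pdivrMr//.
apply: (@le_trans _ _ (\sum_(j : N.-tuple 'I_K | sorted ltn (map val j)) N`!%:R)).
  apply: ler_sum => j _; rewrite -card_Sn -sumr_const; apply: ler_sum => p _.
  by apply: prodr_ile1 => i _; exact: x01.
rewrite sumr_const -(card_ltn_sorted_tuples N K) mulr_natr le_eqVlt; apply/orP; left.
by apply/eqP; congr (_ *+ _); apply: eq_card => t; rewrite inE.
Qed.

Lemma measurable_U_statistic K : measurable_fun setT (U_statistic X (sym_box C) K).
Proof.
rewrite (_ : U_statistic _ _ _ = (fun w => ('C(K, N)%:R)^-1 * sorted_sum (@x K w))); last first.
  by apply/funext => w; exact: U_statisticE.
apply: measurable_funM; first exact: measurable_cst.
under eq_fun do rewrite /sorted_sum big_mkcond.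
apply: measurable_sum => j; case: (sorted _ _); last exact: measurable_cst.
apply: measurable_sum => p.
apply: measurable_prod => i _; apply: measurableT_comp; first exact: measurable_indic.
exact: measurable_funP.
Qed.

Lemma L2_prod : L2 P D (fun w => N`!%:R * \prod_(i < N) fine (D w (C i))).
Proof.
rewrite (_ : (fun _ => _) = intD N (perm_kernel C)); last first.
  by apply/funext => w; rewrite intD_perm_kernel.
have [mb [K hK]] := bounded_perm_kernel mC.
by apply: L2_intD => //; apply: (@sq_integrable_bounded _ _ _ _ _ K) => //; [exact: mb|move=> t; exact: hK].
Qed.

Lemma U_statistic_L2_cvg : L2_cvg P (U_statistic X (sym_box C))
  (fun w => N`!%:R * \prod_(i < N) fine (D w (C i))).
Proof.
apply/L2_cvgP; apply: (sq_cvg_dominated (g := cst (N`!%:R + N`!%:R))).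
- exact: measurable_U_statistic.
- exact/L2_measurable/L2_prod.
- exact: sq_integrable_cst.
- exact: U_statistic_cvg.
move=> K w; apply: le_trans (ler_normB _ _) _; apply: lerD; first exact: U_statistic_bound.
rewrite normrM normr_nat ler_piMr// normr_prod; apply: prodr_ile1 => i _.
rewrite normr_ge0/= ger0_norm ?fine_ge0//.
have := probability_le1 (kernel_at D w) (mC i); rewrite -[X in (X <= _)%E]fineK ?lee_fin//.
exact: fin_num_measure.
Qed.

End U_statistics.

(** The limit of the statistics of a symmetrised box is [N!] times a product of [N] values of [D],
    and by padding every monomial is such a product. Conversely, any other limit of the same
    statistics agrees with it almost surely. *)
Lemma P_U_limit N : P_ P D N = closed_span P D (U_limit X D N).
Proof.
have cU : closed_subspace P D (closed_span P D (U_limit X D N)).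
  by apply: closed_subspace_span; [exact: L2_closed|move=> Y []].
have [_ P0 Pl _] := P_closed N; have [_ U0 Ul _] := cU.
apply/seteqP; split; apply: smallest_sub => //.
- move=> Y hY; have [B mB ->] := D_monomialP hY.
  rewrite (_ : (fun _ => _) =
      (fun w => N`!%:R^-1 * (N`!%:R * \prod_(i < N) fine (D w (B i))) + cst 0 w)); last first.
    by apply/funext => w; rewrite addr0 mulKf// pnatr_eq0 -lt0n fact_gt0.
  apply: Ul => // V [_ SV]; apply: SV; split; first exact: L2_prod.
  exists (sym_box B); last exact: U_statistic_L2_cvg.
  by exists B.
- exact: P_closed.
move=> Y [LY [h [C mC ->] hY]].
apply: (closed_subspace_ae (P_closed N) _ LY (Y := fun w => N`!%:R * \prod_(i < N) fine (D w (C i)) + cst 0 w)).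
  apply: Pl => //; apply: D_monomial_P; exists N, C, (fun=> 1%N); split => //.
  by rewrite sum1_card card_ord.
have /L2_cvgP hC := U_statistic_L2_cvg mC; have /L2_cvgP hY' := hY.
have : {ae P, forall w, N`!%:R * \prod_(i < N) fine (D w (C i)) = Y w}.
  apply: (sq_cvg_unique _ _ _ hC hY') => [K||].
  - exact: measurable_U_statistic.
  - exact/L2_measurable/L2_prod.
  - exact: L2_measurable.
by apply: filterS => w <-; rewrite addr0.
Qed.

End polya_laws.

Theorem proposition6 (R : realType) (A : ptopologicalType) (hA : polish R A)
  (alpha : {finite_measure set (borel A) -> \bar R})
  (halpha : (0 < alpha setT)%E)
  (d : measure_display) (Omega : measurableType d) (P : probability Omega R)
  (D : R.-pker Omega ~> borel A) (hD : dirichlet_ferguson P alpha D)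
  (X : nat -> {RV P >-> borel A}) (hX : polya_sequence alpha X)
  (hXD : empirical_limit X D)
  (N : nat) (hN : (1 <= N)%N) :
  orthogonal_direct_sum P (M_ X D) N (P_ P D N) /\
  (forall h : N.-tuple (borel A) -> R, H_ h -> exists2 Y, L2 P D Y & L2_cvg P (U_statistic X h) Y) /\
  P_ P D N = closed_span P D (U_limit X D N).
Proof.
split; first exact: (P_direct_sum halpha hX hXD).
split; last exact: (P_U_limit hX hXD).
move=> h [C mC ->].
exists (fun w => N`!%:R * \prod_(i < N) fine (D w (C i))).
  exact: (L2_prod hX hXD mC).
exact: (U_statistic_L2_cvg hX hXD mC).
Qed.
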